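(* Let $\varphi:\mathbb P^1\to\mathbb P^1$ be a branched Galois covering of degree $2$ with Galois group $C_2$; up to Möbius transformations, $\varphi$ is $w\mapsto w^2$, $w=x/y$. Let $g([x,y]):\mathbb P^1\to\mathbb P^3$ be a holomorphic curve which is a Galois lift, with covering $\varphi$, of a sextic curve $F$ in $\mathcal V_5$, so $f_1\circ g=F\circ\varphi$. Then, up to Möbius transformations on $\mathbb P^1$ and $PSL_2$-equivalence, $\deg g=2$ or $3$, and the following classification holds. (1) If $\deg g=2$, then $$g=\begin{pmatrix}1&0&a_3\\0&1&b_3\end{pmatrix}\begin{pmatrix}x^2&xy&y^2\\-\xi_1x^2&\xi_1xy&-\xi_1y^2\end{pmatrix}^T,$$ where $\xi_1=\exp(\frac{\pi i}4)$. Such curves form a $\mathbb P^1$-parameterized family with $[a_3,b_3]$ as the parameter. The sextic curve $F$ determined by $g$ is generally ramified. (2) If $\deg g=3$, then $$g=\begin{pmatrix}1&0&a_3&a_4\\0&1&b_3&b_4\end{pmatrix}\begin{pmatrix}x^3&0&xy^2&0\\0&x^2y&0&y^3\end{pmatrix}^T,$$ where $\begin{pmatrix}1&0&a_3&a_4\\0&1&b_3&b_4\end{pmatrix}\in G(2,4)$ is the unique plane in $\mathbb C^4$ perpendicular to $(1,-1,1,-1)$ and $(it^3,-t^2,it,-1)$ under the usual bilinear inner product. Such curves constitute a $\mathbb C\setminus\{0\}$-parameterized family with $t$ as the parameter. The sextic curve $F$ determined by $g$ belongs to the exceptional transversal family.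
   Context: The ground field is $\mathbb C$. $V_n$ is the space of binary forms of degree $n$ in $u,v$, with $SL_2=SL_2(\mathbb C)$ acting by $(A\cdot f)(u,v)=f(A^{-1}(u,v)^T)$. $\mathcal V_5\subset\mathbb P(V_6)=\mathbb P^6$ is the closure of $PSL_2\cdot[uv(u^4-v^4)]$; it is the disjoint union of this open orbit, the $2$-dimensional orbit $PSL_2\cdot[u^5v]$ and the $1$-dimensional orbit $PSL_2\cdot[u^6]$. A sextic curve is a holomorphic curve $F:\mathbb P^1\to\mathcal V_5\subset\mathbb P^6$ of degree $6$, linearly full in $\mathbb P^6$, not contained in $\overline{PSL_2\cdot[u^5v]}$. It is in the generally ramified family if it is tangent to the $1$-dimensional orbit at some point where it meets that orbit; otherwise it is in the exceptional transversal family. Points of $\mathbb P^3$ are nonzero $2\times2$ matrices $\begin{pmatrix}a&b\\c&d\end{pmatrix}$ up to scale, and $f_1:\mathbb P^3\dashrightarrow\mathbb P(V_6)$ sends this matrix to $[(du-bv)(av-cu)((du-bv)^4-(av-cu)^4)]$; on $PSL_2$ it is the orbit map of $[uv(u^4-v^4)]$. $S_4^*\subset SU(2)$ is the binary octahedral group (order $48$) generated by $\mathrm{diag}(e^{\pi i/4},e^{-\pi i/4})$ and $\frac1{\sqrt2}\begin{pmatrix}1&-1\\1&1\end{pmatrix}$; its image in $PSL_2$ is the stabilizer of $[uv(u^4-v^4)]$. A branched covering $\varphi$ is Galois if its group $G=\{\sigma:\varphi\circ\sigma=\varphi\}$ has order $\deg\varphi$. A map $g:\mathbb P^1\to\mathbb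 P^3$ of degree $n$ is a $2\times2$ matrix of degree-$n$ forms in $x,y$ without common factor. It is a Galois lift of $F$ with covering $\varphi$ if $f_1\circ g=F\circ\varphi$ and the homomorphism $\sigma\mapsto g(\sigma(q))^{-1}g(q)$ (independent of generic $q$) from $G$ to the stabilizer of $[uv(u^4-v^4)]$ is injective. Two curves $g,\tilde g:\mathbb P^1\to\mathbb P^3$ are $PSL_2$-equivalent if $AgB^T=\tilde g$ for some $A\in SL_2$, $B\in S_4^*$. Möbius transformations may be applied to both copies of $\mathbb P^1$ (source and target of $\varphi$). $G(2,k)$ is the Grassmannian of $2$-planes in $\mathbb C^k$; a $2\times k$ matrix of rank $2$ denotes its row space. The bilinear inner product is $\sum_i p_iq_i$ (no conjugation).
   Formalization: Family claims hold for parameters where f1∘g is linearly full (all but finitely many; e.g. at t=1 g has a common factor, at t=-i the plane is not of the displayed form); [a3,b3] is read as weighted, i.e. as the point [a3:b3^2] of P^1, since (1,1) and (2,2) give inequivalent curves. *)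

(* Defs.v *)
From HB Require Import structures.
From mathcomp Require Import all_boot all_order all_algebra.
From mathcomp Require Import complex.
From mathcomp Require Import all_classical all_reals all_analysis.

Set Implicit Arguments.
Unset Strict Implicit.
Unset Printing Implicit Defensive.

Import Order.TTheory GRing.Theory Num.Theory.
Import numFieldNormedType.Exports.

Local Open Scope ring_scope.
Local Open Scope complex_scope.

Section Definitions.
Variable R : realType.
Local Notation C := R[i].

(* Two nonzero vectors that represent the same point of P(V). *)
Definition peq (V : lmodType C) (v w : V) : Prop :=
  exists c : C, c != 0 /\ v = c *: w.

Definition mx_of (m n : nat) (s : seq (seq C)) : 'M[C]_(m, n) :=
  \matrix_(i < m, j < n) nth 0 (nth [::] s i) j.

Definition expi (x : R) : C := cos x +i* sin x.
Definition xi1 : C := expi (pi / 4%:R).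

(* [S4star] is generated by the two matrices under product and inverse. *)
Inductive S4star : 'M[C]_2 -> Prop :=
| S4star_diag : S4star (mx_of 2 2 [:: [:: expi (pi / 4%:R); 0];
                                      [:: 0; expi (- (pi / 4%:R))]])
| S4star_rot : S4star ((Num.sqrt (2%:R : R))^-1%:C *:
                       mx_of 2 2 [:: [:: 1; -1]; [:: 1; 1]])
| S4star1 : S4star 1%:M
| S4starM A B : S4star A -> S4star B -> S4star (A *m B)
| S4starV A : S4star A -> S4star (invmx A).

(* A binary form of degree n in u, v is the row of its coefficients; the
   entry of index i is the coefficient of u^(n-i) v^i. *)
Definition binform (n : nat) := 'rV[C]_n.+1.

(* The form of degree n that becomes p after u := 'X, v := 1 (size p <= n+1) *)
Definition homogenize (n : nat) (p : {poly C}) : binform n :=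
  \row_(i < n.+1) p`_(n - i).

(* (A . f)(u, v) = f (A^-1 (u, v)^T) *)
Definition act (n : nat) (A : 'M[C]_2) (f : binform n) : binform n :=
  let B := invmx A in
  let U := B 0 0 *: 'X + (B 0 1)%:P in
  let V := B 1 0 *: 'X + (B 1 1)%:P in
  homogenize n (\sum_(j < n.+1) f 0 j *: (U ^+ (n - j) * V ^+ j)).

Definition octahedral_form : binform 6 := homogenize 6 ('X * ('X ^+ 4 - 1)).
Definition u6 : binform 6 := homogenize 6 ('X ^+ 6).
Definition u5v : binform 6 := homogenize 6 ('X ^+ 5).

(* The affine cone, without 0, over the orbit PSL_2 . [f] in P(V_n) *)
Definition orbit (n : nat) (f : binform n) : set (binform n) :=
  [set h | exists (A : 'M[C]_2) (c : C),
     [/\ \det A = 1, c != 0 & h = c *: act A f]].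

(* Since a cone minus 0 is the preimage of a subset of P(V_n) under the open
   quotient map, closures may be taken in V_n \ {0}. *)
Definition orbit_closure (n : nat) (f : binform n) : set (binform n) :=
  [set h | h != 0 /\ closure (orbit f : set 'rV[C^o]_n.+1) h].

Definition V5 : set (binform 6) := orbit_closure octahedral_form.

(* Points of P^1 are nonzero columns q = (x, y)^T. A vector-valued form
   sum_i x^(n-i) y^i c_i of degree n is given by its coefficients c_i. *)
Definition vform (V : lmodType C) (n : nat) := 'I_n.+1 -> V.

Definition ev (V : lmodType C) (n : nat) (c : vform V n) (q : 'cV[C]_2) : V :=
  \sum_(i < n.+1) (q 0 0 ^+ (n - i) * q 1 0 ^+ i) *: c i.

Definition ev_dx (V : lmodType C) (n : nat) (c : vform V n) (q : 'cV[C]_2) : V :=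
  \sum_(i < n.+1) ((n - i)%:R * q 0 0 ^+ (n - i).-1 * q 1 0 ^+ i) *: c i.

Definition ev_dy (V : lmodType C) (n : nat) (c : vform V n) (q : 'cV[C]_2) : V :=
  \sum_(i < n.+1) (i%:R * q 0 0 ^+ (n - i) * q 1 0 ^+ i.-1) *: c i.

(* A map P^1 -> P(V) of degree n. Over C, forms in two variables have no
   common factor iff they have no common zero on P^1. *)
Definition curve (V : lmodType C) (n : nat) (g : 'cV[C]_2 -> V) : Prop :=
  (exists c : vform V n, forall q, g q = ev c q) /\
  (forall q, q != 0 -> g q != 0).

Definition linearly_full (k : nat) (H : 'cV[C]_2 -> 'rV[C]_k) : Prop :=
  forall l : 'cV[C]_k, (forall q, q != 0 -> H q *m l = 0) -> l = 0.

Definition sextic_curve (F : vform (binform 6) 6) : Prop :=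
  [/\ curve 6 (ev F),
      forall q, q != 0 -> V5 (ev F q),
      linearly_full (ev F) &
      exists q, q != 0 /\ ~ orbit_closure u5v (ev F q)].

(* The tangent line of F at q is spanned by the two partial derivatives; that
   of the orbit of [u^6] at [A . u^6] is spanned by A . u^6 and A . u^5 v. *)
Definition tangent_to_1dim_orbit (F : vform (binform 6) 6) : Prop :=
  exists (q : 'cV[C]_2) (A : 'M[C]_2),
    [/\ q != 0, \det A = 1, peq (ev F q) (act A u6) &
        (col_mx (ev_dx F q) (ev_dy F q) :=: col_mx (act A u6) (act A u5v))%MS].

Definition generally_ramified (F : vform (binform 6) 6) : Prop :=
  sextic_curve F /\ tangent_to_1dim_orbit F.

Definition exceptional_transversal (F : vform (binform 6) 6) : Prop :=
  sextic_curve F /\ ~ tangent_to_1dim_orbit F.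

(* The rational map P^3 --> P(V_6), undefined where the value is 0 *)
Definition f1 (M : 'M[C]_2) : binform 6 :=
  let a := M 0 0 in let b := M 0 1 in let c := M 1 0 in let d := M 1 1 in
  let l := d *: 'X - b%:P in
  let m := a%:P - c *: 'X in
  homogenize 6 (l * m * (l ^+ 4 - m ^+ 4)).

(* Moebius transformations are invertible matrices up to scale. *)
Definition deck (phi : 'cV[C]_2 -> 'cV[C]_2) (s : 'M[C]_2) : Prop :=
  s \in unitmx /\ forall q, q != 0 -> peq (phi (s *m q)) (phi q).

(* [phi] is a covering of degree n whose deck group in PGL_2 has order n. *)
Definition galois_covering (n : nat) (phi : 'cV[C]_2 -> 'cV[C]_2) : Prop :=
  curve n phi /\
  exists s : 'I_n -> 'M[C]_2,
    [/\ forall i, deck phi (s i),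
        forall i j, peq (s i) (s j) -> i = j &
        forall t, deck phi t -> exists i, peq t (s i)].

Definition holonomy (g : 'cV[C]_2 -> 'M[C]_2) (s : 'M[C]_2) (q : 'cV[C]_2) :=
  invmx (g (s *m q)) *m g q.

(* f1 o g = F o phi as rational maps, and the map from the deck group to PSL_2
   given by the holonomy at generic q is injective. *)
Definition galois_lift (phi : 'cV[C]_2 -> 'cV[C]_2)
    (F : 'cV[C]_2 -> binform 6) (g : 'cV[C]_2 -> 'M[C]_2) : Prop :=
  [/\ exists q, q != 0 /\ f1 (g q) != 0,
      forall q, q != 0 -> f1 (g q) != 0 -> peq (f1 (g q)) (F (phi q)) &
      forall s t, deck phi s -> deck phi t ->
        (forall q, q != 0 -> g q \in unitmx -> g (s *m q) \in unitmx ->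
           g (t *m q) \in unitmx -> peq (holonomy g s q) (holonomy g t q)) ->
        peq s t].

(* Equivalence of pairs (covering, curve) under Moebius transformations s of
   the source and t of the target of the covering and PSL_2-equivalence. *)
Definition equivalent (phi : 'cV[C]_2 -> 'cV[C]_2) (g : 'cV[C]_2 -> 'M[C]_2)
    (phi' : 'cV[C]_2 -> 'cV[C]_2) (g' : 'cV[C]_2 -> 'M[C]_2) : Prop :=
  exists s t A B : 'M[C]_2,
    [/\ s \in unitmx /\ t \in unitmx, \det A = 1, S4star B,
        forall q, q != 0 -> peq (t *m phi (s *m q)) (phi' q) &
        forall q, q != 0 -> peq (A *m g (s *m q) *m B^T) (g' q)].

(* w |-> w^2 with w = x/y *)
Definition square (q : 'cV[C]_2) : 'cV[C]_2 := \col_i (q i 0 ^+ 2).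

Definition g_deg2 (a3 b3 : C) (q : 'cV[C]_2) : 'M[C]_2 :=
  let x := q 0 0 in let y := q 1 0 in
  mx_of 2 3 [:: [:: 1; 0; a3]; [:: 0; 1; b3]] *m
  (mx_of 2 3 [:: [:: x ^+ 2; x * y; y ^+ 2];
                 [:: - xi1 * x ^+ 2; xi1 * x * y; - xi1 * y ^+ 2]])^T.

(* Rescaling x and y identifies (a3, b3) with (k^2 a3, k b3), so the point of
   P^1 that a pair (a3, b3) <> (0, 0) determines is [a3 : b3^2]. *)
Definition same_parameter (p p' : C * C) : Prop :=
  p.1 * p'.2 ^+ 2 = p'.1 * p.2 ^+ 2.

Definition plane (a3 a4 b3 b4 : C) : 'M[C]_(2, 4) :=
  mx_of 2 4 [:: [:: 1; 0; a3; a4]; [:: 0; 1; b3; b4]].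

Definition g_deg3 (M : 'M[C]_(2, 4)) (q : 'cV[C]_2) : 'M[C]_2 :=
  let x := q 0 0 in let y := q 1 0 in
  M *m (mx_of 2 4 [:: [:: x ^+ 3; 0; x * y ^+ 2; 0];
                      [:: 0; x ^+ 2 * y; 0; y ^+ 3]])^T.

Definition perpendicular (t : C) (M : 'M[C]_(2, 4)) : Prop :=
  M *m (mx_of 1 4 [:: [:: 1; -1; 1; -1]])^T = 0 /\
  M *m (mx_of 1 4 [:: [:: 'i * t ^+ 3; - t ^+ 2; 'i * t; -1]])^T = 0.

Definition unique_perpendicular_plane (t : C) (M : 'M[C]_(2, 4)) : Prop :=
  [/\ \rank M = 2, perpendicular t M &
      forall N : 'M[C]_(2, 4),
        \rank N = 2 -> perpendicular t N -> (N :=: M)%MS].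

End Definitions.

(* Main.v *)
Require Import Defs.
From HB Require Import structures.
From mathcomp Require Import all_boot all_order all_algebra.
From mathcomp Require Import complex ring zify.
From mathcomp Require Import all_classical all_reals all_analysis.

Set Implicit Arguments.
Unset Strict Implicit.
Unset Printing Implicit Defensive.

Import Order.TTheory GRing.Theory Num.Theory.
Import numFieldNormedType.Exports.

Local Open Scope ring_scope.
Local Open Scope complex_scope.

(** In suitable coordinates a covering of degree 2 is the squaring map
    ([degree2_normal_form]), and a lift becomes an identity of forms
    f1 (g q) = h q F (square q), where h is the common factor of the coordinates
    of f1 o g. As F has degree 6, deg h = 6 n - 12 for n = deg g ([lift_factor]).

    The value f1 (g) is a product of six linear forms in (u, v), one for each
    vertex of the octahedron. By Gauss's lemma h is a product of common divisors
    of the coefficients of the six forms. As g has no base point, any two of these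
    divisors have no common zero, and since each of them divides det g, so does
    h ([content_dvd_det]). Hence 6 n - 12 <= 2 n, that is n <= 3, and for n = 3
    the form h is det g up to a constant. In that case two of the six reduced
    linear forms are independent at every point, so F passes through no sixth
    power and cannot be tangent to the orbit of u^6 ([lift_not_sixth_power]).

    The points q and flip q of a fibre give g q = g (flip q) T with a constant T
    in the octahedral group ([holonomy_const]). Injectivity of the holonomy makes
    T an involution, about an axis through two faces or two edges of the cube
    ([involution_class]); g therefore consists of an even and an odd column,
    up to a fixed change of basis. The fixed point (1, 0) of the flip rules out
    the face axis for n = 2 and the edge axis for n = 3. The bound n >= 2 is
    contained in deg h >= 0.

    For n = 2 the even column is spanned by x^2 and y^2, the odd one is a vector
    times x y, and row operations lead to the family of the theorem
    ([deg2_normal_form]). At x^2 + a y^2 = 0 the curve F meets the orbit of sixth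
    powers tangentially ([deg2_tangent]). Comparison of coefficients shows that
    [a : b^2] is a complete invariant ([g_deg2_parameter]).

    For n = 3 the columns are x e and y o, with e and o linear in X = x^2 and
    Y = y^2. At a zero X / Y = r of the determinant of e and o, divisibility of
    f1 (g) by det g forces o = ka e with ka^4 = r^2 ([discr_ratio]). One zero is
    moved to r = 1 with ka = 1. At the other one ka^2 = r would make the curve lie
    in a hyperplane ([antisymmetric_not_full]), and ka^2 = - r are the equations
    of the plane perpendicular to the two vectors, with i t = ka
    ([cubic_parameter]). Conversely, for such a plane the common factor of
    f1 (g) is det g ([bev_f1_deg3]), which gives the sextic curve F.

    Fullness for all but finitely many parameters is read off triangular
    coefficients in degree 2 ([deg2_full]); in degree 3 it holds for one value of
    t, and a minor that is polynomial in t is then nonzero for almost all t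
    ([generic_full]). *)

(** * Forms in two variables *)

Section Forms.
Variable K : numClosedFieldType.
Implicit Types (p r : {poly K}) (q : 'cV[K]_2).

Lemma poly_all0 p : (forall z, p.[z] = 0) -> p = 0.
Proof.
move=> h; apply/eqP; apply/negPn/negP => p0.
pose s := [seq (i%:R : K) | i <- iota 0 (size p)].
have us : uniq s.
  by rewrite map_inj_uniq ?iota_uniq // => i j /eqP; rewrite eqr_nat => /eqP.
have ar : all (root p) s by apply/allP => x _; rewrite /root h.
by have := max_poly_roots p0 ar us; rewrite size_map size_iota ltnn.
Qed.

Lemma poly_generic0 r p :
  r != 0 -> (forall z, r.[z] != 0 -> p.[z] = 0) -> p = 0.
Proof.
move=> r0 h; have: r * p = 0.
  apply: poly_all0 => z; rewrite hornerM.
  by case: (eqVneq r.[z] 0) => [-> | /h ->]; rewrite ?mul0r ?mulr0.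
by move/eqP; rewrite mulf_eq0 (negPf r0) => /eqP.
Qed.

Lemma poly_ext p r : (forall z, p.[z] = r.[z]) -> p = r.
Proof.
move=> h; apply/eqP; rewrite -subr_eq0; apply/eqP/poly_all0 => z.
by rewrite hornerD hornerN h subrr.
Qed.

Lemma poly_neq0_ex p : p != 0 -> exists z, p.[z] != 0.
Proof.
move=> p0; apply: contrapT => h; move/eqP: p0; apply; apply: poly_all0 => z.
by apply: contrapT => /eqP hz; apply: h; exists z.
Qed.

Lemma coefM_top p r (a b : nat) : (size p <= a.+1)%N -> (size r <= b.+1)%N ->
  (p * r)`_(a + b) = p`_a * r`_b.
Proof.
move=> sp sr; rewrite coefM.
have ha : (a < (a + b).+1)%N by rewrite ltnS leq_addr.
rewrite (bigD1 (Ordinal ha)) //= addKn big1 ?addr0 // => i ni.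
have {}ni : (i : nat) != a by apply: contraNneq ni => ia; apply/eqP/val_inj.
case: (ltngtP i a) ni => // hi _.
  by rewrite (nth_default _ (s := r)) ?mulr0 //; lia.
by rewrite (nth_default _ (s := p)) ?mul0r //; lia.
Qed.

Lemma size_polyM_bound p r (a b : nat) :
  (size p <= a.+1)%N -> (size r <= b.+1)%N -> (size (p * r)%R <= (a + b).+1)%N.
Proof. by have := size_polyMleq p r; lia. Qed.

Lemma size_polyB_bound p r (a : nat) :
  (size p <= a)%N -> (size r <= a)%N -> (size (p - r)%R <= a)%N.
Proof.
move=> sp sr; apply: leq_trans (size_polyD _ _) _.
by rewrite size_polyN geq_max sp sr.
Qed.

Lemma size_polyX_bound p (a k : nat) :
  (size p <= a.+1)%N -> (size (p ^+ k)%R <= (a * k).+1)%N.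
Proof. by have := size_poly_exp_leq p k; nia. Qed.

(** Forms are functions on the cone over P^1 here, not tuples of coefficients:
    sums, products and substitutions are then the pointwise ones. *)
Definition isform (n : nat) (f : 'cV[K]_2 -> K) : Prop :=
  exists c : nat -> K, forall q,
    f q = \sum_(i < n.+1) c i * (q 0 0 ^+ (n - i) * q 1 0 ^+ i).

Lemma isform_ext n f g : (forall q, f q = g q) -> isform n g -> isform n f.
Proof. by move=> h [c hc]; exists c => q; rewrite h. Qed.

Lemma isform0 n : isform n (fun=> 0).
Proof. by exists (fun=> 0) => q; rewrite big1 // => i _; rewrite mul0r. Qed.

Lemma isformD n f g : isform n f -> isform n g -> isform n (fun q => f q + g q).
Proof.
move=> [c hc] [d hd]; exists (fun i => c i + d i) => q.
by rewrite hc hd -big_split; apply: eq_bigr => i _; rewrite mulrDl.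
Qed.

Lemma isformZ n a f : isform n f -> isform n (fun q => a * f q).
Proof.
move=> [c hc]; exists (fun i => a * c i) => q.
by rewrite hc mulr_sumr; apply: eq_bigr => i _; rewrite mulrA.
Qed.

Lemma isformN n f : isform n f -> isform n (fun q => - f q).
Proof.
by move=> hf; apply: isform_ext (isformZ (-1) hf) => q; rewrite mulN1r.
Qed.

Lemma isformB n f g : isform n f -> isform n g -> isform n (fun q => f q - g q).
Proof. by move=> hf /isformN; apply: isformD. Qed.

Lemma isform_sum (I : Type) (s : seq I) n (F : I -> 'cV[K]_2 -> K) :
  (forall i, isform n (F i)) -> isform n (fun q => \sum_(i <- s) F i q).
Proof.
move=> h; elim: s => [|i s IH].
  by apply: isform_ext (isform0 n) => q; rewrite big_nil.
by apply: isform_ext (isformD (h i) IH) => q; rewrite big_cons.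
Qed.

Lemma isform_mono n i j : (i + j)%N = n ->
  isform n (fun q => q 0 0 ^+ i * q 1 0 ^+ j).
Proof.
move=> <-; exists (fun k => (k == j)%:R) => q.
have hj : (j < (i + j).+1)%N by rewrite ltnS leq_addl.
rewrite (bigD1 (Ordinal hj)) //= eqxx mul1r addnK big1 ?addr0 // => k nk.
by rewrite (_ : (k == j :> nat) = false) ?mul0r //; apply: negPf.
Qed.

Lemma isformM n m f g : isform n f -> isform m g ->
  isform (n + m) (fun q => f q * g q).
Proof.
move=> [c hc] [d hd].
apply: (@isform_ext _ _ (fun q => \sum_(i < n.+1) \sum_(j < m.+1)
   (c i * d j) * (q 0 0 ^+ ((n - i) + (m - j)) * q 1 0 ^+ (i + j)))).
  move=> q; rewrite hc hd mulr_suml; apply: eq_bigr => i _; rewrite mulr_sumr.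
  by apply: eq_bigr => j _; rewrite !exprD; ring.
apply: isform_sum => i; apply: isform_sum => j; apply: isformZ; apply: isform_mono.
by rewrite addnACA !subnK // -ltnS.
Qed.

Lemma isform_cst a : isform 0 (fun=> a).
Proof. by exists (fun=> a) => q; rewrite big_ord1 !expr0 !mulr1. Qed.

Lemma isformX n k f : isform n f -> isform (n * k) (fun q => f q ^+ k).
Proof.
move=> hf; elim: k => [|k IH]; first by rewrite muln0; exact: isform_cst.
by rewrite mulnS; apply: isform_ext (isformM hf IH) => q; rewrite exprS.
Qed.

Lemma isform_x : isform 1 (fun q => q 0 0).
Proof. by apply: isform_ext (isform_mono (addn0 1)) => q; rewrite mulr1. Qed.

Lemma isform_y : isform 1 (fun q => q 1 0).
Proof. by apply: isform_ext (isform_mono (add0n 1)) => q; rewrite mul1r. Qed.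

Lemma isform_lin a b : isform 1 (fun q => a * q 0 0 + b * q 1 0).
Proof. exact: isformD (isformZ a isform_x) (isformZ b isform_y). Qed.

Lemma isform_comp n f (S : 'M[K]_2) : isform n f -> isform n (fun q => f (S *m q)).
Proof.
move=> [c hc].
have hS i : isform 1 (fun q => (S *m q) i 0).
  apply: isform_ext (isform_lin (S i 0) (S i 1)) => q.
  by rewrite mxE big_ord_recl big_ord1; congr (_ + S i _ * q _ _); apply: val_inj.
apply: (@isform_ext _ _ (fun q => \sum_(i < n.+1)
  c i * ((S *m q) 0 0 ^+ (n - i) * (S *m q) 1 0 ^+ i))) => //.
apply: isform_sum => i; apply: isformZ.
have := isformM (isformX (n - i) (hS 0)) (isformX i (hS 1)).
by rewrite !mul1n subnK // -ltnS.
Qed.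

Lemma isform_hom n f k q : isform n f -> f (k *: q) = k ^+ n * f q.
Proof.
move=> [c hc]; rewrite !hc mulr_sumr; apply: eq_bigr => i _; rewrite !mxE.
have -> : k ^+ n = k ^+ (n - i) * k ^+ i by rewrite -exprD subnK // -ltnS.
by rewrite !exprMn; ring.
Qed.

Definition pt (x y : K) : 'cV[K]_2 := \col_i (if i == 0 then x else y).

Lemma pt0 x y : pt x y 0 0 = x. Proof. by rewrite mxE. Qed.
Lemma pt1 x y : pt x y 1 0 = y. Proof. by rewrite mxE. Qed.

Lemma pt_eta q : q = pt (q 0 0) (q 1 0).
Proof.
apply/matrixP => i j; rewrite (ord1 j) !mxE; case: (eqVneq i 0) => [-> //|ni].
by congr (q _ _); case: i ni => [[|[|i]] hi] // _; apply: val_inj.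
Qed.

Lemma pt_eq0 x y : (pt x y == 0) = (x == 0) && (y == 0).
Proof.
apply/eqP/andP => [h|[/eqP -> /eqP ->]].
  by split; apply/eqP; [rewrite -(pt0 x y) | rewrite -(pt1 x y)]; rewrite h mxE.
by apply/matrixP => i j; rewrite !mxE if_same.
Qed.

(** A form becomes a polynomial on an affine line; the coefficient of top degree
    is its value at the point at infinity. *)
Lemma isform_line n f q0 q1 : isform n f -> exists p : {poly K},
  [/\ (size p <= n.+1)%N, forall z, p.[z] = f (q0 + z *: q1) & p`_n = f q1].
Proof.
move=> [c hc].
pose l (i : 'I_2) := (q0 i 0)%:P + (q1 i 0) *: 'X.
have sl i : (size (l i) <= 2)%N.
  rewrite /l addrC -mul_polyC size_MXaddC; case: ifP => // _.
  by rewrite ltnS size_polyC leq_b1.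
have cl i : (l i)`_1 = q1 i 0 by rewrite coefD coefC coefZ coefX add0r mulr1.
have sX i k : (size (l i ^+ k) <= k.+1)%N /\ (l i ^+ k)`_k = q1 i 0 ^+ k.
  elim: k => [|k [sk ck]]; first by rewrite !expr0 size_poly1 coef1.
  rewrite !exprS; split.
    by have := sl i; have := size_polyMleq (l i) (l i ^+ k); lia.
  by rewrite -add1n coefM_top // cl ck.
exists (\sum_(i < n.+1) c i *: (l 0 ^+ (n - i) * l 1 ^+ i)); split.
- apply: leq_trans (size_sum _ _ _) _; apply/bigmax_leqP => i _.
  apply: leq_trans (size_scale_leq _ _) _.
  have [s1 _] := sX 0 (n - i)%N; have [s2 _] := sX 1 i.
  have := size_polyMleq (l 0 ^+ (n - i)) (l 1 ^+ i); have := ltn_ord i; lia.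
- move=> z; rewrite hc horner_sum; apply: eq_bigr => i _.
  by rewrite hornerZ hornerM !horner_exp !hornerE !mxE [z * _]mulrC [z * q1 1 0]mulrC.
- rewrite coef_sum hc; apply: eq_bigr => i _; rewrite coefZ; congr (_ * _).
  have [s1 c1] := sX 0 (n - i)%N; have [s2 c2] := sX 1 i.
  by rewrite -c1 -c2 -coefM_top // subnK // -ltnS.
Qed.

Lemma isform_coef0 n (c : nat -> K) :
  (forall q, q != 0 ->
     \sum_(i < n.+1) c i * (q 0 0 ^+ (n - i) * q 1 0 ^+ i) = 0) ->
  forall i : 'I_n.+1, c i = 0.
Proof.
move=> h i; have p0 : \poly_(i < n.+1) c i = 0.
  apply: poly_all0 => z; rewrite horner_poly.
  have nz : pt 1 z != 0 by rewrite pt_eq0 oner_eq0.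
  rewrite -[RHS](h _ nz).
  by apply: eq_bigr => j _; rewrite pt0 pt1 expr1n mul1r.
by have := congr1 (fun p : {poly K} => p`_i) p0; rewrite coef_poly ltn_ord coef0.
Qed.

Lemma isform_zero n f : isform n f -> (forall q, q != 0 -> f q = 0) -> forall q, f q = 0.
Proof.
move=> [c hc] h q; rewrite hc; have c0 : forall i : 'I_n.+1, c i = 0.
  by apply: isform_coef0 => q' nq; rewrite -hc h.
by apply: big1 => i _; rewrite c0 mul0r.
Qed.

Lemma isform_eq n f g : isform n f -> isform n g ->
  (forall q, q != 0 -> f q = g q) -> forall q, f q = g q.
Proof.
move=> hf hg h q; apply/eqP; rewrite -subr_eq0; apply/eqP.
by apply: (isform_zero (isformB hf hg)) => q' nq; rewrite h ?subrr.
Qed.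

(** Forms make up an integral domain: restrict both to the line through a
    non-zero of each. *)
Lemma isform_dom n m f g : isform n f -> isform m g ->
  (forall q, q != 0 -> f q * g q = 0) ->
  (forall q, f q = 0) \/ (forall q, g q = 0).
Proof.
move=> hf hg h; case: (pselect (forall q, f q = 0)) => [|/existsNP[q1 /eqP f1]]; first by left.
right=> q2; apply: contrapT => /eqP g2.
have {}h := isform_zero (isformM hf hg) h.
have [p [_ hp _]] := isform_line q1 (q2 - q1) hf.
have [r [_ hr _]] := isform_line q1 (q2 - q1) hg.
have: p * r = 0 by apply: poly_all0 => z; rewrite hornerM hp hr h.
move/eqP; rewrite mulf_eq0 => /orP[/eqP p0|/eqP r0].
  by move: (hp 0); rewrite p0 horner0 scale0r addr0 => /esym/eqP; apply/negP.
by move: (hr 1); rewrite r0 horner0 scale1r addrC subrK => /esym/eqP; apply/negP.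
Qed.

Lemma isform_cancel n m f g h : isform n f -> isform m g -> isform m h ->
  (exists q, f q != 0) -> (forall q, q != 0 -> f q * g q = f q * h q) ->
  forall q, g q = h q.
Proof.
move=> hf hg hh [q0 f0] e.
have e0 q : q != 0 -> f q * (g q - h q) = 0.
  by move=> nq; rewrite mulrBr e ?subrr.
have [f00 q|gh q] := isform_dom hf (isformB hg hh) e0.
  by rewrite f00 eqxx in f0.
by apply/eqP; rewrite -subr_eq0 gh.
Qed.

Lemma isform2P f : isform 2 f -> exists a b c, forall q,
  f q = a * q 0 0 ^+ 2 + b * (q 0 0 * q 1 0) + c * q 1 0 ^+ 2.
Proof.
move=> [c hc]; exists (c 0%N), (c 1%N), (c 2%N) => q.
by rewrite hc !big_ord_recl big_ord0 /=; ring.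
Qed.

Lemma isform3P f : isform 3 f -> exists a b c d, forall q,
  f q = a * q 0 0 ^+ 3 + b * (q 0 0 ^+ 2 * q 1 0) + c * (q 0 0 * q 1 0 ^+ 2)
        + d * q 1 0 ^+ 3.
Proof.
move=> [c hc]; exists (c 0%N), (c 1%N), (c 2%N), (c 3%N) => q.
by rewrite hc !big_ord_recl big_ord0 /=; ring.
Qed.

Lemma isform0P f : isform 0 f -> exists a, forall q, f q = a.
Proof. by move=> [c hc]; exists (c 0%N) => q; rewrite hc big_ord1 !expr0 !mulr1. Qed.

End Forms.

(** * Divisibility of forms *)

Section Divisibility.
Variable K : numClosedFieldType.
Implicit Types (p r : {poly K}) (q : 'cV[K]_2).

Lemma poly_prop_const (I : Type) (p p' : I -> {poly K}) :
  (forall z, exists i, (p i).[z] != 0) -> (forall z, exists i, (p' i).[z] != 0) ->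
  (forall i j, p i * p' j = p j * p' i) ->
  exists2 c : K, c != 0 & forall i, p' i = c *: p i.
Proof.
move=> np np' e.
have main : forall n (a a' : {poly K}), (size a <= n)%N -> a != 0 ->
    (forall j, a * p' j = p j * a') -> exists b : {poly K}, forall j, p' j = b * p j.
  elim=> [|n IH] a a' sa a0 ea; first by move: sa; rewrite leqn0 size_poly_eq0 (negPf a0).
  case: (eqVneq (size a) 1%N) => [/eqP/size_poly1P[k k0 ak]|].
    exists (k^-1 *: a') => j; rewrite -scalerAl mulrC -ea ak mul_polyC.
    by rewrite scalerA mulVf // scale1r.
  move/closed_rootP => [r ra].
  have ra' : root a' r.
    have [j hj] := np r; have := congr1 (fun s : {poly K} => s.[r]) (ea j).
    rewrite /= !hornerM (eqP ra) mul0r => /esym/eqP.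
    by rewrite mulf_eq0 (negPf hj).
  have /factor_theorem[b ab] := ra; have /factor_theorem[b' ab'] := ra'.
  have nX : 'X - r%:P != 0 by rewrite polyXsubC_eq0.
  have b0 : b != 0 by apply: contraNneq a0 => b0; rewrite ab b0 mul0r.
  apply: (IH b b') => //.
    by move: sa; rewrite ab size_Mmonic ?monicXsubC // size_XsubC addn2.
  move=> j; apply: (mulIf nX); rewrite -mulrA [p' j * _]mulrC mulrA -ab ea ab'.
  by rewrite mulrA.
have [i hi] := np 0.
have pi0 : p i != 0 by apply: contraNneq hi => ->; rewrite horner0.
have [b hb] := main _ _ (p' i) (leqnn _) pi0 (fun j => e i j).
have : size b == 1%N.
  apply/negPn/closed_rootP => -[r rb]; have [j] := np' r.
  by rewrite hb hornerM (eqP rb) mul0r eqxx.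
move=> /size_poly1P[c c0 bc]; exists c => // j; by rewrite hb bc mul_polyC.
Qed.

(** Two maps P^1 -> P^N of the same degree that agree pointwise have
    proportional coefficients: the factor of proportionality is a rational
    function without zeros and poles. *)
Lemma isform_prop_const (I : Type) n (f f' : I -> 'cV[K]_2 -> K) :
  (forall i, isform n (f i)) -> (forall i, isform n (f' i)) ->
  (forall q, q != 0 -> exists i, f i q != 0) ->
  (forall q, q != 0 -> exists i, f' i q != 0) ->
  (forall q i j, q != 0 -> f i q * f' j q = f j q * f' i q) ->
  exists2 c : K, c != 0 & forall i q, f' i q = c * f i q.
Proof.
move=> hf hf' nf nf' e.
have /(_ _)/cid-/all_sig[p hp] := fun i => isform_line (pt 1 0) (pt 0 1) (hf i).
have /(_ _)/cid-/all_sig[p' hp'] := fun i => isform_line (pt 1 0) (pt 0 1) (hf' i).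
have line z : pt 1 0 + z *: pt 0 1 = pt 1 z :> 'cV[K]_2.
  by rewrite [LHS]pt_eta !mxE /= mulr0 addr0 mulr1 add0r.
have nz z : pt 1 z != 0 :> 'cV[K]_2 by rewrite pt_eq0 oner_eq0.
have ep i z : (p i).[z] = f i (pt 1 z) by have [_ -> _] := hp i; rewrite line.
have ep' i z : (p' i).[z] = f' i (pt 1 z) by have [_ -> _] := hp' i; rewrite line.
have [|||c c0 hc] := @poly_prop_const I p p'.
- by move=> z; have [i hi] := nf _ (nz z); exists i; rewrite ep.
- by move=> z; have [i hi] := nf' _ (nz z); exists i; rewrite ep'.
- by move=> i j; apply: poly_ext => z; rewrite !hornerM !ep !ep' e.
exists c => // i.
apply: (isform_cancel (isform_x K) (hf' i) (isformZ c (hf i))).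
  by exists (pt 1 0); rewrite pt0 oner_eq0.
move=> q _; case: (eqVneq (q 0 0) 0) => [->|x0]; first by rewrite !mul0r.
congr (_ * _); have -> : q = q 0 0 *: pt 1 (q 1 0 / q 0 0).
  by rewrite [LHS]pt_eta [RHS]pt_eta !mxE /= mulr1 mulrC divfK.
by rewrite (isform_hom _ _ (hf' i)) (isform_hom _ _ (hf i)) -ep -ep' hc hornerZ; ring.
Qed.

Lemma isform_root_x n f : isform n f -> (exists q, f q != 0) -> f (pt 0 1) = 0 ->
  exists m g, [/\ n = m.+1, isform m g & forall q, f q = q 0 0 * g q].
Proof.
move=> [c hc] [q0 f0] f1.
have cn : c n = 0.
  move: f1; rewrite hc big_ord_recr /= pt0 pt1 subnn expr0 expr1n !mulr1 big1 ?add0r //.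
  by move=> i _; rewrite expr0n subn_eq0 leqNgt ltn_ord mul0r mulr0.
case: n => [|m] in hc cn *.
  by move: f0; rewrite hc big_ord1 cn mul0r eqxx.
exists m, (fun q => \sum_(i < m.+1) c i * (q 0 0 ^+ (m - i) * q 1 0 ^+ i)).
split=> //; first by exists c.
move=> q; rewrite hc big_ord_recr /= cn mul0r addr0 mulr_sumr.
by apply: eq_bigr => i _; rewrite subSn ?exprS; [ring | rewrite -ltnS].
Qed.

Lemma isform_root_y n f : isform n f -> (exists q, f q != 0) -> f (pt 1 0) = 0 ->
  exists m g, [/\ n = m.+1, isform m g & forall q, f q = q 1 0 * g q].
Proof.
move=> [c hc] [q0 f0] f1.
have c0 : c 0%N = 0.
  move: f1; rewrite hc big_ord_recl /= pt0 pt1 expr0 expr1n !mulr1 big1 ?addr0 //.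
  by move=> i _; rewrite expr0n mulr0 mulr0.
case: n => [|m] in hc *.
  by move: f0; rewrite hc big_ord1 c0 mul0r eqxx.
exists m, (fun q => \sum_(i < m.+1) c i.+1 * (q 0 0 ^+ (m - i) * q 1 0 ^+ i)).
split=> //; first by exists (fun i => c i.+1).
move=> q; rewrite hc big_ord_recl /= c0 mul0r add0r mulr_sumr.
by apply: eq_bigr => i _; rewrite /bump /= add1n subSS exprS; ring.
Qed.

(** x^k and y^k have no common factor; the factors x and y are split off one at a
    time. *)
Lemma isform_cross_div k n f g : isform n f -> isform n g -> (exists q, f q != 0) ->
  (forall q, f q * q 1 0 ^+ k = g q * q 0 0 ^+ k) ->
  exists m h, [/\ n = (m + k)%N, isform m h,
    forall q, f q = q 0 0 ^+ k * h q & forall q, g q = q 1 0 ^+ k * h q].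
Proof.
elim: k n f g => [|k IH] n f g hf hg nf e.
  exists n, f; split=> [|//|q|q]; rewrite ?addn0 ?expr0 ?mul1r //.
  by have := e q; rewrite !expr0 !mulr1.
have ng : exists q, g q != 0.
  case: (pselect (exists q, g q != 0)) => // /forallNP g0; case: nf => q1 fq1.
  have {}g0 q : g q = 0 by apply/eqP/negPn/negP/g0.
  have hY := isformX k.+1 (isform_y K).
  have [|f0|y0] := isform_dom hf hY; first by move=> q _; rewrite e g0 mul0r.
    by rewrite f0 eqxx in fq1.
  by have := y0 (pt 0 1); rewrite pt1 expr1n => /eqP; rewrite oner_eq0.
have f1 : f (pt 0 1) = 0.
  by have := e (pt 0 1); rewrite pt0 pt1 expr1n mulr1 expr0n mulr0.
have g1 : g (pt 1 0) = 0.
  by have := e (pt 1 0); rewrite pt0 pt1 expr1n mulr1 expr0n mulr0.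
have [m [f' [nm hf' ef]]] := isform_root_x hf nf f1.
have [m' [g' [nm' hg' eg]]] := isform_root_y hg ng g1.
have mm : m' = m by move: nm nm'; lia.
rewrite {}mm {nm' m'} in hg'.
have nf' : exists q, f' q != 0.
  by have [q hq] := nf; exists q; apply: contraNneq hq => h; rewrite ef h mulr0.
have hxy : isform 2 (fun q => q 0 0 * q 1 0) := isformM (isform_x K) (isform_y K).
have e' q : f' q * q 1 0 ^+ k = g' q * q 0 0 ^+ k.
  have h1 := isformM hf' (isformX k (isform_y K)).
  have h2 := isformM hg' (isformX k (isform_x K)).
  apply: (isform_cancel hxy h1 h2).
    by exists (pt 1 1); rewrite pt0 pt1 mulr1 oner_eq0.
  move=> q' _; have := e q'; rewrite ef eg !exprS => h.
  transitivity (q' 0 0 * f' q' * (q' 1 0 * q' 1 0 ^+ k)); first by ring.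
  by rewrite h; ring.
have [l [h [ml hh eh1 eh2]]] := IH _ _ _ hf' hg' nf' e'.
exists l, h; split=> // [|q|q]; first by rewrite nm ml addnS.
  by rewrite ef eh1 exprS; ring.
by rewrite eg eh2 exprS; ring.
Qed.

(** ** Contents of a product of linear forms *)

Lemma linear_prod0 (I : finType) (a b : I -> K) :
  (forall u v, \prod_i (u * a i + v * b i) = 0) -> exists i, a i = 0 /\ b i = 0.
Proof.
move=> h; have : \prod_i ((a i)%:P + b i *: 'X) = 0.
  apply: poly_all0 => z; rewrite horner_prod -[RHS](h 1 z); apply: eq_bigr => i _.
  by rewrite !hornerE [_ * z]mulrC.
move/eqP/prodf_eq0 => [i _ /eqP/polyP hi]; exists i; split.
  by have := hi 0%N; rewrite coefD coefC coefZ coefX mulr0 addr0 coef0.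
by have := hi 1%N; rewrite coefD coefC coefZ coefX mulr1 add0r coef0.
Qed.

(** Gauss's lemma: a polynomial in z which divides a product of linear forms
    in (u, v) splits as a product of common divisors of the coefficients of
    the single forms. Peel off one root of H at a time. *)
Lemma gauss_linear_prod (I : finType) (H : {poly K}) (a b : I -> {poly K}) :
  H != 0 -> (forall u v : K, H %| \prod_i (u *: a i + v *: b i)) ->
  exists (c : K) (G a' b' : I -> {poly K}), [/\ c != 0, H = c *: \prod_i G i,
    forall i, a i = G i * a' i & forall i, b i = G i * b' i].
Proof.
have [n] := ubnP (size H); elim: n => // n IH in H a b *; rewrite ltnS => sH H0 hH.
case: (eqVneq (size H) 1%N) => [/eqP/size_poly1P[k k0 ->]|].
  exists k, (fun=> 1), a, b; split=> // [|i|i]; rewrite ?mul1r //.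
  by rewrite big1 // alg_polyC.
move/closed_rootP => [r rH]; have /factor_theorem[H' eH] := rH.
have [i0 [a0 b0]] : exists i, (a i).[r] = 0 /\ (b i).[r] = 0.
  apply: linear_prod0 => u v; have /dvdpP[s hs] := hH u v.
  transitivity ((\prod_i (u *: a i + v *: b i)).[r]).
    by rewrite horner_prod; apply: eq_bigr => i _; rewrite !hornerE.
  by rewrite hs hornerM (eqP rH) mulr0.
have /factor_theorem[a1 ea] : root (a i0) r by apply/eqP.
have /factor_theorem[b1 eb] : root (b i0) r by apply/eqP.
have nX : 'X - r%:P != 0 by rewrite polyXsubC_eq0.
have H'0 : H' != 0 by apply: contraNneq H0 => h; rewrite eH h mul0r.
pose aa i := if i == i0 then a1 else a i; pose bb i := if i == i0 then b1 else b i.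
have [|//|u v|c [G [a' [b' [c0 eH' eaa ebb]]]]] := IH H' aa bb.
- by move: sH; rewrite eH size_Mmonic ?monicXsubC // size_XsubC addn2.
- rewrite -(dvdp_mul2l _ _ nX) mulrC -eH; apply: dvdp_trans (hH u v) _.
  have -> : \prod_i (u *: aa i + v *: bb i) =
      (u *: a1 + v *: b1) * \prod_(i | i != i0) (u *: a i + v *: b i).
    rewrite (bigD1 i0) //= /aa /bb eqxx; congr (_ * _).
    by apply: eq_bigr => i /negPf ->.
  rewrite (bigD1 i0) //= ea eb !scalerAl -mulrDl [_ * ('X - _)]mulrC.
  by rewrite -mulrA dvdpp.
exists c, (fun i => if i == i0 then ('X - r%:P) * G i else G i), a', b'; split=> //.
- have -> : \prod_i (if i == i0 then ('X - r%:P) * G i else G i) =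
      ('X - r%:P) * \prod_i G i.
    rewrite (bigD1 i0) //= eqxx [in RHS](bigD1 i0) //= mulrA; congr (_ * _).
    by apply: eq_bigr => i /negPf ->.
  by rewrite eH eH' -scalerAl mulrC.
- move=> i; have := eaa i; rewrite /aa; case: eqP => [-> e|_ //].
  by rewrite ea e; ring.
- move=> i; have := ebb i; rewrite /bb; case: eqP => [-> e|_ //].
  by rewrite eb e; ring.
Qed.

Lemma coprime_prod_dvdp (I : finType) (G : I -> {poly K}) (D : {poly K}) :
  (forall i j, i != j -> forall z, (G i).[z] = 0 -> (G j).[z] != 0) ->
  (forall i, G i %| D) -> \prod_i G i %| D.
Proof.
move=> cop dv; rewrite -big_enum /=; have := enum_uniq I.
elim: (enum I) => [|i s IH] /=; first by rewrite big_nil dvd1p.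
move=> /andP[nis us]; rewrite big_cons Gauss_dvdp ?dv ?IH //.
apply/Pdiv.ClosedField.coprimepP => z /eqP Gz; rewrite horner_prod prodf_seq_neq0.
apply/allP => j js /=; apply: (cop i) => //.
by apply: contraNneq nis => ->.
Qed.

End Divisibility.

(** * Binary forms as functions of (u, v) *)

Section BinaryForms.
Variable R : realType.
Local Notation C := R[i].
Implicit Types (q w : 'cV[C]_2) (M A B : 'M[C]_2).

(** The definitions of [f1] and [act] pass through polynomials in one variable.
    On values they become substitutions, which [bev_f1] and [bev_act] record. *)
Definition bev n (f : binform R n) w : C :=
  \sum_(i < n.+1) f 0 i * (w 0 0 ^+ (n - i) * w 1 0 ^+ i).

Lemma isform_bev n (f : binform R n) : isform n (bev f).
Proof.
exists (fun i => f 0 (inord i)) => w; apply: eq_bigr => i _.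
by rewrite inord_val.
Qed.

Lemma bev_inj n (f g : binform R n) : (forall w, w != 0 -> bev f w = bev g w) -> f = g.
Proof.
move=> h; apply/matrixP => i j; rewrite (ord1 i); apply/eqP; rewrite -subr_eq0.
have e w : w != 0 ->
    \sum_(k < n.+1) (f 0 (inord k) - g 0 (inord k)) * (w 0 0 ^+ (n - k) * w 1 0 ^+ k) = 0.
  move=> nw; rewrite -[RHS](subrr (bev g w)) -{1}(h w nw) /bev -sumrB.
  by apply: eq_bigr => k _; rewrite inord_val mulrBl.
have := @isform_coef0 C n (fun k => f 0 (inord k) - g 0 (inord k)) e j.
by rewrite inord_val => ->.
Qed.

Lemma bevZ n k (f : binform R n) w : bev (k *: f) w = k * bev f w.
Proof. by rewrite /bev mulr_sumr; apply: eq_bigr => i _; rewrite mxE -mulrA. Qed.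

Lemma bevD n (f g : binform R n) w : bev (f + g) w = bev f w + bev g w.
Proof. by rewrite /bev -big_split; apply: eq_bigr => i _; rewrite mxE mulrDl. Qed.

Lemma bev0 n w : bev (0 : binform R n) w = 0.
Proof. by rewrite /bev big1 // => i _; rewrite mxE mul0r. Qed.

Lemma bev_sum n (I : Type) (s : seq I) (F : I -> binform R n) w :
  bev (\sum_(i <- s) F i) w = \sum_(i <- s) bev (F i) w.
Proof.
elim: s => [|i s IH]; first by rewrite !big_nil bev0.
by rewrite !big_cons bevD IH.
Qed.

Lemma bev_mx n (f : binform R n) w :
  bev f w = (f *m \col_i (w 0 0 ^+ (n - i) * w 1 0 ^+ i)) 0 0.
Proof. by rewrite /bev mxE; apply: eq_bigr => i _; rewrite mxE. Qed.

Lemma bev_neq0 n (f : binform R n) : f != 0 -> exists2 w, w != 0 & bev f w != 0.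
Proof.
move=> f0; apply: contrapT => h; move/eqP: f0; apply; apply: bev_inj => w nw.
by rewrite bev0; apply/eqP/negPn/negP => hw; apply: h; exists w.
Qed.

(** Coefficients are linear combinations of values, with weights that do not
    depend on the form. *)
Lemma coef_bev n (i : 'I_n.+1) : exists L : 'I_n.+1 -> C,
  forall f : binform R n, f 0 i = \sum_k L k * bev f (pt 1 k%:R).
Proof.
pose a : 'rV[C]_n.+1 := \row_k k%:R.
pose V := Vandermonde n.+1 a.
have uV : V \in unitmx.
  rewrite unitmxE det_Vandermonde unitfE; apply/prodf_neq0 => k _.
  apply/prodf_neq0 => l kl; rewrite !mxE subr_eq0 eqr_nat.
  by apply: contraTneq kl => ->; rewrite ltnn.
exists (fun k => invmx V k i) => f.
rewrite -[f in LHS](mulmxK uV) mxE; apply: eq_bigr => k _.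
rewrite mulrC; congr (_ * _); rewrite mxE; apply: eq_bigr => j _.
by rewrite !mxE /= expr1n mul1r.
Qed.

Lemma isform_coef n m (f : 'cV[C]_2 -> binform R n) :
  (forall w, isform m (fun q => bev (f q) w)) ->
  forall i, isform m (fun q => f q 0 i).
Proof.
move=> h i; have [L hL] := coef_bev i.
by apply: isform_ext (fun q => hL (f q)) _; apply: isform_sum => k; apply: isformZ.
Qed.

Lemma isform_mulmx n m (f : 'cV[C]_2 -> binform R n) (l : 'cV[C]_n.+1) :
  (forall i, isform m (fun q => f q 0 i)) -> isform m (fun q => (f q *m l) 0 0).
Proof.
move=> h; apply: (@isform_ext _ _ _ (fun q => \sum_j l j 0 * f q 0 j)).
  by move=> q; rewrite mxE; apply: eq_bigr => j _; rewrite mulrC.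
by apply: isform_sum => j; apply: isformZ.
Qed.

Lemma bev_homogenize n (p : {poly C}) (G : 'cV[C]_2 -> C) :
  isform n G -> (size p <= n.+1)%N -> (forall u, G (pt u 1) = p.[u]) ->
  forall w, bev (homogenize n p) w = G w.
Proof.
move=> hG sp e.
have e1 u : bev (homogenize n p) (pt u 1) = p.[u].
  rewrite /bev (horner_coef_wide _ sp) (reindex_inj rev_ord_inj) /=.
  apply: eq_bigr => i _; rewrite mxE pt0 pt1 expr1n mulr1 /= subSS.
  by rewrite subKn // -ltnS.
apply: (isform_cancel (isform_y C) (isform_bev _) hG).
  by exists (pt 0 1); rewrite pt1 oner_eq0.
move=> w _; case: (eqVneq (w 1 0) 0) => [->|y0]; first by rewrite !mul0r.
congr (_ * _); have -> : w = w 1 0 *: pt (w 0 0 / w 1 0) 1.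
  by rewrite [LHS]pt_eta [RHS]pt_eta !mxE /= mulr1 mulrC divfK.
by rewrite (isform_hom _ _ (isform_bev _)) (isform_hom _ _ hG) e1 e.
Qed.

(** u v (u^4 - v^4), the form whose zeros are the vertices of an octahedron. *)
Definition oct (l m : C) : C := l * m * (l ^+ 4 - m ^+ 4).

Lemma isform_oct n l m : isform n l -> isform n m ->
  isform (6 * n) (fun q : 'cV[C]_2 => oct (l q) (m q)).
Proof.
move=> hl hm; have := isformM (isformM hl hm) (isformB (isformX 4 hl) (isformX 4 hm)).
by rewrite (_ : n + n + n * 4 = 6 * n)%N //; lia.
Qed.

Lemma octZ k l m : oct (k * l) (k * m) = k ^+ 6 * oct l m.
Proof. by rewrite /oct; ring. Qed.

Lemma size_lin (a b : C) : (size (a *: 'X + b%:P)%R <= 2)%N.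
Proof.
by rewrite -mul_polyC size_MXaddC; case: ifP => // _; rewrite ltnS size_polyC leq_b1.
Qed.

Lemma bev_f1 M w :
  bev (f1 M) w = oct (M 1 1 * w 0 0 - M 0 1 * w 1 0) (M 0 0 * w 1 0 - M 1 0 * w 0 0).
Proof.
set a := M 0 0; set b := M 0 1; set c := M 1 0; set d := M 1 1.
pose l := d *: 'X + (- b)%:P : {poly C}; pose m := (- c) *: 'X + a%:P : {poly C}.
have -> : f1 M = homogenize 6 (l * m * (l ^+ 4 - m ^+ 4)).
  by rewrite /f1 /l /m polyCN scaleNr [a%:P - _]addrC.
apply: (@bev_homogenize _ _ (fun w => oct (d * w 0 0 - b * w 1 0) (a * w 1 0 - c * w 0 0))).
- have h1 : isform 1 (fun w : 'cV[C]_2 => d * w 0 0 - b * w 1 0).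
    by apply: isform_ext (isform_lin d (- b)) => q; rewrite mulNr.
  have h2 : isform 1 (fun w : 'cV[C]_2 => a * w 1 0 - c * w 0 0).
    by apply: isform_ext (isform_lin (- c) a) => q; rewrite mulNr addrC.
  exact: isform_oct h1 h2.
- have sl : (size l <= 2)%N := size_lin _ _; have sm : (size m <= 2)%N := size_lin _ _.
  apply: (@size_polyM_bound _ _ _ 2 4); first exact: (@size_polyM_bound _ _ _ 1 1).
  by apply: size_polyB_bound; exact: (@size_polyX_bound _ _ 1 4).
- move=> u; have hl : l.[u] = d * u - b.
    by rewrite /l hornerD hornerZ hornerX hornerC.
  have hm : m.[u] = a - c * u by rewrite /m hornerD hornerZ hornerX hornerC mulNr addrC.
  by clearbody l m; rewrite 2!hornerM hornerD hornerN !horner_exp hl hm pt0 pt1 !mulr1.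
Qed.

Lemma mulcol2 A w i : (A *m w) i 0 = A i 0 * w 0 0 + A i 1 * w 1 0.
Proof.
rewrite mxE big_ord_recl big_ord1; congr (_ + A i _ * w _ _); exact: val_inj.
Qed.

Lemma isform_row A i : isform 1 (fun w : 'cV[C]_2 => (A *m w) i 0).
Proof. by apply: isform_ext (isform_lin (A i 0) (A i 1)) => w; rewrite mulcol2. Qed.

Lemma bev_act n A (f : binform R n) w : bev (act A f) w = bev f (invmx A *m w).
Proof.
rewrite /act; set B := invmx A; set U := _ + _; set V := _ + _.
apply: (@bev_homogenize _ _ (fun w => bev f (B *m w))).
- exact: isform_comp (isform_bev f).
- apply: leq_trans (size_sum _ _ _) _; apply/bigmax_leqP => i _.
  apply: leq_trans (size_scale_leq _ _) _.
  have sU : (size U <= 2)%N := size_lin _ _; have sV : (size V <= 2)%N := size_lin _ _.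
  have := @size_polyM_bound _ _ _ _ _ (size_polyX_bound (n - i) sU) (size_polyX_bound i sV).
  by rewrite !mul1n subnK // -ltnS.
- move=> u; rewrite /bev horner_sum; apply: eq_bigr => i _.
  by rewrite hornerZ hornerM !horner_exp !mulcol2 !hornerE pt0 pt1 !mulr1.
Qed.

Lemma bev_octahedral w : bev (octahedral_form R) w = oct (w 0 0) (w 1 0).
Proof.
apply: (@bev_homogenize _ _ (fun w => oct (w 0 0) (w 1 0))).
- exact: isform_oct (isform_x C) (isform_y C).
- apply: (@size_polyM_bound _ _ _ 1 5); first by rewrite size_polyX.
  by apply: size_polyB_bound; rewrite ?size_polyXn ?size_poly1.
- by move=> u; rewrite /oct !hornerE pt0 pt1; ring.
Qed.

Lemma bev_u6 w : bev (u6 R) w = w 0 0 ^+ 6.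
Proof.
apply: (@bev_homogenize _ _ (fun w => w 0 0 ^+ 6)).
- have HH := isformX 6 (isform_x C). exact: HH.
- by rewrite size_polyXn.
- by move=> u; rewrite !hornerE pt0.
Qed.

Lemma bev_u5v w : bev (u5v R) w = w 0 0 ^+ 5 * w 1 0.
Proof.
apply: (@bev_homogenize _ _ (fun w => w 0 0 ^+ 5 * w 1 0)).
- exact: isformM (isformX 5 (isform_x C)) (isform_y C).
- by rewrite size_polyXn.
- by move=> u; rewrite !hornerE pt0 pt1 mulr1.
Qed.

(** * Curves *)

Lemma isform_ev_row n k (c : vform 'rV[C]_k n) i : isform n (fun q => ev c q 0 i).
Proof.
exists (fun j => c (inord j) 0 i) => q; rewrite /ev summxE; apply: eq_bigr => j _.
by rewrite mxE inord_val mulrC.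
Qed.

Lemma isform_ev_mx n m k (c : vform 'M[C]_(m, k) n) i j : isform n (fun q => ev c q i j).
Proof.
exists (fun l => c (inord l) i j) => q; rewrite /ev summxE; apply: eq_bigr => l _.
by rewrite mxE inord_val mulrC.
Qed.

Lemma isform_bev_ev n m (F : vform (binform R m) n) w :
  isform n (fun q => bev (ev F q) w).
Proof.
exists (fun j => bev (F (inord j)) w) => q; rewrite /ev bev_sum; apply: eq_bigr => j _.
by rewrite bevZ inord_val mulrC.
Qed.

Lemma isform_curve n (g : 'cV[C]_2 -> 'M[C]_2) i j :
  curve n g -> isform n (fun q => g q i j).
Proof. by move=> [[c hc] _]; apply: isform_ext (isform_ev_mx c i j) => q; rewrite hc. Qed.

Lemma isform_f1 n (g : 'cV[C]_2 -> 'M[C]_2) w :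
  (forall i j, isform n (fun q => g q i j)) ->
  isform (6 * n) (fun q => bev (f1 (g q)) w).
Proof.
move=> hg; apply: isform_ext (fun q => bev_f1 (g q) w) _.
by apply: isform_oct; (apply: isform_ext (isformB (isformZ _ (hg _ _)) (isformZ _ (hg _ _))) => q;
  rewrite [_ * w _ _]mulrC [_ * w _ _ in X in _ - X]mulrC).
Qed.

(** A linearly full curve of degree 6 in P^6 is a rational normal curve: its
    seven coefficients are a basis. *)
Lemma full_dual (F : vform (binform R 6) 6) : linearly_full (ev F) ->
  exists l : 'I_7 -> 'cV[C]_7, forall i k, (F i *m l k) 0 0 = (i == k)%:R.
Proof.
move=> full; pose Fm : 'M[C]_7 := \matrix_i F i.
have evE q : ev F q = (\row_i (q 0 0 ^+ (6 - i) * q 1 0 ^+ i)) *m Fm.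
  rewrite mulmx_sum_row; apply: eq_bigr => i _; rewrite mxE; congr (_ *: _).
  by apply/rowP => j; rewrite !mxE.
have uF : Fm \in unitmx.
  rewrite -unitmx_tr -row_free_unit -kermx_eq0; apply/eqP/row_matrixP => i.
  rewrite row0; apply: trmx_inj; rewrite trmx0; apply: full => q _.
  have e : row i (kermx Fm^T) *m Fm^T = 0 by rewrite -row_mul mulmx_ker row0.
  by rewrite evE -mulmxA (_ : Fm *m _ = 0) ?mulmx0 // -[LHS]trmxK trmx_mul trmxK e trmx0.
exists (fun k => col k (invmx Fm)) => i k.
have <- : row i Fm = F i by apply/rowP => j; rewrite !mxE.
by rewrite colE mulmxA -row_mul mulmxV // -colE !mxE.
Qed.

Lemma full_monomials (F : vform (binform R 6) 6) : linearly_full (ev F) ->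
  exists l : 'I_7 -> 'cV[C]_7,
    forall k q, (ev F q *m l k) 0 0 = q 0 0 ^+ (6 - k) * q 1 0 ^+ k.
Proof.
move=> /full_dual[l hl]; exists l => k q.
rewrite /ev mulmx_suml summxE (bigD1 k) //= -scalemxAl mxE hl eqxx mulr1.
by rewrite big1 ?addr0 // => i /negPf ik; rewrite -scalemxAl mxE hl ik mulr0.
Qed.

Lemma square0 q : square q 0 0 = q 0 0 ^+ 2. Proof. by rewrite mxE. Qed.
Lemma square1 q : square q 1 0 = q 1 0 ^+ 2. Proof. by rewrite mxE. Qed.

(** [f1 (g q)] and [F (square q)] span the same line; as the coordinates of the
    latter contain x^12 and y^12, the factor between them is a form. *)
Lemma lift_factor n (g : 'cV[C]_2 -> 'M[C]_2) (F : vform (binform R 6) 6) :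
  (forall i j, isform n (fun q => g q i j)) -> linearly_full (ev F) ->
  (exists q, q != 0 /\ f1 (g q) != 0) ->
  (forall q, q != 0 -> f1 (g q) != 0 -> peq (f1 (g q)) (ev F (square q))) ->
  exists m h, [/\ (6 * n = m + 12)%N, isform m h &
     forall q, f1 (g q) = h q *: ev F (square q)].
Proof.
move=> hg full [q0 [nq0 f0]] rel.
have [l hl] := full_monomials full.
have fc := fun i => isform_coef (fun w => isform_f1 w hg) i.
pose A q := (f1 (g q) *m l ord0) 0 0; pose B q := (f1 (g q) *m l ord_max) 0 0.
have hA : isform (6 * n) A := isform_mulmx _ fc.
have hB : isform (6 * n) B := isform_mulmx _ fc.
have relk q : q != 0 -> exists k, f1 (g q) = k *: ev F (square q).
  move=> nq; case: (eqVneq (f1 (g q)) 0) => [->|fq]; first by exists 0; rewrite scale0r.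
  by have [k [_ ek]] := rel q nq fq; exists k.
have AE q k : f1 (g q) = k *: ev F (square q) -> A q = k * q 0 0 ^+ 12.
  by move=> e; rewrite /A e -scalemxAl mxE hl /= square0 -exprM subn0 expr0 mulr1.
have BE q k : f1 (g q) = k *: ev F (square q) -> B q = k * q 1 0 ^+ 12.
  by move=> e; rewrite /B e -scalemxAl mxE hl /= square1 -exprM subnn expr0 mul1r.
have h12 : isform 12 (fun q : 'cV[C]_2 => q 0 0 ^+ 12) := isformX 12 (isform_x C).
have k12 : isform 12 (fun q : 'cV[C]_2 => q 1 0 ^+ 12) := isformX 12 (isform_y C).
have e12 q : A q * q 1 0 ^+ 12 = B q * q 0 0 ^+ 12.
  apply: (isform_eq (isformM hA k12) (isformM hB h12)) => q' nq.
  by have [k ek] := relk q' nq; rewrite (AE _ _ ek) (BE _ _ ek); ring.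
have nA : exists q, A q != 0.
  apply: contrapT => hA0.
  have A0 q : A q = 0 by apply: contrapT => /eqP hq; apply: hA0; exists q.
  have B0 q : B q = 0.
    have [|B0|x0] := isform_dom hB h12; [|exact: B0|].
      by move=> q' _; rewrite -e12 A0 mul0r.
    by have := x0 (pt 1 0); rewrite pt0 expr1n => /eqP; rewrite oner_eq0.
  have [k ek] := relk q0 nq0; move: f0; rewrite ek.
  have : k = 0.
    have := A0 q0; rewrite (AE _ _ ek); have := B0 q0; rewrite (BE _ _ ek).
    move/eqP; rewrite mulf_eq0 => /orP[/eqP //|]; rewrite expf_eq0 /= => y0.
    move/eqP; rewrite mulf_eq0 => /orP[/eqP //|]; rewrite expf_eq0 /= => x0.
    by move: nq0; rewrite [q0]pt_eta pt_eq0 x0 y0.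
  by move=> ->; rewrite scale0r eqxx.
have [m [h [mE hh hAh hBh]]] := isform_cross_div hA hB nA e12.
exists m, h; split=> // q; apply: bev_inj => w _; rewrite bevZ.
have hsq : isform 12 (fun q => bev (ev F (square q)) w).
  have [c hc] := isform_bev_ev F w.
  apply: (@isform_ext _ _ _ (fun q => \sum_(i < 7) c i * ((q 0 0 ^+ 2) ^+ (6 - i) * (q 1 0 ^+ 2) ^+ i))).
    by move=> q'; rewrite hc; apply: eq_bigr => i _; rewrite square0 square1.
  apply: isform_sum => i; apply: isformZ; apply: (@isform_ext _ _ _ (fun q => q 0 0 ^+ (2 * (6 - i)) * q 1 0 ^+ (2 * i))).
    by move=> q'; rewrite !exprM.
  by apply: isform_mono; have := ltn_ord i; lia.
have hL := isform_f1 w hg; rewrite mE in hL.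
apply: (isform_eq hL (isformM hh hsq)) => q' nq.
have [k ek] := relk q' nq; rewrite ek bevZ; congr (_ * _).
have := hAh q'; have := hBh q'; rewrite (AE _ _ ek) (BE _ _ ek).
case: (eqVneq (q' 0 0) 0) => x0; case: (eqVneq (q' 1 0) 0) => y0.
- by move: nq; rewrite [q']pt_eta pt_eq0 x0 y0 eqxx.
- by rewrite mulrC => /(mulfI (expf_neq0 12 y0)).
- by move=> _; rewrite mulrC => /(mulfI (expf_neq0 12 x0)).
- by move=> _; rewrite mulrC => /(mulfI (expf_neq0 12 x0)).
Qed.

End BinaryForms.

(** * The six linear factors of the octahedral form along a curve *)

Section OctahedralContents.
Variable K : numClosedFieldType.
Local Notation I := ('i%R : K).

(** The linear factors of the octahedral form are l, m, l - m, l + m, l - i m and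
    l + i m, each written as oal l + obe m. *)
Definition oal (i : 'I_6) : K := nth 0 [:: 1; 0; 1; 1; 1; 1] i.
Definition obe (i : 'I_6) : K := nth 0 [:: 0; 1; -1; 1; - I; I] i.

Lemma sqI : I * I = -1. Proof. by rewrite -expr2 sqrCi. Qed.

Lemma odet_neq0 i j : i != j -> oal i * obe j - oal j * obe i != 0.
Proof.
have I0 : I != 0 := neq0Ci K.
have I1 : I - 1 != 0.
  by apply/negP => /eqP h; have := sqI; rewrite (_ : I = 1);
    [move/eqP; rewrite mulr1 -subr_eq0 opprK (_ : 1 + 1 = 2%:R) ?pnatr_eq0 // -natrD |
     apply/eqP; rewrite -subr_eq0 h].
have I2 : I + 1 != 0.
  by apply/negP => /eqP h; have := sqI; rewrite (_ : I = - 1);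
    [move/eqP; rewrite mulrNN mulr1 -subr_eq0 opprK (_ : 1 + 1 = 2%:R) ?pnatr_eq0 // -natrD |
     apply/eqP; rewrite -subr_eq0 opprK h].
have n2 : (2 : K) != 0 by rewrite pnatr_eq0.
have e k (x : K) : k != 0 -> (x = k) + (x = - k) -> x != 0.
  by move=> k0 [] ->; rewrite ?oppr_eq0.
case: i => [[|[|[|[|[|[|]]]]]] hi] //; case: j => [[|[|[|[|[|[|]]]]]] hj] //= ;
  rewrite /oal /obe /= => _;
  first [ apply: (e 1); [exact: oner_neq0 | by first [left; ring | right; ring]]
        | apply: (e 2); [exact: n2 | by first [left; ring | right; ring]]
        | apply: (e I); [exact: I0 | by first [left; ring | right; ring]]
        | apply: (e (2 * I)); [exact: mulf_neq0 | by first [left; ring | right; ring]]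
        | apply: (e (I - 1)); [exact: I1 | by first [left; ring | right; ring]]
        | apply: (e (I + 1)); [exact: I2 | by first [left; ring | right; ring]]].
Qed.

Variables a b c d H : {poly K}.
Hypothesis ncz : forall z, ~ [/\ a.[z] = 0, b.[z] = 0, c.[z] = 0 & d.[z] = 0].
Hypothesis H0 : H != 0.

Let L (u v : K) := u *: d - v *: b.
Let M (u v : K) := v *: a - u *: c.
Let D := a * d - b * c.

Variable P : K -> K -> {poly K}.
Hypothesis HP : forall u v, H * P u v = L u v * M u v * (L u v ^+ 4 - M u v ^+ 4).

Let cu i := oal i *: d - obe i *: c.
Let cv i := obe i *: a - oal i *: b.

Let factE u v : H * P u v = \prod_i (u *: cu i + v *: cv i).
Proof.
have e i : u *: cu i + v *: cv i = oal i *: L u v + obe i *: M u v.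
  by rewrite /cu /cv /L /M -!mul_polyC; ring.
rewrite HP (eq_bigr _ (fun i _ => e i)) !big_ord_recl big_ord0 /oal /obe /=.
have hI : (I%:P : {poly K}) * I%:P = -1 by rewrite -polyCM sqI polyCN.
rewrite -!mul_polyC !polyCN polyC0 polyC1.
move: (L u v) (M u v) (I%:P) hI => l m J hJ.
transitivity (l * m * (l - m) * (l + m) * (l * l - (J * J) * m * m)); last by ring.
by rewrite hJ; ring.
Qed.

Let detE i j : cu i * cv j - cu j * cv i = (oal i * obe j - oal j * obe i) *: D.
Proof. by rewrite /cu /cv /D -!mul_polyC polyCB !polyCM; ring. Qed.

Let contents : exists (k : K) (G x y : 'I_6 -> {poly K}), [/\ k != 0,
  H = k *: \prod_i G i, forall i, cu i = G i * x i & forall i, cv i = G i * y i].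
Proof.
by apply: gauss_linear_prod => // u v; rewrite -factE dvdp_mulIl.
Qed.

(** Two of the six linear forms vanish together only where the whole matrix
    does. *)
Let disjoint_roots (G x y : 'I_6 -> {poly K}) i j z :
  (forall i, cu i = G i * x i) -> (forall i, cv i = G i * y i) ->
  i != j -> (G i).[z] = 0 -> (G j).[z] != 0.
Proof.
move=> hu hv ij Gi; apply/eqP => Gj; apply: (@ncz z).
have ui : (cu i).[z] = 0 by rewrite hu hornerM Gi mul0r.
have uj : (cu j).[z] = 0 by rewrite hu hornerM Gj mul0r.
have vi : (cv i).[z] = 0 by rewrite hv hornerM Gi mul0r.
have vj : (cv j).[z] = 0 by rewrite hv hornerM Gj mul0r.
move: ui uj vi vj; rewrite /cu /cv !hornerE => ui uj vi vj.
have dt := odet_neq0 ij; split; apply/(mulfI dt); rewrite mulr0.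
- by transitivity (oal i * (obe j * a.[z] - oal j * b.[z])
     - oal j * (obe i * a.[z] - oal i * b.[z])); [ring | rewrite vi vj; ring].
- by transitivity (obe i * (obe j * a.[z] - oal j * b.[z])
     - obe j * (obe i * a.[z] - oal i * b.[z])); [ring | rewrite vi vj; ring].
- by transitivity (oal j * (oal i * d.[z] - obe i * c.[z])
     - oal i * (oal j * d.[z] - obe j * c.[z])); [ring | rewrite ui uj; ring].
- by transitivity (obe j * (oal i * d.[z] - obe i * c.[z])
     - obe i * (oal j * d.[z] - obe j * c.[z])); [ring | rewrite ui uj; ring].
Qed.

Lemma content_dvd_det : H %| a * d - b * c.
Proof.
have [k [G [x [y [k0 HE hu hv]]]]] := contents.
rewrite HE dvdpZl //; apply: coprime_prod_dvdp => [i j ij z|i].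
  exact: (disjoint_roots hu hv).
have [j ij] : exists j : 'I_6, i != j.
  by case: (eqVneq i ord0) => [->|n]; [exists ord_max | exists ord0].
rewrite -[_ - _]/D -(dvdpZr _ _ (odet_neq0 ij)) -detE (hu i) (hv i) -mulrA.
by rewrite [cu j * _]mulrCA -mulrBr dvdp_mulIl.
Qed.

(** Here the contents multiply up to the determinant, so the determinant of two
    reduced linear forms is a constant times the contents of the other four. At
    most one content vanishes at r, and two forms chosen to include its index
    stay independent there: the value at r has two distinct zeros. *)
Lemma quotient_two_roots (k' : K) (r : K) : k' != 0 -> D = k' *: H ->
  exists u1 v1 u2 v2 : K, [/\ u1 * v2 - u2 * v1 != 0,
     (P u1 v1).[r] = 0 & (P u2 v2).[r] = 0].
Proof.
move=> k'0 DE; have [k [G [x [y [k0 HE hu hv]]]]] := contents.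
have [i [j [ij Gl]]] : exists i j, i != j /\
    forall l, l != i -> l != j -> (G l).[r] != 0.
  case: (pselect (exists i, (G i).[r] = 0)) => [[i Gi]|nG].
    have [j ij] : exists j : 'I_6, i != j.
      by case: (eqVneq i ord0) => [->|n]; [exists ord_max | exists ord0].
    exists i, j; split=> // l li _.
    by apply: (disjoint_roots hu hv _ Gi); rewrite eq_sym.
  by exists ord0, ord_max; split=> // l _ _; apply/eqP => Gl; apply: nG; exists l.
have nG l : G l != 0.
  apply: contraNneq H0 => Gl0; rewrite HE (bigD1 l) //= Gl0 mul0r scaler0 //.
have dxy : x i * y j - x j * y i =
    ((oal i * obe j - oal j * obe i) * k' * k) *: \prod_(l | (l != i) && (l != j)) G l.
  apply: (mulfI (nG j)); apply: (mulfI (nG i)).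
  transitivity (cu i * cv j - cu j * cv i); first by rewrite !hu !hv; ring.
  rewrite detE DE HE (bigD1 i) //= (bigD1 j) /=; last by rewrite eq_sym.
  by rewrite -!mul_polyC !polyCM; ring.
have PE u v : k *: P u v = \prod_i (u *: x i + v *: y i).
  apply: (mulfI (_ : \prod_i G i != 0)); first by apply/prodf_neq0.
  rewrite -scalerAr scalerAl -HE factE -big_split; apply: eq_bigr => l _ /=.
  by rewrite hu hv mulrDr -!scalerAr.
exists (- (y i).[r]), (x i).[r], (- (y j).[r]), (x j).[r]; split.
- rewrite (_ : _ - _ = (x i * y j - x j * y i).[r]); last by rewrite !hornerE; ring.
  rewrite dxy hornerZ horner_prod; apply: mulf_neq0.
    by rewrite !mulf_neq0 ?odet_neq0.
  by apply/prodf_neq0 => l /andP[li lj]; exact: Gl.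
- apply/(mulfI k0); rewrite mulr0 -hornerZ PE horner_prod (bigD1 i) //= !hornerE.
  by rewrite (_ : _ + _ = 0) ?mul0r //; ring.
- apply/(mulfI k0); rewrite mulr0 -hornerZ PE horner_prod (bigD1 j) //= !hornerE.
  by rewrite (_ : _ + _ = 0) ?mul0r //; ring.
Qed.

End OctahedralContents.

(** * Orbit closures *)

Lemma closure_zero (K : numFieldType) (T : topologicalType) (Q : T -> K^o) (S : set T) f :
  continuous Q -> (forall g, S g -> Q g = 0) -> closure S f -> Q f = 0.
Proof.
move=> cQ Q0 hf; apply: contrapT => /eqP Qf.
have e0 : 0 < `|Q f| by rewrite normr_gt0.
have hb : nbhs (Q f) (ball (Q f) `|Q f|) by apply/nbhs_ballP; exists `|Q f|.
have [g [og]] := hf _ (cQ f _ hb).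
by rewrite /= (Q0 _ og) -ball_normE /= subr0 ltxx.
Qed.

Section Closures.
Variable R : realType.
Local Notation C := R[i].
Implicit Types (q w : 'cV[C]_2) (M A B : 'M[C]_2).

Lemma continuous_poly (p : {poly C}) : continuous (fun z : C^o => p.[z] : C^o).
Proof.
elim/poly_ind: p => [|p c IH] z.
  have -> : (fun z : C^o => (0 : {poly C}).[z] : C^o) = fun=> 0.
    by apply/funext => y; rewrite horner0.
  exact: cst_continuous.
have -> : (fun z : C^o => (p * 'X + c%:P).[z] : C^o) =
    fun z : C^o => (p.[z] : C^o) * z + (c : C^o).
  by apply/funext => y; rewrite !hornerE.
apply: (@continuousD _ _ _ (fun z : C^o => (p.[z] : C^o) * z) (fun=> (c : C^o))).
  by apply: (@continuousM _ _ (fun z : C^o => p.[z] : C^o) id); [exact: IH|by move=> ? ; apply: cvg_id].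
exact: cst_continuous.
Qed.

(** The limit of a polynomial path in projective space lies in the closure of
    any set that contains all but finitely many of its points. *)
Lemma closure_path n (S : set 'rV[C^o]_n) (p : 'I_n -> {poly C}) (r : {poly C}) :
  r != 0 -> (forall z, r.[z] != 0 -> S (\row_i (p i).[z])) ->
  closure S (\row_i (p i).[0] : 'rV[C^o]_n).
Proof.
move=> r0 hS U [P hP sP].
have hP' (i : 'I_n) : nbhs (0 : C^o) (fun z : C^o => P 0 i (p i).[z]).
  have := hP 0 i; rewrite mxE => h.
  exact: (@continuous_poly (p i) 0 _ h).
have /nbhs_ballP[e /= e0 he] : nbhs (0 : C^o) (fun z : C^o => forall i : 'I_n, P 0 i (p i).[z]).
  exact: (@filter_forall C^o _ (fun (i : 'I_n) z => P 0 i (p i).[z]) (nbhs (0 : C^o)) _ hP').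
pose s := [seq e / (k.+2)%:R | k <- iota 0 (size r)].
have us : uniq s.
  rewrite map_inj_uniq ?iota_uniq // => i j /(mulfI (lt0r_neq0 e0)) /invr_inj /eqP.
  by rewrite eqr_nat => /eqP[].
have [z zs rz] : exists2 z, z \in s & r.[z] != 0.
  apply: contrapT => h; have ar : all (root r) s.
    apply/allP => z zs; apply/negPn/negP => nr; apply: h; exists z => //.
  by have := max_poly_roots r0 ar us; rewrite size_map size_iota ltnn.
exists (\row_i (p i).[z]); split; first exact: hS.
apply: sP => i j; rewrite (ord1 i) mxE; apply: (he z).
case/mapP: zs => k _ ->; rewrite -ball_normE /= sub0r normrN normrM (gtr0_norm e0).
rewrite gtr0_norm ?invr_gt0 ?ltr0n // gtr_pMr // invf_lt1 ?ltr0n //.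
by rewrite ltr1n.
Qed.

Lemma form_nonzero_poly n f q1 : isform n f -> f q1 != 0 -> forall q0,
  exists r : {poly C}, r != 0 /\ forall z, r.[z] = f (q0 + z *: q1).
Proof.
move=> hf f1 q0; have [r [_ hr rn]] := isform_line q0 q1 hf.
by exists r; split=> //; apply: contraNneq f1 => r0; rewrite -rn r0 coef0.
Qed.

Lemma row_path n m (G : 'cV[C]_2 -> binform R n) q0 q1 :
  (forall w, isform m (fun q => bev (G q) w)) ->
  exists p : 'I_n.+1 -> {poly C}, forall z, \row_i (p i).[z] = G (q0 + z *: q1).
Proof.
move=> hG; have /(_ _)/cid-/all_sig[p hp] := fun i => isform_line q0 q1 (isform_coef hG i).
exists p => z; apply/rowP => i; rewrite mxE.
by have [_ -> _] := hp i.
Qed.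

Lemma isform_bev_square n m (F : vform (binform R m) n) w :
  isform (2 * n) (fun q => bev (ev F (square q)) w).
Proof.
have [c hc] := isform_bev_ev F w.
apply: (@isform_ext _ _ _ (fun q => \sum_(i < n.+1)
  c i * (q 0 0 ^+ (2 * (n - i)) * q 1 0 ^+ (2 * i)))).
  by move=> q; rewrite hc; apply: eq_bigr => i _; rewrite square0 square1 !exprM.
apply: isform_sum => i; apply: isformZ; apply: isform_mono.
by rewrite -mulnDr subnK // -ltnS.
Qed.

Definition mat2 (a b c d : C) : 'M[C]_2 := mx_of 2 2 [:: [:: a; b]; [:: c; d]].

Lemma mat2E a b c d :
  (mat2 a b c d 0 0 = a) * (mat2 a b c d 0 1 = b) *
  (mat2 a b c d 1 0 = c) * (mat2 a b c d 1 1 = d).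
Proof. by do !split; rewrite mxE. Qed.

Lemma det2 M : \det M = M 0 0 * M 1 1 - M 0 1 * M 1 0.
Proof.
rewrite (expand_det_row _ 0) !big_ord_recl big_ord0 /cofactor !det_mx11 !mxE.
rewrite (_ : lift 0 0 = 1); last exact: val_inj.
rewrite (_ : lift 1 0 = 0); last exact: val_inj.
by rewrite /= expr0 expr1; ring.
Qed.

Lemma det_mat2 a b c d : \det (mat2 a b c d) = a * d - b * c.
Proof. by rewrite det2 !mat2E. Qed.

Lemma orbit_subst n (f h : binform R n) B c : \det B = 1 -> c != 0 ->
  (forall w, bev h w = c * bev f (B *m w)) -> Defs.orbit f h.
Proof.
move=> dB c0 e; exists (invmx B), c; split=> //; first by rewrite det_inv dB invr1.
by apply: bev_inj => w _; rewrite bevZ bev_act invmxK e.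
Qed.

Lemma orbitZ n (f h : binform R n) c : c != 0 -> Defs.orbit f h -> Defs.orbit f (c *: h).
Proof.
move=> c0 [A [k [dA k0 ->]]]; exists A, (c * k).
by rewrite mulf_neq0 // scalerA.
Qed.

Lemma f1_orbit M : \det M != 0 -> Defs.orbit (octahedral_form R) (f1 M).
Proof.
move=> dM; pose s := sqrtC (\det M).
have s0 : s != 0 by rewrite sqrtC_eq0.
have s2 : s * s = \det M by rewrite -expr2 sqrtCK.
apply: (@orbit_subst _ _ _ (s^-1 *: mat2 (M 1 1) (- M 0 1) (- M 1 0) (M 0 0)) (s ^+ 6)).
- rewrite detZ det_mat2; transitivity (s^-1 ^+ 2 * (s * s)); last by field.
  by rewrite s2 det2; ring.
- exact: expf_neq0.
- move=> w; have scal A i : ((s^-1 *: A) *m w) i 0 = s^-1 * (A *m w) i 0.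
    by rewrite -scalemxAl mxE.
  rewrite bev_f1 bev_octahedral !scal !mulcol2 !mat2E octZ mulrA.
  by rewrite exprVn mulfV ?expf_neq0 // mul1r; congr oct; ring.
Qed.

Lemma f1_neq0 M : \det M != 0 -> f1 M != 0.
Proof.
move=> dM; have [A [c [dA c0 ->]]] := f1_orbit dM.
rewrite scaler_eq0 (negPf c0) /=; apply/eqP => h.
have := bev0 6 (A *m pt 1 2%:R); rewrite -h bev_act mulmxA mulVmx ?unitmxE ?dA ?unitr1 //.
rewrite mul1mx bev_octahedral pt0 pt1 /oct => /eqP; apply/negP.
by rewrite (_ : _ * _ = - 30%:R) ?oppr_eq0 ?pnatr_eq0 //; ring.
Qed.

Lemma f1_singular M : \det M = 0 -> exists k a b : C,
  forall w, bev (f1 M) w = k * (a * w 0 0 + b * w 1 0) ^+ 6.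
Proof.
rewrite det2 => /eqP; rewrite subr_eq0 => /eqP dM.
case: (pselect (exists t, M 0 0 = - t * M 0 1 /\ - M 1 0 = t * M 1 1)) => [[t [ea ec]]|nt].
  have {}ec : M 1 0 = - (t * M 1 1) by rewrite -ec opprK.
  exists (t * (1 - t ^+ 4)), (M 1 1), (- M 0 1) => w.
  by rewrite bev_f1 ea ec /oct; ring.
case: (eqVneq (M 1 1) 0) => [d0|d0].
  case: (eqVneq (M 0 1) 0) => [b0|b0].
    by exists 0, 0, 0 => w; rewrite bev_f1 d0 b0 /oct; ring.
  case: nt; exists (- M 0 0 / M 0 1); split; first by field.
  move: dM; rewrite d0 mulr0 => /esym/eqP; rewrite mulf_eq0 (negPf b0) /= => /eqP ->.
  by rewrite mulr0 oppr0.
case: nt; exists (- M 1 0 / M 1 1); split; last by field.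
by apply: (mulIf d0); rewrite dM; field.
Qed.

(** l^6 + z l^5 r is the product of l^5 and a linear form independent of l, hence
    in the orbit of u^5 v, as soon as z is not 0. *)
Lemma sixth_power_closure (f : binform R 6) (k a b : C) : f != 0 ->
  (forall w, bev f w = k * (a * w 0 0 + b * w 1 0) ^+ 6) ->
  closure (Defs.orbit (u5v R) : set 'rV[C^o]_7) f.
Proof.
move=> f0 hf; have [w _ fw] := bev_neq0 f0.
have k0 : k != 0 by apply: contraNneq fw => k0; rewrite hf k0 mul0r.
have [c [d abcd]] : exists c d, a * d - b * c = 1.
  case: (eqVneq a 0) => [a0|a0]; last by exists 0, a^-1; rewrite mulr0 subr0 mulfV.
  case: (eqVneq b 0) => [b0|b0]; last by exists (- b^-1), 0; rewrite a0; field.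
  by move: fw; rewrite hf a0 b0 !mul0r addr0 expr0n mulr0 eqxx.
pose e := k *: act (invmx (mat2 a b c d)) (u5v R).
have he w' : bev e w' = k * (a * w' 0 0 + b * w' 1 0) ^+ 5 * (c * w' 0 0 + d * w' 1 0).
  by rewrite bevZ bev_act invmxK bev_u5v !mulcol2 !mat2E mulrA.
have := @closure_path _ (Defs.orbit (u5v R)) (fun i => (f 0 i)%:P + e 0 i *: 'X) 'X.
have path z : \row_i ((f 0 i)%:P + e 0 i *: 'X).[z] = f + z *: e.
  apply/rowP => i; rewrite mxE hornerD hornerC hornerZ hornerX [RHS]mxE.
  by rewrite [X in _ = _ + X]mxE mulrC.
rewrite path scale0r addr0; apply; first by rewrite polyX_eq0.
move=> z; rewrite hornerX path => z0.
apply: (@orbit_subst _ _ _ (mat2 a b ((a + z * c) / z) ((b + z * d) / z)) (k * z)).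
- by rewrite det_mat2 -[RHS]abcd; field; exact: z0.
- exact: mulf_neq0.
- move=> w'; rewrite bevD bevZ hf he bev_u5v !mulcol2 !mat2E; field.
  exact: z0.
Qed.

(** The invariant quadratic form on binary sextics, a multiple of the sixth
    transvectant of f with itself. *)
Definition quadQ (f : binform R 6) : C :=
  120%:R * f 0 (inord 0) * f 0 (inord 6) - 20%:R * f 0 (inord 1) * f 0 (inord 5)
  + 8%:R * f 0 (inord 2) * f 0 (inord 4) - 3%:R * f 0 (inord 3) ^+ 2.

Lemma coef_of_bev (f : binform R 6) (c0 c1 c2 c3 c4 c5 c6 : C) :
  (forall x y, bev f (pt x y) = c0 * x ^+ 6 + c1 * (x ^+ 5 * y) + c2 * (x ^+ 4 * y ^+ 2)
    + c3 * (x ^+ 3 * y ^+ 3) + c4 * (x ^+ 2 * y ^+ 4) + c5 * (x * y ^+ 5) + c6 * y ^+ 6) ->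
  quadQ f = 120%:R * c0 * c6 - 20%:R * c1 * c5 + 8%:R * c2 * c4 - 3%:R * c3 ^+ 2.
Proof.
move=> h; pose s := [:: c0; c1; c2; c3; c4; c5; c6].
have -> : f = \row_i nth 0 s i.
  apply: bev_inj => w _; rewrite [w]pt_eta h /bev !big_ord_recl big_ord0 !mxE /=.
  by ring.
by rewrite /quadQ !mxE !inordK.
Qed.

Lemma quadQ_u5v (f : binform R 6) : Defs.orbit (u5v R) f -> quadQ f = 0.
Proof.
move=> [A [k [dA k0 ->]]].
set B := invmx A.
have h x y : bev (k *: act A (u5v R)) (pt x y) =
    k * ((B 0 0 * x + B 0 1 * y) ^+ 5 * (B 1 0 * x + B 1 1 * y)).
  by rewrite bevZ bev_act bev_u5v !mulcol2 pt0 pt1.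
move: (B 0 0) (B 0 1) (B 1 0) (B 1 1) h => a b c d h.
rewrite (@coef_of_bev _ (k * (a ^+ 5 * c)) (k * (a ^+ 5 * d + 5%:R * a ^+ 4 * b * c))
  (k * (5%:R * a ^+ 4 * b * d + 10%:R * a ^+ 3 * b ^+ 2 * c))
  (k * (10%:R * a ^+ 3 * b ^+ 2 * d + 10%:R * a ^+ 2 * b ^+ 3 * c))
  (k * (10%:R * a ^+ 2 * b ^+ 3 * d + 5%:R * a * b ^+ 4 * c))
  (k * (5%:R * a * b ^+ 4 * d + b ^+ 5 * c)) (k * (b ^+ 5 * d))).
  by ring.
by move=> x y; rewrite h; ring.
Qed.

Lemma quadQ_f1 M : quadQ (f1 M) = 20%:R * \det M ^+ 6.
Proof.
rewrite det2; have h x y : bev (f1 M) (pt x y) =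
    oct (M 1 1 * x - M 0 1 * y) (M 0 0 * y - M 1 0 * x) by rewrite bev_f1 pt0 pt1.
move: (M 0 0) (M 0 1) (M 1 0) (M 1 1) h => a b c d h.
pose p0 := - (d ^+ 5 * c) + d * c ^+ 5.
pose p1 := d ^+ 5 * a + 5%:R * d ^+ 4 * b * c - (5%:R * d * c ^+ 4 * a + b * c ^+ 5).
pose p2 := - (5%:R * d ^+ 4 * b * a + 10%:R * d ^+ 3 * b ^+ 2 * c)
  + (10%:R * d * c ^+ 3 * a ^+ 2 + 5%:R * b * c ^+ 4 * a).
pose p3 := 10%:R * d ^+ 3 * b ^+ 2 * a + 10%:R * d ^+ 2 * b ^+ 3 * c
  - (10%:R * d * c ^+ 2 * a ^+ 3 + 10%:R * b * c ^+ 3 * a ^+ 2).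
pose p4 := - (10%:R * d ^+ 2 * b ^+ 3 * a + 5%:R * d * b ^+ 4 * c)
  + (5%:R * d * c * a ^+ 4 + 10%:R * b * c ^+ 2 * a ^+ 3).
pose p5 := 5%:R * d * b ^+ 4 * a + b ^+ 5 * c - (d * a ^+ 5 + 5%:R * b * c * a ^+ 4).
pose p6 := - (b ^+ 5 * a) + b * a ^+ 5.
rewrite (@coef_of_bev _ p0 p1 p2 p3 p4 p5 p6).
  by rewrite /p0 /p1 /p2 /p3 /p4 /p5 /p6; ring.
by move=> x y; rewrite h /oct /p0 /p1 /p2 /p3 /p4 /p5 /p6; ring.
Qed.

Lemma quadQZ k (f : binform R 6) : quadQ (k *: f) = k ^+ 2 * quadQ f.
Proof. by rewrite /quadQ !mxE; ring. Qed.

Lemma continuous_quadQ : continuous (quadQ : 'rV[C^o]_7 -> C^o).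
Proof.
have co i : continuous (fun f : 'rV[C^o]_7 => f 0 i : C^o) by exact: coord_continuous.
have cc (a : C^o) : continuous (fun _ : 'rV[C^o]_7 => a : C^o) by move=> f; exact: cst_continuous.
have cm (f g : 'rV[C^o]_7 -> C^o) : continuous f -> continuous g -> continuous (f \* g : 'rV[C^o]_7 -> C^o).
  by move=> hf hg x; apply: continuousM; [exact: hf|exact: hg].
have cd (f g : 'rV[C^o]_7 -> C^o) : continuous f -> continuous g -> continuous (f \+ g : 'rV[C^o]_7 -> C^o).
  by move=> hf hg x; apply: continuousD; [exact: hf|exact: hg].
pose m (a : C^o) i j : 'rV[C^o]_7 -> C^o := fun f => a * f 0 (inord i) * f 0 (inord j).
have hm a i j : continuous (m a i j) by exact: (cm _ _ (cm _ _ (cc a) (co _)) (co _)).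
have -> : (quadQ : 'rV[C^o]_7 -> C^o) = m 120%:R 0%N 6%N \+ m (- 20%:R) 1%N 5%N
    \+ m 8%:R 2%N 4%N \+ m (- 3%:R) 3%N 3%N.
  by apply/funext => f; rewrite /quadQ /m /=; ring.
exact: (cd _ _ (cd _ _ (cd _ _ (hm _ _ _) (hm _ _ _)) (hm _ _ _)) (hm _ _ _)).
Qed.

Lemma quadQ_closure (f : binform R 6) : orbit_closure (u5v R) f -> quadQ f = 0.
Proof.
move=> [_ hf].
exact: (@closure_zero C 'rV[C^o]_7 quadQ (Defs.orbit (u5v R)) f continuous_quadQ quadQ_u5v hf).
Qed.

End Closures.

(** * Lifts and the degree bound *)

Section Lifts.
Variable R : realType.
Local Notation C := R[i].
Implicit Types (q w : 'cV[C]_2) (M A B : 'M[C]_2) (F : vform (binform R 6) 6).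

Lemma full_neq0 F q : linearly_full (ev F) -> q != 0 -> ev F q != 0.
Proof.
move=> full nq; have [l hl] := full_monomials full; apply: contraNneq nq => e.
rewrite [q]pt_eta pt_eq0; apply/andP; split.
  have := hl ord0 q; rewrite e mul0mx mxE /= subn0 expr0 mulr1 => /esym/eqP.
  by rewrite expf_eq0.
have := hl ord_max q; rewrite e mul0mx mxE /= subnn expr0 mul1r => /esym/eqP.
by rewrite expf_eq0.
Qed.

Lemma square_surj q : exists q', q = square q'.
Proof.
exists (pt (sqrtC (q 0 0)) (sqrtC (q 1 0))); rewrite [LHS]pt_eta [RHS]pt_eta.
by rewrite square0 square1 pt0 pt1 !sqrtCK.
Qed.

Lemma square_neq0 q : q != 0 -> square q != 0.
Proof.
by rewrite {1}[q]pt_eta [square q]pt_eta !pt_eq0 square0 square1 !expf_eq0.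
Qed.

Lemma ex_coord_neq0 q : q != 0 -> exists i, q i 0 != 0.
Proof.
move=> nq; apply: contrapT => h; move/eqP: nq; apply; apply/matrixP => i j.
by rewrite (ord1 j) mxE; apply: contrapT => /eqP hi; apply: h; exists i.
Qed.

Lemma isform_coord (i : 'I_2) : isform 1 (fun q => q i 0).
Proof.
case: i => [[|[|i]] hi] //.
  by apply: isform_ext (isform_x C) => q; congr (q _ _); apply: val_inj.
by apply: isform_ext (isform_y C) => q; congr (q _ _); apply: val_inj.
Qed.

Lemma isform_det n (g : 'cV[C]_2 -> 'M[C]_2) :
  (forall i j, isform n (fun q => g q i j)) -> isform (2 * n) (fun q => \det (g q)).
Proof.
move=> hg; rewrite mul2n -addnn.
by apply: isform_ext (isformB (isformM (hg 0 0) (hg 1 1)) (isformM (hg 0 1) (hg 1 0))) => q;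
  rewrite det2.
Qed.

(** If det g vanished identically, [f1 (g q)] would always be a sixth power, and
    the curve would stay in the closure of the orbit of [u^5 v]. *)
Lemma lift_det_neq0 n (g : 'cV[C]_2 -> 'M[C]_2) F :
  (forall i j, isform n (fun q => g q i j)) -> sextic_curve F ->
  (exists q, q != 0 /\ f1 (g q) != 0) ->
  (forall q, q != 0 -> f1 (g q) != 0 -> peq (f1 (g q)) (ev F (square q))) ->
  exists q, \det (g q) != 0.
Proof.
move=> hg [[_ nF] _ _ [q' [nq' Fq']]] [q1 [nq1 f1q1]] rel.
apply: contrapT => h; have {h} d0 q : \det (g q) = 0.
  by apply: contrapT => /eqP hq; apply: h; exists q.
apply: Fq'; split; first exact: nF.
have [q0 ->] := square_surj q'.
have [p hp] := row_path q0 q1 (isform_bev_square F).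
have [i xi] := ex_coord_neq0 nq1.
have [w _ fw] := bev_neq0 f1q1.
have hf := isformM (isform_coord i) (isform_f1 w hg).
have [r [r0 hr]] := form_nonzero_poly hf (mulf_neq0 xi fw) q0.
have := @closure_path _ _ (closure (Defs.orbit (u5v R) : set 'rV[C^o]_7)) p r r0.
rewrite hp scale0r addr0 => hc; apply: closed_closure; apply: hc => z.
rewrite hr hp; set q := _ + _; rewrite mulf_eq0 negb_or => /andP[xq fq].
have nq : q != 0 by apply: contraNneq xq => ->; rewrite mxE.
have fq0 : f1 (g q) != 0 by apply: contraNneq fq => ->; rewrite bev0.
have [c [c0 ec]] := rel q nq fq0.
have [k [a [b hk]]] := f1_singular (d0 q).
apply: (@sixth_power_closure _ _ (c^-1 * k) a b).
  exact/nF/square_neq0.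
by move=> w'; rewrite -mulrA -hk ec bevZ mulKf.
Qed.

(** A point of the curve with det g = 0 is a limit of points of the open orbit.
    The curve leaves the closure of the orbit of u^5 v because the invariant
    quadratic form takes the value 20 (det g)^6 on f1 (g). *)
Lemma lift_sextic n m (g : 'cV[C]_2 -> 'M[C]_2) h F :
  (forall i j, isform n (fun q => g q i j)) -> isform m h ->
  (exists q, q != 0 /\ \det (g q) != 0) -> linearly_full (ev F) ->
  (forall q, f1 (g q) = h q *: ev F (square q)) -> sextic_curve F.
Proof.
move=> hg hh [q1 [nq1 d1]] full lift.
have hne q : \det (g q) != 0 -> h q != 0.
  by move/f1_neq0; apply: contraNneq => h0; rewrite lift h0 scale0r.
have FE q : \det (g q) != 0 -> ev F (square q) = (h q)^-1 *: f1 (g q).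
  by move=> dq; rewrite lift scalerA mulVf ?hne // scale1r.
split=> //.
- by split; [exists F | move=> q; exact: full_neq0].
- move=> q nq; split; first exact: full_neq0.
  have [q0 ->] := square_surj q.
  have [p hp] := row_path q0 q1 (isform_bev_square F).
  have [r [r0 hr]] := form_nonzero_poly (isform_det hg) d1 q0.
  have := @closure_path _ _ (Defs.orbit (octahedral_form R) : set 'rV[C^o]_7) p r r0.
  rewrite hp scale0r addr0; apply => z; rewrite hr hp => dz.
  by rewrite FE //; apply: orbitZ (f1_orbit dz); rewrite invr_eq0 hne.
- exists (square q1); split; first exact: square_neq0.
  move=> /quadQ_closure/eqP; rewrite FE // quadQZ quadQ_f1; apply/negP.
  by rewrite !mulf_neq0 ?expf_neq0 ?invr_eq0 ?hne // pnatr_eq0.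
Qed.

Definition indep q0 q1 : bool := q0 0 0 * q1 1 0 - q0 1 0 * q1 0 0 != 0.

Lemma indep_neq0 q0 q1 : indep q0 q1 -> forall z, q0 + z *: q1 != 0.
Proof.
move=> hi z; apply/eqP => /colP e; move/negP: hi; apply; apply/eqP.
have := e 0; have := e 1; rewrite !mxE => e1 e0.
transitivity ((q0 0 0 + z * q1 0 0) * q1 1 0 - (q0 1 0 + z * q1 1 0) * q1 0 0); first by ring.
by rewrite e0 e1 !mul0r subrr.
Qed.

Lemma ex_indep q1 : q1 != 0 -> exists q0, indep q0 q1.
Proof.
rewrite [q1]pt_eta pt_eq0 negb_and /indep => /orP[x0|y0].
  by exists (pt 0 1); rewrite !pt0 !pt1 mul0r mul1r sub0r oppr_eq0.
by exists (pt 1 0); rewrite !pt0 !pt1 mul0r mul1r subr0.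
Qed.

Lemma not_indep q0 q1 : q0 != 0 -> ~~ indep q0 q1 -> exists k : C, q1 = k *: q0.
Proof.
rewrite {1}[q0]pt_eta pt_eq0 negb_and /indep negbK subr_eq0 => /orP[x0|y0] /eqP e.
  exists (q1 0 0 / q0 0 0); rewrite [LHS]pt_eta [RHS]pt_eta !mxE divfK //.
  by congr pt; apply: (mulfI x0); rewrite e; field.
exists (q1 1 0 / q0 1 0); rewrite [LHS]pt_eta [RHS]pt_eta !mxE divfK //.
by congr pt; apply: (mulfI y0); rewrite -e; field.
Qed.

Lemma isform_line0 n f q0 q1 : isform n f -> indep q0 q1 ->
  (forall z, f (q0 + z *: q1) = 0) -> forall q, f q = 0.
Proof.
move=> hf hi hz.
have hd : isform 1 (fun q => q1 1 0 * q 0 0 + - q1 0 0 * q 1 0) := isform_lin _ _.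
apply: (isform_cancel hd hf (isform0 _ n)).
  by exists q0; rewrite mulNr mulrC [q1 0 0 * _]mulrC.
move=> q _; rewrite mulr0; set a := _ + _.
case: (eqVneq a 0) => [->|a0]; first by rewrite mul0r.
set d := q0 0 0 * q1 1 0 - q0 1 0 * q1 0 0 in hi.
have d0 : d != 0 by [].
pose b := q0 0 0 * q 1 0 - q0 1 0 * q 0 0.
have -> : q = (a / d) *: (q0 + (b / a) *: q1).
  apply/colP => i; rewrite !mxE.
  transitivity ((a * q0 i 0 + b * q1 i 0) / d); last by field; rewrite a0 d0.
  apply: (mulIf d0); rewrite divfK // /a /b /d.
  case: i => [[|[|i]] hi'] //.
    by rewrite (_ : Ordinal hi' = 0); [ring | exact: val_inj].
  by rewrite (_ : Ordinal hi' = 1); [ring | exact: val_inj].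
by rewrite (isform_hom _ _ hf) hz !mulr0.
Qed.

(** Restriction of a lift to a line: the data of the octahedral content
    lemmas. *)
Lemma lift_line n m (g : 'cV[C]_2 -> 'M[C]_2) h F q0 q1 :
  (forall i j, isform n (fun q => g q i j)) -> (forall q, q != 0 -> g q != 0) ->
  isform m h -> (forall q, f1 (g q) = h q *: ev F (square q)) -> indep q0 q1 ->
  exists (a b c d H : {poly C}) (P : C -> C -> {poly C}),
  [/\ forall z, ~ [/\ a.[z] = 0, b.[z] = 0, c.[z] = 0 & d.[z] = 0],
      forall u v, H * P u v = (u *: d - v *: b) * (v *: a - u *: c) *
        ((u *: d - v *: b) ^+ 4 - (v *: a - u *: c) ^+ 4),
      (forall z, (a * d - b * c).[z] = \det (g (q0 + z *: q1))) /\
      (size (a * d - b * c)%R <= (2 * n).+1)%N,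
      [/\ (size H <= m.+1)%N, forall z, H.[z] = h (q0 + z *: q1) & H`_m = h q1]
    & forall u v z, (P u v).[z] = bev (ev F (square (q0 + z *: q1))) (pt u v)].
Proof.
move=> hg ng hh lift hi.
have /(_ _)/cid-/all_sig[e he] := fun ij : 'I_2 * 'I_2 => isform_line q0 q1 (hg ij.1 ij.2).
have [H hH] := isform_line q0 q1 hh.
have /(_ _)/cid-/all_sig[P hP] :=
  fun uv : C * C => isform_line q0 q1 (isform_bev_square F (pt uv.1 uv.2)).
have ee i j z : (e (i, j)).[z] = g (q0 + z *: q1) i j by have [_ -> _] := he (i, j).
have se i j : (size (e (i, j)) <= n.+1)%N by have [] := he (i, j).
exists (e (0, 0)), (e (0, 1)), (e (1, 0)), (e (1, 1)), H, (fun u v => P (u, v)).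
split=> //.
- move=> z []; rewrite !ee => e1 e2 e3 e4; move/eqP: (ng _ (indep_neq0 hi z)); apply.
  apply/matrixP => i j; rewrite [RHS]mxE.
  case: i => [[|[|i]] hi1] //; case: j => [[|[|j]] hj1] //;
    [rewrite -[RHS]e1|rewrite -[RHS]e2|rewrite -[RHS]e3|rewrite -[RHS]e4];
    by congr (g _ _ _); apply: val_inj.
- move=> u v; apply: poly_ext => z; have [_ hz _] := hH; have [_ hPz _] := hP (u, v).
  have hl (s t : C) (a b : {poly C}) y : (s *: a - t *: b).[y] = a.[y] * s - b.[y] * t.
    by rewrite hornerD hornerN !hornerZ ![_ * s]mulrC ![_ * t]mulrC.
  rewrite hornerM hz hPz -bevZ -lift bev_f1 pt0 pt1 /oct.
  by rewrite 2!hornerM !hl hornerD hornerN !horner_exp !hl !ee.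
- split; first by move=> z; rewrite !hornerE !ee det2.
  rewrite mul2n -addnn; apply: size_polyB_bound; exact: size_polyM_bound.
- by move=> u v z; have [_ hPz _] := hP (u, v); rewrite hPz.
Qed.

(** The common factor h divides det g, which bounds its degree; if the degrees
    agree, the quotient is constant. *)
Lemma lift_degree n m (g : 'cV[C]_2 -> 'M[C]_2) h F :
  (forall i j, isform n (fun q => g q i j)) -> (forall q, q != 0 -> g q != 0) ->
  isform m h -> (forall q, f1 (g q) = h q *: ev F (square q)) ->
  (exists q, q != 0 /\ \det (g q) != 0) ->
  (m <= 2 * n)%N /\ (m = (2 * n)%N -> exists k : C, k != 0 /\
    forall q, \det (g q) = k * h q).
Proof.
move=> hg ng hh lift [q1 [nq1 d1]]; have [q0 hi] := ex_indep nq1.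
have [a [b [c [d [H [P [ncz HP [DE sD] [sH HE Hm] PE]]]]]]] := lift_line hg ng hh lift hi.
have h1 : h q1 != 0.
  by move/f1_neq0: d1; apply: contraNneq => h0; rewrite lift h0 scale0r.
have H0 : H != 0 by apply: contraNneq h1 => H0; rewrite -Hm H0 coef0.
have dvd := content_dvd_det ncz H0 HP.
have D0 : a * d - b * c != 0.
  apply/negP => /eqP D0; have [r [r0 hr]] := form_nonzero_poly (isform_det hg) d1 q0.
  by case/negP: r0; apply/eqP/poly_all0 => z; rewrite hr -DE D0 horner0.
have sHm : size H = m.+1.
  apply/eqP; rewrite eqn_leq sH /= ltnNge; apply: contra h1 => s; rewrite -Hm.
  by rewrite nth_default.
have le := dvdp_leq D0 dvd; rewrite sHm in le.
split; first by rewrite -ltnS; exact: leq_trans le sD.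
move=> mE; have : a * d - b * c %= H.
  by rewrite eqp_sym -dvdp_size_eqp // sHm eqn_leq le mE sD.
move/eqpP => [[k1 k2] /= /andP[k10 k20] eD].
have k0 : k2 / k1 != 0 by rewrite mulf_neq0 ?invr_eq0.
exists (k2 / k1); split=> // q; apply/eqP; rewrite -subr_eq0; apply/eqP.
have hf : isform (2 * n) (fun q => \det (g q) - k2 / k1 * h q).
  by apply: isformB (isform_det hg) _; rewrite -mE; exact: isformZ.
apply: (isform_line0 hf hi) => z; rewrite -DE -HE.
have := congr1 (fun p : {poly C} => p.[z]) eD; rewrite /= !hornerZ => ez.
by apply: (mulfI k10); rewrite mulr0 mulrBr ez; field.
Qed.

(** Where the common factor is all of det g, no point of the curve is a sixth
    power: after the common divisors are removed, two of the six linear factors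
    stay independent at every point. *)
Lemma lift_not_sixth_power n (g : 'cV[C]_2 -> 'M[C]_2) h F (k : C) :
  (forall i j, isform n (fun q => g q i j)) -> (forall q, q != 0 -> g q != 0) ->
  isform (2 * n) h -> (forall q, f1 (g q) = h q *: ev F (square q)) ->
  k != 0 -> (forall q, \det (g q) = k * h q) -> (exists q, q != 0 /\ h q != 0) ->
  linearly_full (ev F) ->
  forall q (c a b : C), q != 0 ->
    ~ forall w, bev (ev F q) w = c * (a * w 0 0 + b * w 1 0) ^+ 6.
Proof.
move=> hg ng hh lift k0 Dh [q2 [nq2 h2]] full q c a b nq hsix.
have [q0 qE] := square_surj q.
have nq0 : q0 != 0.
  apply: contraNneq nq => q00; rewrite qE q00; apply/eqP/colP => i.
  by rewrite !mxE expr0n.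
have [q1 [hi [z hz]]] : exists q1, indep q0 q1 /\ exists z, h (q0 + z *: q1) != 0.
  case: (eqVneq (h q0) 0) => [h00|h00].
    have hi : indep q0 q2.
      case: (boolP (indep q0 q2)) => // /(not_indep nq0)[l lE].
      by move: h2; rewrite lE (isform_hom _ _ hh) h00 mulr0 eqxx.
    exists q2; split=> //; have [r [r0 hr]] := form_nonzero_poly hh h2 q0.
    by have [z hz] := poly_neq0_ex r0; exists z; rewrite -hr.
  have [q1 hi] := ex_indep nq0; exists (- q1); split.
    by rewrite /indep !mxE (_ : _ - _ = q1 0 0 * q0 1 0 - q1 1 0 * q0 0 0) //; ring.
  by exists 0; rewrite scale0r addr0.
have [A [B [C0 [D [H [P [ncz HP [DE sD] [sH HE Hm] PE]]]]]]] := lift_line hg ng hh lift hi.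
have H0 : H != 0 by apply: contraNneq hz => H0; rewrite -HE H0 horner0.
have DH : A * D - B * C0 = k *: H.
  by apply: poly_ext => y; rewrite DE Dh hornerZ HE.
have [u1 [v1 [u2 [v2 [ind P1 P2]]]]] := quotient_two_roots ncz H0 HP 0 k0 DH.
move: P1 P2; rewrite !PE scale0r addr0 -qE !hsix !pt0 !pt1.
have [w _ fw] := bev_neq0 (full_neq0 full nq); rewrite hsix in fw.
move/eqP; rewrite mulf_eq0; case: (eqVneq c 0) => [c0|_ /=]; first by rewrite c0 mul0r eqxx in fw.
rewrite expf_eq0 /= => /eqP e1; move/eqP; rewrite mulf_eq0.
case: (eqVneq c 0) => [c0|_ /=]; first by rewrite c0 mul0r eqxx in fw.
rewrite expf_eq0 /= => /eqP e2.
have a0 : a = 0.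
  apply: (mulIf ind); rewrite mul0r.
  by transitivity ((a * u1 + b * v1) * v2 - (a * u2 + b * v2) * v1); [ring | rewrite e1 e2; ring].
have b0 : b = 0.
  apply: (mulIf ind); rewrite mul0r.
  by transitivity ((a * u2 + b * v2) * u1 - (a * u1 + b * v1) * u2); [ring | rewrite e1 e2; ring].
by move: fw; rewrite a0 b0 !mul0r addr0 expr0n mulr0 eqxx.
Qed.

End Lifts.

(** * Holonomy *)

Section Holonomy.
Variable R : realType.
Local Notation C := R[i].
Implicit Types (q w : 'cV[C]_2) (M A B T : 'M[C]_2) (F : vform (binform R 6) 6).

Definition flip q : 'cV[C]_2 := pt (q 0 0) (- q 1 0).

Lemma flipK q : flip (flip q) = q.
Proof. by rewrite /flip !pt0 !pt1 opprK -pt_eta. Qed.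

Lemma square_flip q : square (flip q) = square q.
Proof.
by rewrite [LHS]pt_eta [RHS]pt_eta !square0 !square1 /flip !pt0 !pt1 sqrrN.
Qed.

Lemma flip_neq0 q : q != 0 -> flip q != 0.
Proof. by rewrite {1}[q]pt_eta !pt_eq0 oppr_eq0. Qed.

Lemma flipE q : flip q = mat2 1 0 0 (-1) *m q.
Proof.
rewrite [RHS]pt_eta !mulcol2 !mat2E; congr pt; ring.
Qed.

Lemma isform_flip n f : isform n f -> isform n (fun q => f (flip q)).
Proof.
by move=> hf; apply: isform_ext (isform_comp (mat2 1 0 0 (-1)) hf) => q; rewrite flipE.
Qed.

Lemma ord2 (i : 'I_2) : i = 0 \/ i = 1.
Proof. by case: i => [[|[|i]] hi] //; [left|right]; apply: val_inj. Qed.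

Lemma mx2P (A B : 'M[C]_2) : A 0 0 = B 0 0 -> A 0 1 = B 0 1 -> A 1 0 = B 1 0 ->
  A 1 1 = B 1 1 -> A = B.
Proof.
move=> e1 e2 e3 e4; apply/matrixP => i j.
by case: (ord2 i) => ->; case: (ord2 j) => ->.
Qed.

Lemma scE m n (k : C) (A : 'M[C]_(m, n)) i j : (k *: A) i j = k * A i j.
Proof. by rewrite mxE. Qed.

Lemma mulmx2 A B i j : (A *m B) i j = A i 0 * B 0 j + A i 1 * B 1 j.
Proof.
rewrite mxE big_ord_recl big_ord1; congr (_ + A i _ * B _ _); exact: val_inj.
Qed.

(** The adjugate is used in place of the inverse, since its entries are forms if
    those of the matrix are. *)
Definition ad M := mat2 (M 1 1) (- M 0 1) (- M 1 0) (M 0 0).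

Lemma adM M : ad M *m M = (\det M)%:M.
Proof. by apply: mx2P; rewrite mulmx2 !mat2E mxE /= ?mulr1n ?mulr0n ?det2; ring. Qed.

Lemma Mad M : M *m ad M = (\det M)%:M.
Proof. by apply: mx2P; rewrite mulmx2 !mat2E mxE /= ?mulr1n ?mulr0n ?det2; ring. Qed.

Lemma f1ad M w : bev (f1 M) w = oct ((ad M *m w) 0 0) ((ad M *m w) 1 0).
Proof. by rewrite bev_f1 !mulcol2 !mat2E; congr oct; ring. Qed.

Lemma ad_mul A B : ad (A *m B) = ad B *m ad A.
Proof. by apply: mx2P; rewrite mulmx2 !mat2E !mulmx2; ring. Qed.

Lemma oct_factors (l m : C) : oct l m = \prod_(i < 6) (oal _ i * l + obe _ i * m).
Proof.
rewrite !big_ord_recl big_ord0 /oal /obe /= /oct.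
transitivity (l * m * (l - m) * (l + m) * (l * l - ('i%R * 'i%R) * m * m)); last by ring.
by rewrite sqI; ring.
Qed.

Lemma isform_prod0 (I : finType) n (f : I -> 'cV[C]_2 -> C) :
  (forall i, isform n (f i)) -> (forall q, \prod_i f i q = 0) ->
  exists i, forall q, f i q = 0.
Proof.
move=> hf.
have hP (s : seq I) : isform (n * size s) (fun q => \prod_(i <- s) f i q).
  elim: s => [|i s IH].
    by rewrite muln0; apply: isform_ext (isform_cst 1) => q; rewrite big_nil.
  by rewrite /= mulnS; apply: isform_ext (isformM (hf i) IH) => q; rewrite big_cons.
move=> h; have {}h q : \prod_(i <- enum I) f i q = 0 by rewrite big_enum; exact: h.
elim: (enum I) h => [|i s IH] h.
  by have := h 0; rewrite big_nil => /eqP; rewrite oner_eq0.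
have [|e|e] := isform_dom (hf i) (hP s); [|by exists i|exact: IH].
by move=> q _; have := h q; rewrite big_cons.
Qed.

(** A matrix of forms that maps each of the six roots of the octahedral form to
    such a root is constant up to a factor: three images of roots determine a
    projectivity, and there are finitely many choices. *)
Lemma root_permuting_const n (N : 'cV[C]_2 -> 'M[C]_2) :
  (forall i j, isform n (fun q => N q i j)) -> (exists q, \det (N q) != 0) ->
  (forall q w, oct (w 0 0) (w 1 0) = 0 -> oct ((N q *m w) 0 0) ((N q *m w) 1 0) = 0) ->
  exists (a : 'cV[C]_2 -> C) T, [/\ \det T != 0 & forall q, N q = a q *: T].
Proof.
move=> hN [q1 d1] hroot.
have key w : oct (w 0 0) (w 1 0) = 0 -> exists j, forall q,
    oal _ j * (N q *m w) 0 0 + obe _ j * (N q *m w) 1 0 = 0 :> C.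
  move=> hw; have hf i : isform n (fun q => (N q *m w) i 0).
    apply: isform_ext (isformD (isformZ (w 0 0) (hN i 0)) (isformZ (w 1 0) (hN i 1))) => q.
    by rewrite mulcol2; ring.
  apply: (@isform_prod0 _ n (fun j q => oal _ j * (N q *m w) 0 0 + obe _ j * (N q *m w) 1 0)).
    by move=> j; exact: isformD (isformZ _ (hf 0)) (isformZ _ (hf 1)).
  by move=> q; rewrite -oct_factors hroot.
have [|j1 h1] := key (pt 1 0); first by rewrite pt0 pt1 /oct; ring.
have [|j2 h2] := key (pt 0 1); first by rewrite pt0 pt1 /oct; ring.
have [|j3 h3] := key (pt 1 1); first by rewrite pt0 pt1 /oct; ring.
have {}h1 q : oal _ j1 * N q 0 0 + obe _ j1 * N q 1 0 = 0.
  by rewrite -[RHS](h1 q) !mulcol2 pt0 pt1; ring.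
have {}h2 q : oal _ j2 * N q 0 1 + obe _ j2 * N q 1 1 = 0.
  by rewrite -[RHS](h2 q) !mulcol2 pt0 pt1; ring.
have {}h3 q : oal _ j3 * (N q 0 0 + N q 0 1) + obe _ j3 * (N q 1 0 + N q 1 1) = 0.
  by rewrite -[RHS](h3 q) !mulcol2 pt0 pt1; ring.
have nz (j : 'I_6) (x y : C) : oal _ j * x + obe _ j * y = 0 ->
    exists t, x = t * obe _ j /\ y = t * - oal _ j.
  move=> e; case: (eqVneq (oal C j) 0) => [a0|a0].
    have b0 : obe C j != 0.
      have [k jk] : exists k : 'I_6, j != k.
        by case: (eqVneq j ord0) => [->|n0]; [exists ord_max | exists ord0].
      by apply: contraNneq (odet_neq0 C jk) => b0; rewrite a0 b0 mul0r mulr0 subrr.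
    exists (x / obe _ j); rewrite divfK // a0 oppr0 mulr0; split=> //.
    by apply: (mulfI b0); rewrite mulr0 -[RHS]e a0 mul0r add0r.
  exists (- y / oal _ j); split; last by field.
  by apply: (mulfI a0); rewrite -[LHS](addrK (obe _ j * y)) e; field.
have /(_ _)/cid-/all_sig[a ha] := fun q => nz _ _ _ (h1 q).
have /(_ _)/cid-/all_sig[b hb] := fun q => nz _ _ _ (h2 q).
pose x i j := oal C i * obe C j - oal C j * obe C i.
have e12 q : \det (N q) = a q * b q * x j1 j2.
  by rewrite det2; have [-> ->] := ha q; have [-> ->] := hb q; rewrite /x; ring.
have e3 q : a q * x j3 j1 + b q * x j3 j2 = 0.
  by rewrite -[RHS](h3 q); have [-> ->] := ha q; have [-> ->] := hb q; rewrite /x; ring.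
have a1 : a q1 != 0 by apply: contraNneq d1 => z; rewrite e12 z !mul0r.
have b1 : b q1 != 0 by apply: contraNneq d1 => z; rewrite e12 z mulr0 mul0r.
have x12 : x j1 j2 != 0 by apply: contraNneq d1 => z; rewrite e12 z mulr0.
have j31 : j3 != j1.
  apply/eqP => j31; have := e3 q1; rewrite j31 {1}/x subrr mulr0 add0r => /eqP.
  by rewrite mulf_eq0 (negPf b1) (negPf x12).
have j32 : j3 != j2.
  apply/eqP => j32; have := e3 q1; rewrite j32 {2}/x subrr mulr0 addr0 => /eqP.
  rewrite mulf_eq0 (negPf a1) /= (_ : x j2 j1 = - x j1 j2) ?oppr_eq0 ?(negPf x12) //.
  by rewrite /x; ring.
have x31 : x j3 j1 != 0 := odet_neq0 C j31; have x32 : x j3 j2 != 0 := odet_neq0 C j32.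
pose k := - (x j3 j1 / x j3 j2).
have bE q : b q = a q * k.
  apply: (mulIf x32); rewrite /k -[LHS](addKr (a q * x j3 j1)) e3; field.
  exact: x32.
exists a, (mat2 (obe _ j1) (k * obe _ j2) (- oal _ j1) (- (k * oal _ j2))); split.
  rewrite det_mat2 (_ : _ - _ = k * x j1 j2); last by rewrite /x; ring.
  by rewrite mulf_neq0 // oppr_eq0 mulf_neq0 // invr_eq0.
move=> q; have [ha1 ha2] := ha q; have [hb1 hb2] := hb q.
by apply: mx2P; rewrite mxE !mat2E ?ha1 ?ha2 ?hb1 ?hb2 ?bE; ring.
Qed.

(** The two sheets of the covering differ by a fixed element of the octahedral
    group: f1 (g q) and f1 (g (flip q)) are proportional, so the matrix
    ad (g (flip q)) g q permutes the roots of the octahedral form and is a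
    multiple of a constant matrix. Two curves in P^3 that agree pointwise are
    equal up to a constant, which turns this into g q = g (flip q) T. *)
Lemma holonomy_const n m (g : 'cV[C]_2 -> 'M[C]_2) h F :
  (forall i j, isform n (fun q => g q i j)) -> (forall q, q != 0 -> g q != 0) ->
  isform m h -> (forall q, f1 (g q) = h q *: ev F (square q)) ->
  (exists q, q != 0 /\ \det (g q) != 0) ->
  exists T, [/\ forall q, g q = g (flip q) *m T, T *m T = 1%:M &
    exists k : C, forall w, oct ((T *m w) 0 0) ((T *m w) 1 0) = k * oct (w 0 0) (w 1 0)].
Proof.
move=> hg ng hh lift [q1 [nq1 d1]].
have hne q : \det (g q) != 0 -> h q != 0.
  by move/f1_neq0; apply: contraNneq => h0; rewrite lift h0 scale0r.
pose N q := ad (g (flip q)) *m g q.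
have main q w : h q * oct ((N q *m w) 0 0) ((N q *m w) 1 0) =
    h (flip q) * (\det (g q) ^+ 6 * oct (w 0 0) (w 1 0)).
  rewrite /N -mulmxA -f1ad lift bevZ square_flip.
  rewrite -octZ mulrCA -bevZ -lift f1ad mulmxA adM; congr (_ * oct _ _).
    by rewrite mul_scalar_mx mxE.
  by rewrite mul_scalar_mx mxE.
have hgf i j : isform n (fun q => g (flip q) i j) := isform_flip (hg i j).
have hN i j : isform (2 * n) (fun q => N q i j).
  have had i' j' : isform n (fun q => ad (g (flip q)) i' j').
    case: (ord2 i') => ->; case: (ord2 j') => ->.
    - by apply: isform_ext (hgf 1 1) => q; rewrite mat2E.
    - by apply: isform_ext (isformN (hgf 0 1)) => q; rewrite mat2E.
    - by apply: isform_ext (isformN (hgf 1 0)) => q; rewrite mat2E.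
    - by apply: isform_ext (hgf 0 0) => q; rewrite mat2E.
  rewrite mul2n -addnn.
  by apply: isform_ext (isformD (isformM (had i 0) (hg 0 j)) (isformM (had i 1) (hg 1 j))) => q;
    rewrite mulmx2.
have detN q : \det (N q) = \det (g (flip q)) * \det (g q).
  by rewrite det_mulmx; congr (_ * _); rewrite det_mat2 det2; ring.
have hd := isform_det hg.
have hdf : isform (2 * n) (fun q => \det (g (flip q))) := isform_det hgf.
have nN : exists q, \det (N q) != 0.
  apply: contrapT => /forallNP e0; have [|f0|f0] := isform_dom hdf hd.
  - by move=> q _; rewrite -detN; apply/eqP/negPn/negP/e0.
  - by have := f0 (flip q1); rewrite flipK => e; rewrite e eqxx in d1.
  - by have := f0 q1 => e; rewrite e eqxx in d1.
have [q w e0|a [T0 [dT0 NE]]] := root_permuting_const hN nN.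
  have hNw i : isform (2 * n) (fun q => (N q *m w) i 0).
    apply: isform_ext (isformD (isformZ (w 0 0) (hN i 0)) (isformZ (w 1 0) (hN i 1))) => q'.
    by rewrite mulcol2; ring.
  have [|h0|] := isform_dom hh (isform_oct (hNw 0) (hNw 1)); last by apply.
    by move=> q' _; rewrite main e0 !mulr0.
  by have := hne _ d1; rewrite h0 eqxx.
have eT q : a q *: (g (flip q) *m T0) = \det (g (flip q)) *: g q.
  by rewrite scalemxAr -NE mulmxA Mad mul_scalar_mx.
pose e (ij : 'I_2 * 'I_2) q := g q ij.1 ij.2.
pose e' (ij : 'I_2 * 'I_2) q := (g (flip q) *m T0) ij.1 ij.2.
have he' ij : isform n (e' ij).
  by apply: isform_ext (isformD (isformZ (T0 0 ij.2) (hgf ij.1 0))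
    (isformZ (T0 1 ij.2) (hgf ij.1 1))) => q; rewrite /e' mulmx2; ring.
have nmx (M : 'M[C]_2) : M != 0 -> exists ij : 'I_2 * 'I_2, M ij.1 ij.2 != 0.
  move=> nM; apply: contrapT => hM; move/eqP: nM; apply; apply/matrixP => i j.
  by rewrite mxE; apply: contrapT => /eqP hij; apply: hM; exists (i, j).
have uT0 : T0 \in unitmx by rewrite unitmxE unitfE.
have [|||c c0 hc] := @isform_prop_const _ _ n e e' (fun ij => hg ij.1 ij.2) he'.
- by move=> q nq; have [ij hij] := nmx _ (ng q nq); exists ij.
- move=> q nq; apply: nmx; have := ng _ (flip_neq0 nq); apply: contraNneq => z.
  by rewrite -[g _](mulmxK uT0) z mul0mx.
- move=> q i j _.
  apply: (isform_cancel hdf (isformM (hg i.1 i.2) (he' j)) (isformM (hg j.1 j.2) (he' i))).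
    by exists (flip q1); rewrite flipK.
  move=> q' _; have := congr1 (fun M : 'M[C]_2 => M i.1 i.2) (eT q').
  have := congr1 (fun M : 'M[C]_2 => M j.1 j.2) (eT q'); rewrite /= !scE => ej ei.
  by rewrite mulrA -ei mulrA -ej /e'; ring.
have gE q : g q = g (flip q) *m (c^-1 *: T0).
  apply/matrixP => i j; rewrite -scalemxAr mxE; apply: (mulfI c0).
  by rewrite mulVKf // -[LHS]/(c * e (i, j) q) -hc.
exists (c^-1 *: T0); set T := c^-1 *: T0 in gE *; split=> //.
  have u1 : g q1 \in unitmx by rewrite unitmxE unitfE.
  have : g q1 *m (T *m T) = g q1.
    by rewrite mulmxA -[in X in X *m T *m T](flipK q1) -gE -gE.
  by move/(congr1 (mulmx (invmx (g q1)))); rewrite mulKmx // mulVmx.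
have dT : \det T != 0 by rewrite detZ mulf_neq0 // expf_neq0 // invr_eq0.
have df1 : \det (g (flip q1)) != 0.
  by apply: contraNneq d1 => z; rewrite gE det_mulmx z mul0r.
have NT : N q1 = \det (g (flip q1)) *: T by rewrite /N [X in _ *m X]gE mulmxA adM mul_scalar_mx.
exists (h (flip q1) * \det (g q1) ^+ 6 / (h q1 * \det (g (flip q1)) ^+ 6)) => w.
have := main q1 w; rewrite NT -scalemxAl !scE octZ => e1.
apply: (mulfI (mulf_neq0 (hne _ d1) (expf_neq0 6 df1))).
rewrite -[LHS]mulrA e1; field.
by rewrite df1 hne.
Qed.

End Holonomy.

(** * Involutions in the octahedral group *)

Section Octahedral.
Variable R : realType.
Local Notation C := R[i].
Local Notation xi := (xi1 R).
Implicit Types (q w : 'cV[C]_2) (M A B T : 'M[C]_2).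

Lemma expiD (x y : R) : expi x * expi y = expi (x + y).
Proof.
rewrite /expi cosD sinD; apply/eqP; rewrite eq_complex /=.
by apply/andP; split; apply/eqP; ring.
Qed.

Lemma expi0 : expi (0 : R) = 1.
Proof. by rewrite /expi cos0 sin0. Qed.

Lemma xi_sq : xi ^+ 2 = 'i.
Proof.
rewrite expr2 /xi1 expiD (_ : pi / 4%:R + pi / 4%:R = pi / 2%:R); last by field.
by rewrite /expi cos_pihalf sin_pihalf.
Qed.

Lemma xi_4 : xi ^+ 4 = -1.
Proof. by rewrite (exprM _ 2 2) xi_sq sqr_i. Qed.

Lemma xi_neq0 : xi != 0.
Proof.
by apply/eqP => h; have := xi_4; rewrite h expr0n => /esym/eqP; rewrite oppr_eq0 oner_eq0.
Qed.

Lemma expi_opp : expi (- (pi / 4%:R)) = xi^-1.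
Proof.
by apply: (mulfI xi_neq0); rewrite mulfV ?xi_neq0 // /xi1 expiD subrr expi0.
Qed.

Lemma xi_mat : mx_of 2 2 [:: [:: expi (pi / 4%:R); 0]; [:: 0; expi (- (pi / 4%:R))]]
  = mat2 xi 0 0 xi^-1.
Proof. by rewrite expi_opp. Qed.

Definition rsq2 : C := ((Num.sqrt (2%:R : R))^-1)%:C.

Lemma rsq2_sq : rsq2 * rsq2 = 2^-1.
Proof.
rewrite /rsq2 -rmorphM /= -invfM -expr2 sqr_sqrtr ?ler0n //.
by rewrite fmorphV rmorph_nat.
Qed.

Lemma two_neq0 : (2 : C) != 0. Proof. by rewrite pnatr_eq0. Qed.

Definition diag2 (z : C) := mat2 z 0 0 z^-1.
Definition rot := mat2 rsq2 (- rsq2) rsq2 rsq2.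

Lemma mat2M a b c d a' b' c' d' :
  mat2 a b c d *m mat2 a' b' c' d' =
  mat2 (a * a' + b * c') (a * b' + b * d') (c * a' + d * c') (c * b' + d * d') :> 'M[C]_2.
Proof. by apply: mx2P; rewrite mulmx2 !mat2E. Qed.

Lemma mat2_eta M : M = mat2 (M 0 0) (M 0 1) (M 1 0) (M 1 1).
Proof. by apply: mx2P; rewrite !mat2E. Qed.

Lemma mat2_1 : 1%:M = mat2 1 0 0 1 :> 'M[C]_2.
Proof. by apply: mx2P; rewrite !mat2E mxE. Qed.

Lemma rot_mat : (Num.sqrt (2%:R : R))^-1%:C *: mx_of 2 2 [:: [:: 1; -1]; [:: 1; 1]] = rot.
Proof. by apply: mx2P; rewrite scE !mat2E -/rsq2 ?mulr1 ?mulrN1. Qed.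

Lemma S4star_rot2 : S4star rot.
Proof. by have := @S4star_rot R; rewrite rot_mat. Qed.

Lemma S4star_diag1 : S4star (diag2 xi).
Proof. by have := @S4star_diag R; rewrite xi_mat. Qed.

Lemma diag2M y z : y != 0 -> z != 0 -> diag2 y *m diag2 z = diag2 (y * z).
Proof.
move=> y0 z0; rewrite mat2M /diag2; apply: mx2P; rewrite !mat2E; try ring.
by field; rewrite y0 z0.
Qed.

Lemma S4star_xi_pow k : S4star (diag2 (xi ^+ k)).
Proof.
elim: k => [|k IH]; first by rewrite expr0 /diag2 invr1 -mat2_1; exact: S4star1.
by rewrite exprS -diag2M ?xi_neq0 ?expf_neq0 ?xi_neq0 //; exact: S4starM S4star_diag1 IH.
Qed.

Lemma eighth_root z : z ^+ 8 = 1 -> exists k, z = xi ^+ k.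
Proof.
move=> z8; have x4 := xi_4; have x0 := xi_neq0.
have : \prod_(k < 8) (z - xi ^+ k) = 0.
  rewrite !big_ord_recl big_ord0 /=.
  transitivity (z ^+ 8 - 1 + (xi ^+ 4 + 1) * 0); last by rewrite z8; ring.
  have h k : xi ^+ (4 + k) = - xi ^+ k by rewrite exprD x4 mulN1r.
  rewrite /bump /= (h 0%N) (h 1%N) (h 2%N) (h 3%N).
  transitivity ((z ^+ 2 - 1) * (z ^+ 2 - xi ^+ 2) * (z ^+ 2 - xi ^+ 4) * (z ^+ 2 - xi ^+ 4 * xi ^+ 2)).
    by ring.
  rewrite x4.
  transitivity ((z ^+ 4 - 1) * (z ^+ 4 - xi ^+ 4)); first by ring.
  by rewrite x4; ring.
by move/eqP/prodf_eq0 => [k _]; rewrite subr_eq0 => /eqP ->; exists k.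
Qed.

Lemma S4star_diag8 z : z ^+ 8 = 1 -> S4star (diag2 z).
Proof. by move/eighth_root => [k ->]; exact: S4star_xi_pow. Qed.

Lemma det_rot : \det rot = 1.
Proof.
by rewrite det_mat2 mulNr opprK rsq2_sq; field.
Qed.

Lemma S4star_det A : S4star A -> \det A = 1.
Proof.
elim=> [|||B D _ hB _ hD|B _ hB].
- by rewrite xi_mat det_mat2 mulfV ?xi_neq0 // mul0r subr0.
- by rewrite rot_mat det_rot.
- exact: det1.
- by rewrite det_mulmx hB hD mulr1.
- by rewrite det_inv hB invr1.
Qed.

Lemma S4star_tr A : S4star A -> S4star A^T.
Proof.
elim=> [|||B D _ hB _ hD|B _ hB].
- rewrite (_ : _^T = diag2 xi); first exact: S4star_diag1.
  by rewrite xi_mat; apply: mx2P; rewrite mxE !mat2E.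
- rewrite rot_mat (_ : _^T = invmx rot); first exact: S4starV S4star_rot2.
  have u : rot \in unitmx by rewrite unitmxE det_rot unitr1.
  rewrite -[LHS]mulmx1 -(mulmxV u) mulmxA -[RHS]mul1mx; congr (_ *m _).
  have s2 := rsq2_sq.
  rewrite mat2_1 (_ : rot^T = mat2 rsq2 rsq2 (- rsq2) rsq2); last first.
    by apply: mx2P; rewrite mxE !mat2E.
  by rewrite /rot mat2M; apply: mx2P; rewrite !mat2E ?mulrN ?mulNr ?s2; field.
- by rewrite trmx1; exact: S4star1.
- by rewrite trmx_mul; exact: S4starM.
- by rewrite trmx_inv; exact: S4starV.
Qed.

Lemma S4star_unit A : S4star A -> A \in unitmx.
Proof. by move=> /S4star_det dA; rewrite unitmxE dA unitr1. Qed.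

(** Both generators change the sign of the octahedral form. *)
Lemma S4star_oct A : S4star A -> exists k : C, k ^+ 2 = 1 /\
  forall w, oct ((A *m w) 0 0) ((A *m w) 1 0) = k * oct (w 0 0) (w 1 0).
Proof.
have x4 := xi_4; have x0 := xi_neq0.
elim=> [|||B D _ [k [k2 hk]] _ [l [l2 hl]]|B SB [k [k2 hk]]].
- exists (-1); split; first by ring.
  move=> w; rewrite xi_mat !mulcol2 !mat2E /oct.
  have -> : xi^-1 = - xi ^+ 3 by apply: (mulfI x0); rewrite mulfV // mulrN -exprS x4 opprK.
  transitivity (- (xi ^+ 4) * w 0 0 * w 1 0 * (xi ^+ 4 * w 0 0 ^+ 4 - (xi ^+ 4) ^+ 3 * w 1 0 ^+ 4)).
    by ring.
  by rewrite x4; ring.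
- exists (-1); split; first by ring.
  move=> w; rewrite rot_mat.
  have s6 : rsq2 ^+ 6 = 2^-1 ^+ 3 by rewrite -rsq2_sq; ring.
  rewrite !mulcol2 !mat2E.
  have -> : rsq2 * w 0 0 + - rsq2 * w 1 0 = rsq2 * (w 0 0 - w 1 0) by ring.
  by rewrite -mulrDr octZ s6 /oct; field.
- by exists 1; split; [rewrite expr1n | move=> w; rewrite mul1mx mul1r].
- by exists (k * l); split; [rewrite exprMn k2 l2 mulr1 | move=> w; rewrite -mulmxA hk hl mulrA].
- exists k; split=> // w.
  have := hk (invmx B *m w); rewrite mulmxA mulmxV ?S4star_unit // mul1mx => ->.
  by rewrite mulrA -expr2 k2 mul1r.
Qed.

(** Half turns about an axis through two faces and through two edges of the cube,
    scaled to square to 1. *)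
Definition face : 'M[C]_2 := mat2 1 0 0 (-1).
Definition edge : 'M[C]_2 := mat2 0 (- xi) (- xi^-1) 0.

Lemma sqrt_eighth (c : C) : c ^+ 4 = 1 -> exists z, z ^+ 2 = c /\ z ^+ 8 = 1.
Proof. by move=> c4; exists (sqrtC c); rewrite (exprM _ 2 4) !sqrtCK. Qed.

(** Conjugation by a diagonal element of S4* multiplies q by a fourth root of
    unity, so that only the cases q^4 = 1 and q^4 = - 1 have to be matched. *)
Lemma offdiag_class (q : C) : q ^+ 8 = 1 -> exists B, S4star B /\
  (mat2 0 q q^-1 0 *m B = B *m face \/ mat2 0 q q^-1 0 *m B = B *m edge).
Proof.
move=> q8; have q0 : q != 0.
  by apply/eqP => h; move/eqP: q8; rewrite h expr0n /= eq_sym oner_eq0.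
have x0 := xi_neq0.
have z_neq0 (z : C) : z ^+ 8 = 1 -> z != 0.
  by move=> z8; apply/eqP => h; move/eqP: z8; rewrite h expr0n /= eq_sym oner_eq0.
have : (q ^+ 4 - 1) * (q ^+ 4 + 1) = 0 by transitivity (q ^+ 8 - 1); [ring | rewrite q8 subrr].
move/eqP; rewrite mulf_eq0 subr_eq0 addr_eq0 => /orP[/eqP q4|/eqP q4].
- have [z [z2 z8]] := sqrt_eighth q4; have z0 := z_neq0 _ z8.
  exists (diag2 z *m rot); split; first exact: S4starM (S4star_diag8 z8) S4star_rot2.
  by left; rewrite -z2 /diag2 /rot /face !mat2M; move: rsq2 => s; apply: mx2P; rewrite !mat2E; field; rewrite ?z0.
- have [|z [z2 z8]] := @sqrt_eighth (- (q / xi)).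
    by rewrite -mulN1r !exprMn exprVn q4 xi_4; field.
  have z0 := z_neq0 _ z8; exists (diag2 z); split; first exact: S4star_diag8.
  have qE : q = - (z ^+ 2 * xi) by rewrite z2; field.
  right; rewrite qE /diag2 /edge !mat2M; apply: mx2P; rewrite !mat2E; by field; rewrite ?x0 ?z0.
Qed.

(** An involution of the octahedral group fixes two opposite faces of the cube
    or two opposite edges; each kind is a single conjugacy class. *)
Lemma involution_class T (k : C) : T *m T = 1%:M -> T != 1%:M -> T != - 1%:M ->
  (forall w, oct ((T *m w) 0 0) ((T *m w) 1 0) = k * oct (w 0 0) (w 1 0)) ->
  exists B, S4star B /\ (T *m B = B *m face \/ T *m B = B *m edge).
Proof.
move=> T2 nT nT' hoct.
have {}hoct x y : oct x y = 0 -> oct (T 0 0 * x + T 0 1 * y) (T 1 0 * x + T 1 1 * y) = 0.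
  by move=> e; have := hoct (pt x y); rewrite !mulcol2 pt0 pt1 e mulr0.
move: T2 nT nT' hoct; rewrite (mat2_eta T).
move: (T 0 0) (T 0 1) (T 1 0) (T 1 1) => p q r s {T}; rewrite !mat2E => T2 nT nT' hoct.
have e00 : p * p + q * r = 1.
  by have := congr1 (fun M : 'M[C]_2 => M 0 0) T2; rewrite /= mat2M mat2E mxE.
have e01 : p * q + q * s = 0.
  by have := congr1 (fun M : 'M[C]_2 => M 0 1) T2; rewrite /= mat2M mat2E mxE.
have e10 : r * p + s * r = 0.
  by have := congr1 (fun M : 'M[C]_2 => M 1 0) T2; rewrite /= mat2M mat2E mxE.
have e11 : r * q + s * s = 1.
  by have := congr1 (fun M : 'M[C]_2 => M 1 1) T2; rewrite /= mat2M mat2E mxE.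
have sE : s = - p.
  apply/eqP; rewrite -addr_eq0 addrC; apply: contraT => ps.
  have q0 : q = 0 by apply: (mulIf ps); rewrite mul0r -[RHS]e01; ring.
  have r0 : r = 0 by apply: (mulIf ps); rewrite mul0r -[RHS]e10; ring.
  have sp : s = p.
    apply/eqP; rewrite -subr_eq0; apply/eqP/(mulIf ps); rewrite mul0r.
    by transitivity (r * q + s * s - (p * p + q * r)); [ring | rewrite e00 e11 subrr].
  have : (p - 1) * (p + 1) = 0.
    by transitivity (p * p + q * r - 1); [rewrite q0; ring | rewrite e00 subrr].
  move/eqP; rewrite mulf_eq0 subr_eq0 addr_eq0 => /orP[/eqP p1|/eqP p1].
    by move: nT; rewrite q0 r0 sp p1 -mat2_1 eqxx.
  move: nT'; rewrite q0 r0 sp p1 mat2_1; case/eqP.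
  by apply: mx2P; rewrite [RHS]mxE !mat2E ?oppr0.
rewrite {}sE {s e01 e10 e11 T2 nT nT'} in hoct *.
have n2 : (2 : C) != 0 by rewrite pnatr_eq0.
have n15 : (15 : C) != 0 by rewrite pnatr_eq0.
case: (eqVneq p 0) => [p0|p0].
  move: e00; rewrite p0 mul0r add0r => qr.
  have q0 : q != 0 by apply/eqP => h; move/eqP: qr; rewrite h mul0r eq_sym oner_eq0.
  have rE : r = q^-1 by apply: (mulfI q0); rewrite qr mulfV.
  have [|B hB] := @offdiag_class q.
    have := hoct 1 1; rewrite p0 rE /oct => /(_ ltac:(ring)) h.
    apply: (mulfI (expf_neq0 4 q0)); rewrite mulr1.
    have -> : q ^+ 4 * q ^+ 8 = q ^+ 8 * (q ^+ 4 - q^-1 ^+ 4) + q ^+ 4 by field.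
    suff -> : q ^+ 4 - q^-1 ^+ 4 = 0 by rewrite mulr0 add0r.
    by rewrite -[RHS]h; field.
  by exists B; rewrite rE oppr0.
have four (a b : C) : a * b * (a ^+ 4 - b ^+ 4) = 0 -> b != 0 -> a = 0 \/ a ^+ 4 = b ^+ 4.
  move/eqP; rewrite !mulf_eq0 subr_eq0 => /orP[/orP[/eqP|/eqP ->]|/eqP]; first by left.
    by rewrite eqxx.
  by right.
have hr : r = 0 \/ r ^+ 4 = p ^+ 4.
  apply: four p0; have := hoct 1 0; rewrite /oct => /(_ ltac:(ring)) h.
  by rewrite -[RHS]oppr0 -[in RHS]h; ring.
have hq : q = 0 \/ q ^+ 4 = p ^+ 4.
  apply: four p0; have := hoct 0 1; rewrite /oct => /(_ ltac:(ring)) h.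
  by rewrite -[RHS]oppr0 -[in RHS]h; ring.
have nz4 (a b : C) : a ^+ 4 = b ^+ 4 -> b != 0 -> a != 0.
  move=> e b0; apply: contraNneq b0 => a0; move: e.
  by rewrite a0 expr0n => /esym/eqP; rewrite expf_eq0.
have bad1 (x y : C) : x != 0 -> y ^+ 4 = x ^+ 4 -> oct (2 * p * y) (x * p) = 0 ->
    y != 0 -> False.
  move=> x0 yx h y0; have e : 2 * 15 * p ^+ 6 * y * x * x ^+ 4 = 0.
    by rewrite -[RHS]h /oct !exprMn yx; ring.
  have : 2 * 15 * p ^+ 6 * y * x * x ^+ 4 != 0 by rewrite !mulf_neq0 ?expf_neq0.
  by rewrite e eqxx.
case: hr => [r0|r4]; case: hq => [q0|q4].
- have : (p - 1) * (p + 1) = 0.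
    by transitivity (p * p + q * r - 1); [rewrite q0; ring | rewrite e00 subrr].
  move/eqP; rewrite mulf_eq0 subr_eq0 addr_eq0 => /orP[/eqP p1|/eqP p1].
    by exists 1%:M; split; [exact: S4star1 | left; rewrite mulmx1 mul1mx q0 r0 p1].
  exists (rot *m rot); split; first exact: S4starM S4star_rot2 S4star_rot2.
  by left; rewrite /rot /face !mat2M q0 r0 p1; apply: mx2P; rewrite !mat2E; ring.
- exfalso; have q0 : q != 0 := nz4 _ _ q4 p0.
  have pq : oct q p = 0 by rewrite /oct q4; ring.
  have := hoct _ _ pq; rewrite r0 => h.
  have p0' : - p != 0 by rewrite oppr_eq0.
  apply: (@bad1 (- p) q p0') => //; first by rewrite q4; ring.
  by rewrite -[RHS]h; congr oct; ring.
- exfalso; have r0 : r != 0 := nz4 _ _ r4 p0.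
  have pr : oct p (- r) = 0.
    have e : (- r) ^+ 4 = r ^+ 4 by ring.
    by rewrite /oct e r4; ring.
  have := hoct _ _ pr; rewrite q0 => h.
  apply: (@bad1 p r p0) => //.
  by rewrite -[RHS]oppr0 -[in RHS]h /oct; ring.
- have q0 : q != 0 := nz4 _ _ q4 p0.
  have r0 : r != 0 := nz4 _ _ r4 p0.
  have pq : oct q p = 0 by rewrite /oct q4; ring.
  have := hoct _ _ pq; set u := q * r / p ^+ 2.
  have p2 : p ^+ 2 != 0 by rewrite expf_neq0.
  have qrE : q * r = u * p ^+ 2 by rewrite /u divfK.
  have u4 : u ^+ 4 = 1 by rewrite /u !exprMn q4 r4; field.
  have -> : r * q + - p * p = (u - 1) * p ^+ 2 by rewrite [r * q]mulrC qrE; ring.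
  have -> : p * q + q * p = 2 * p * q by ring.
  move=> h; have {h} : (u - 1) * (16 - (u - 1) ^+ 4) = 0.
    have nz : 2 * p * q * p ^+ 10 != 0 by rewrite !mulf_neq0 ?expf_neq0.
    apply: (mulfI nz); rewrite mulr0 -[RHS]h /oct !exprMn q4; ring.
  have eu : 1 + u != 0.
    apply/eqP => h; move/eqP: e00; rewrite qrE (_ : _ + _ = p ^+ 2 * (1 + u)); last by ring.
    by rewrite h mulr0 eq_sym oner_eq0.
  have u1 : (u - 1) * (16 - (u - 1) ^+ 4) = 0 -> u = 1.
    move/eqP; rewrite mulf_eq0 subr_eq0 => /orP[/eqP //|/eqP e16].
    have : (u - 1) * (u ^+ 2 + 1) = 0.
      by apply: (mulfI eu); rewrite mulr0; transitivity (u ^+ 4 - 1); [ring | rewrite u4 subrr].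
    move/eqP; rewrite mulf_eq0 subr_eq0 addr_eq0 => /orP[/eqP //|/eqP u2].
    have : (20 : C) = 0.
      rewrite -[RHS]e16 (_ : (u - 1) ^+ 4 = (u ^+ 2) ^+ 2 - 4 * u ^+ 2 * u + 6 * u ^+ 2 - 4 * u + 1); last by ring.
      by rewrite u2; ring.
    by move/eqP; rewrite pnatr_eq0.
  move/u1 => u1'; rewrite u1' mul1r in qrE.
  (* T = p (1, 1/a; a, -1) with a^4 = 1; the matrix diag2 z rot, with z^2 = i/a,
     conjugates it to an off-diagonal involution *)
  have pp : 2 * p ^+ 2 = 1 by rewrite -[RHS]e00 qrE; ring.
  pose a := r / p; have a0 : a != 0 by rewrite mulf_neq0 // invr_eq0.
  have a4 : a ^+ 4 = 1 by rewrite exprMn r4 exprVn mulfV // expf_neq0.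
  have rE : r = p * a by rewrite /a mulrC divfK.
  have qE : q = p / a by apply: (mulIf r0); rewrite qrE rE; field; exact: a0.
  pose J : C := xi ^+ 2.
  have J2 : J * J = -1 by rewrite -expr2 -exprM xi_4.
  have J0 : J != 0 by rewrite expf_neq0 // xi_neq0.
  have JJ : J ^+ 2 = -1 by rewrite expr2.
  have [|z [z2 z8]] := @sqrt_eighth (J / a).
    by rewrite exprMn exprVn a4 (exprM _ 2 2) JJ; field.
  have z0 : z != 0.
    by apply/eqP => h; move/eqP: z8; rewrite h expr0n /= eq_sym oner_eq0.
  have [|B [SB hB]] := @offdiag_class (- (p * (1 + J))).
    rewrite (_ : _ ^+ 8 = (p ^+ 2) ^+ 4 * ((1 + J) ^+ 2) ^+ 4); last by ring.
    rewrite (_ : (1 + J) ^+ 2 = 2 * J); last by transitivity (1 + 2 * J + J * J); [ring | rewrite J2; ring].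
    rewrite -exprMn (_ : p ^+ 2 * (2 * J) = 2 * p ^+ 2 * J); last by ring.
    by rewrite pp mul1r (exprM _ 2 2) JJ; ring.
  exists (diag2 z *m rot *m B); split.
    exact: S4starM (S4starM (S4star_diag8 z8) S4star_rot2) SB.
  have conj : mat2 p q r (- p) *m (diag2 z *m rot) =
      diag2 z *m rot *m mat2 0 (- (p * (1 + J))) (- (p * (1 + J)))^-1 0.
    have -> : (- (p * (1 + J)))^-1 = p * (J - 1).
      have i1 : - (p * (1 + J)) != 0 :> C.
        apply/eqP => h; have : 2 * p ^+ 2 * (1 + J) * (1 - J) = 2 :> C.
          by rewrite pp; transitivity (1 - J * J : C); [ring | rewrite J2; ring].
        rewrite (_ : 2 * p ^+ 2 * (1 + J) * (1 - J) = (- (p * (1 + J))) * (- 2 * p * (1 - J))); last by ring.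
        by rewrite h mul0r => /esym/eqP; rewrite (negPf n2).
      apply: (mulfI i1); rewrite mulfV // -[LHS]pp.
      by transitivity (p ^+ 2 * (1 - J * J) : C); [rewrite J2; ring | ring].
    have aE : a = J / z ^+ 2 by rewrite z2; field; rewrite a0 J0.
    have aV : a^-1 = - (J * z ^+ 2).
      rewrite z2; transitivity (- (J * J) / a); [by rewrite J2; field; exact: a0 | by field; exact: a0].
    rewrite qE rE aV {1}aE /diag2 /rot !mat2M; move: rsq2 => s; apply: mx2P; rewrite !mat2E; by field; rewrite ?z0.
  case: hB => hB; [left|right].
    by rewrite mulmxA conj -mulmxA hB mulmxA.
  by rewrite mulmxA conj -mulmxA hB mulmxA.
Qed.

End Octahedral.

(** * Equivalence of lifts and normal form of the covering *)

Section Equivalence.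
Variable R : realType.
Local Notation C := R[i].
Implicit Types (q w : 'cV[C]_2) (M A B T : 'M[C]_2) (F : vform (binform R 6) 6).

Lemma peqxx (V : lmodType C) (v : V) : peq v v.
Proof. by exists 1; rewrite oner_neq0 scale1r. Qed.

Lemma peq_trans (V : lmodType C) (v1 v2 v3 : V) : peq v1 v2 -> peq v2 v3 -> peq v1 v3.
Proof.
by move=> [c [c0 ->]] [d [d0 ->]]; exists (c * d); rewrite mulf_neq0 // scalerA.
Qed.

Lemma peq_mull m n p (A : 'M[C]_(m, n)) (v w : 'M[C]_(n, p)) :
  peq v w -> peq (A *m v) (A *m w).
Proof. by move=> [c [c0 ->]]; exists c; rewrite -scalemxAr. Qed.

Lemma peq_mulr m n p (A : 'M[C]_(n, p)) (v w : 'M[C]_(m, n)) :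
  peq v w -> peq (v *m A) (w *m A).
Proof. by move=> [c [c0 ->]]; exists c; rewrite -scalemxAl. Qed.

Lemma unit_mul_neq0 A n (v : 'M[C]_(2, n)) : A \in unitmx -> v != 0 -> A *m v != 0.
Proof. by move=> uA; apply: contraNneq => h; rewrite -[v](mulKmx uA) h mulmx0. Qed.

Lemma equivalent_trans phi1 (g1 : 'cV[C]_2 -> 'M[C]_2) phi2 g2 phi3 g3 :
  equivalent phi1 g1 phi2 g2 -> equivalent phi2 g2 phi3 g3 ->
  equivalent phi1 g1 phi3 g3.
Proof.
move=> [s [t [A [B [[us ut] dA SB hp hg]]]]] [s' [t' [A' [B' [[us' ut'] dA' SB' hp' hg']]]]].
exists (s *m s'), (t' *m t), (A' *m A), (B' *m B); split.
- by rewrite !unitmx_mul us us' ut ut'.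
- by rewrite det_mulmx dA dA' mulr1.
- exact: S4starM.
- move=> q nq; apply: peq_trans (hp' q nq); rewrite -!mulmxA.
  by apply: peq_mull; apply: hp; exact: unit_mul_neq0.
- move=> q nq; apply: peq_trans (hg' q nq).
  have -> : A' *m A *m g1 (s *m s' *m q) *m (B' *m B)^T =
      A' *m (A *m g1 (s *m (s' *m q)) *m B^T) *m B'^T by rewrite trmx_mul !mulmxA.
  by apply/peq_mulr/peq_mull/hg; exact: unit_mul_neq0.
Qed.

(** The determinant of A may be any non-zero number: matrices are taken up to
    scale. *)
Lemma equivalentI phi (g : 'cV[C]_2 -> 'M[C]_2) phi' g' s t A B :
  s \in unitmx -> t \in unitmx -> \det A != 0 -> S4star B ->
  (forall q, q != 0 -> peq (t *m phi (s *m q)) (phi' q)) ->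
  (forall q, q != 0 -> peq (A *m g (s *m q) *m B^T) (g' q)) ->
  equivalent phi g phi' g'.
Proof.
move=> us ut dA SB hp hg; pose k := sqrtC (\det A).
have k0 : k != 0 by rewrite sqrtC_eq0.
exists s, t, (k^-1 *: A), B; split=> //.
  by rewrite detZ exprVn sqrtCK mulVf.
move=> q nq; have [c [c0 hc]] := hg q nq; exists (k^-1 * c).
by rewrite mulf_neq0 ?invr_eq0 // -!scalemxAl hc scalerA.
Qed.

Lemma S4star_f1 B : S4star B -> exists k : C, k ^+ 2 = 1 /\
  forall M, f1 (M *m B^T) = k *: f1 M.
Proof.
move=> SB; have [k [k2 hk]] := S4star_oct (S4starV (S4star_tr SB)).
exists k; split=> // M; apply: bev_inj => w _; rewrite bevZ !f1ad ad_mul -mulmxA.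
have -> : ad B^T = invmx B^T.
  have u := S4star_unit (S4star_tr SB).
  by rewrite -[LHS](mulmxK u) adM (S4star_det (S4star_tr SB)) mul1mx.
by rewrite hk.
Qed.

Lemma f1_mull A M w : bev (f1 (A *m M)) w = bev (f1 M) (ad A *m w).
Proof. by rewrite !f1ad ad_mul mulmxA. Qed.

Lemma vform_of_isform n k (G : 'cV[C]_2 -> 'rV[C]_k) :
  (forall i, isform n (fun q => G q 0 i)) -> exists c : vform 'rV[C]_k n,
    forall q, ev c q = G q.
Proof.
move=> /(_ _)/cid-/all_sig[c hc]; exists (fun j => \row_i c i j) => q.
apply/rowP => i; rewrite hc /ev summxE; apply: eq_bigr => j _.
by rewrite !mxE mulrC.
Qed.

Lemma vform_comp F (S : 'M[C]_2) : exists F1 : vform (binform R 6) 6,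
  forall q, ev F1 q = ev F (S *m q).
Proof.
by apply: vform_of_isform => i; exact: isform_comp S (isform_ev_row F i).
Qed.

Lemma sextic_comp F F1 (S : 'M[C]_2) : S \in unitmx ->
  (forall q, ev F1 q = ev F (S *m q)) -> sextic_curve F -> sextic_curve F1.
Proof.
move=> uS e [[_ nF] V full [q0 [nq0 hq0]]]; split.
- split; first by exists F1.
  by move=> q nq; rewrite e nF // unit_mul_neq0.
- by move=> q nq; rewrite e; apply: V; exact: unit_mul_neq0.
- move=> l hl; apply: full => q nq.
  have := hl (invmx S *m q); rewrite e mulKVmx //; apply.
  by rewrite unit_mul_neq0 // unitmx_inv.
- exists (invmx S *m q0); rewrite e mulKVmx //; split=> //.
  by rewrite unit_mul_neq0 // unitmx_inv.
Qed.

Lemma unitmx_mat2 (a b c d : C) : (mat2 a b c d \in unitmx) = (a * d - b * c != 0).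
Proof. by rewrite unitmxE det_mat2 unitfE. Qed.

Lemma quadratic_root (a b c : C) : a != 0 -> exists x, a * x ^+ 2 + b * x + c = 0.
Proof.
move=> a0; pose s := sqrtC (b ^+ 2 - 4 * a * c).
have s2 : s ^+ 2 = b ^+ 2 - 4 * a * c by rewrite sqrtCK.
exists ((s - b) / (2 * a)); transitivity ((s ^+ 2 - (b ^+ 2 - 4 * a * c)) / (4 * a)).
  by field.
by rewrite s2 subrr mul0r.
Qed.

Lemma quadratic_form_root (a b c : C) :
  exists x y : C, (pt x y != 0) /\ a * x ^+ 2 + b * (x * y) + c * y ^+ 2 = 0.
Proof.
case: (eqVneq a 0) => [->|a0].
  by exists 1, 0; rewrite pt_eq0 oner_eq0; split=> //; ring.
have [x hx] := quadratic_root b c a0; exists x, 1.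
by rewrite pt_eq0 oner_eq0 andbF; split=> //; rewrite -[RHS]hx; ring.
Qed.

Lemma complete_square (a b c : C) : b ^+ 2 = 4 * a * c -> exists l0 l1 : C,
  forall x y, a * x ^+ 2 + b * (x * y) + c * y ^+ 2 = (l0 * x + l1 * y) ^+ 2.
Proof.
move=> disc; case: (eqVneq a 0) => [a0|a0].
  exists 0, (sqrtC c) => x y; have b0 : b = 0.
    have : b ^+ 2 == 0 by rewrite disc a0 mulr0 mul0r.
    by rewrite expf_eq0 => /eqP.
  by rewrite a0 b0 mul0r add0r mul0r add0r mul0r add0r exprMn sqrtCK.
exists (sqrtC a), (sqrtC a * (b / (2 * a))) => x y.
have s2 := sqrtCK a; rewrite -mulrA -mulrDr exprMn s2.
have -> : c = b ^+ 2 / (4 * a) by rewrite disc; field.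
by field.
Qed.

(** A pencil of binary quadratic forms without base point contains two squares;
    they become the coordinates of the target. *)
Lemma degree2_normal_form (phi : 'cV[C]_2 -> 'cV[C]_2) : curve 2 phi ->
  exists s t : 'M[C]_2, [/\ s \in unitmx, t \in unitmx &
    forall q, t *m phi (s *m q) = square q].
Proof.
move=> cphi; have [[c hc] nphi] := cphi.
have hf i : isform 2 (fun q => phi q i 0).
  by apply: isform_ext (isform_ev_mx c i 0) => q; rewrite hc.
have [a0 [b0 [c0 h0]]] := isform2P (hf 0).
have [a1 [b1 [c1 h1]]] := isform2P (hf 1).
have [u [v [nuv disc]]] := quadratic_form_root (b0 ^+ 2 - 4 * a0 * c0)
  (2 * b0 * b1 - 4 * (a0 * c1 + a1 * c0)) (b1 ^+ 2 - 4 * a1 * c1).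
have [l0 [l1 hl]] : exists l0 l1 : C, forall q,
    u * phi q 0 0 + v * phi q 1 0 = (l0 * q 0 0 + l1 * q 1 0) ^+ 2.
  have [|l0 [l1 hl]] := @complete_square (u * a0 + v * a1) (u * b0 + v * b1) (u * c0 + v * c1).
    by apply/eqP; rewrite -subr_eq0; apply/eqP; rewrite -[RHS]disc; ring.
  by exists l0, l1 => q; rewrite h0 h1 -hl; ring.
have [u' [v' uv']] : exists u' v' : C, u * v' - v * u' != 0.
  move: nuv; rewrite pt_eq0 negb_and => /orP[n0|n0].
    by exists 0, 1; rewrite mulr1 mulr0 subr0.
  by exists (-1), 0; rewrite mulr0 sub0r mulrN1 opprK.
pose psi q := u' * phi q 0 0 + v' * phi q 1 0.
have npsi q : q != 0 -> l0 * q 0 0 + l1 * q 1 0 = 0 -> psi q != 0.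
  move=> nq lq; apply/eqP => pq; have := hl q; rewrite lq expr0n /= => e.
  move/eqP: (nphi q nq); apply; rewrite [phi q]pt_eta.
  have -> : phi q 0 0 = 0.
    apply: (mulfI uv'); rewrite mulr0.
    transitivity (v' * (u * phi q 0 0 + v * phi q 1 0) - v * psi q); first by rewrite /psi; ring.
    by rewrite e pq; ring.
  have -> : phi q 1 0 = 0.
    apply: (mulfI uv'); rewrite mulr0.
    transitivity (u * psi q - u' * (u * phi q 0 0 + v * phi q 1 0)); first by rewrite /psi; ring.
    by rewrite e pq; ring.
  by apply/eqP; rewrite pt_eq0 eqxx.
have psi2 : isform 2 psi by exact: isformD (isformZ _ (hf 0)) (isformZ _ (hf 1)).
have [l0' [l1' ll]] : exists l0' l1' : C, l0 * l1' - l1 * l0' != 0.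
  case: (eqVneq l0 0) => [z0|n0]; last by exists 0, 1; rewrite mulr1 mulr0 subr0.
  case: (eqVneq l1 0) => [z1|n1]; last by exists (-1), 0; rewrite mulr0 sub0r mulrN1 opprK.
  have [a [b [d hp]]] := isform2P psi2.
  have [x [y [nxy exy]]] := quadratic_form_root a b d.
  by have := npsi (pt x y) nxy; rewrite z0 z1 hp !pt0 !pt1 exy eqxx !mul0r addr0 => /(_ erefl).
pose S := mat2 l0 l1 l0' l1'.
have uS : S \in unitmx by rewrite unitmx_mat2.
have [a [b [d hp]]] := isform2P (isform_comp (invmx S) psi2).
have d0 : d != 0.
  have := npsi (invmx S *m pt 0 1); rewrite hp !pt0 !pt1 expr0n expr1n mulr0 mul0r mulr0 !add0r mulr1.
  apply; first by rewrite unit_mul_neq0 ?unitmx_inv // pt_eq0 oner_eq0 andbF.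
  have := mulcol2 S (invmx S *m pt 0 1) 0; rewrite mulKVmx // !mat2E pt0 => <-.
  by [].
pose s2 := mat2 1 0 (- (b / (2 * d))) 1.
pose t2 := mat2 1 0 (- (a - b ^+ 2 / (4 * d)) / d) d^-1.
exists (invmx S *m s2), (t2 *m mat2 u v u' v'); split.
- by rewrite unitmx_mul unitmx_inv uS unitmx_mat2 mulr1 mul0r subr0 oner_neq0.
- rewrite unitmx_mul !unitmx_mat2 uv' andbT mul1r mul0r subr0 invr_eq0 //.
- move=> q; set q' := invmx S *m s2 *m q.
  have e0 : u * phi q' 0 0 + v * phi q' 1 0 = q 0 0 ^+ 2.
    rewrite hl; congr (_ ^+ 2).
    have := mulcol2 S q' 0; rewrite /q' -mulmxA mulKVmx // !mat2E => <-.
    by rewrite mulcol2 !mat2E; ring.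
  have e1 : psi q' = a * q 0 0 ^+ 2 + b * (q 0 0 * (q 1 0 - b / (2 * d) * q 0 0))
      + d * (q 1 0 - b / (2 * d) * q 0 0) ^+ 2.
    by rewrite /q' -mulmxA hp !mulcol2 !mat2E; congr (_ + _ + _); ring.
  rewrite [LHS]pt_eta [RHS]pt_eta square0 square1 -mulmxA !mulcol2 !mat2E e0 -/(psi q') e1.
  by congr pt; field.
Qed.

End Equivalence.

(** * Tangency with the orbit of sixth powers *)

Section Tangent.
Variable R : realType.
Local Notation C := R[i].
Implicit Types (q w d : 'cV[C]_2) (M A B T : 'M[C]_2) (F : vform (binform R 6) 6).

Lemma euler n (V : lmodType C) (c : vform V n.+1) q :
  q 0 0 *: ev_dx c q + q 1 0 *: ev_dy c q = (n.+1)%:R *: ev c q.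
Proof.
rewrite /ev_dx /ev_dy /ev !scaler_sumr -big_split; apply: eq_bigr => i _ /=.
rewrite !scalerA -scalerDl; congr (_ *: _); move: (q 0 0) (q 1 0) => x y.
have [le_in|] := leqP i n; last first.
  move=> lt_ni; have -> : (i = n.+1 :> nat) by apply/eqP; rewrite eqn_leq -ltnS ltn_ord.
  by rewrite subnn !expr0 /= exprS; ring.
rewrite subSn // exprS /=; case: (i : nat) le_in => [|k] lk /=.
  by rewrite subn0; ring.
have -> : (n.+1%:R = (n - k.+1).+1%:R + k.+1%:R :> C) by rewrite -natrD addSn subnK.
by rewrite [y ^+ k.+1]exprS; ring.
Qed.

Lemma ev_path F q d w : exists P : {poly C},
  (forall z, P.[z] = bev (ev F (q + z *: d)) w) /\
  P^`().[0] = bev (d 0 0 *: ev_dx F q + d 1 0 *: ev_dy F q) w.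
Proof.
pose l i := (q i 0)%:P + d i 0 *: 'X : {poly C}.
exists (\sum_(i < 7) bev (F i) w *: (l 0 ^+ (6 - i) * l 1 ^+ i)); split.
  move=> z; rewrite /ev bev_sum horner_sum; apply: eq_bigr => i _.
  have hl j : (l j).[z] = (q + z *: d) j 0.
    by rewrite /l hornerD hornerC hornerZ hornerX !mxE mulrC.
  by rewrite bevZ hornerZ hornerM !horner_exp !hl mulrC.
rewrite bevD !bevZ /ev_dx /ev_dy !bev_sum raddf_sum horner_sum !mulr_sumr -big_split.
apply: eq_bigr => i _; rewrite !bevZ /=.
have dl j : (l j)^`() = (d j 0)%:P.
  by rewrite /l derivD derivC derivZ derivX add0r alg_polyC.
have l0 j : (l j).[0] = q j 0 by rewrite /l !hornerE.
rewrite derivZ derivM !deriv_exp !dl hornerZ hornerD !hornerM !hornerMn !hornerM.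
by rewrite !horner_exp !hornerC !l0; ring.
Qed.

(** A rational normal curve is immersed. *)
Lemma full_row_free F q : linearly_full (ev F) -> q != 0 ->
  row_free (col_mx (ev_dx F q) (ev_dy F q)).
Proof.
move=> /full_dual[l hl] nq; rewrite -kermx_eq0; apply/eqP/row_matrixP => r.
rewrite row0; set v := row r _; have: v *m col_mx (ev_dx F q) (ev_dy F q) = 0.
  by rewrite -row_mul mulmx_ker row0.
rewrite -[v]hsubmxK mul_row_col; set a := lsubmx v; set b := rsubmx v => e0.
have dual (s : 'I_7 -> C) (k : 'I_7) : ((\sum_i s i *: F i) *m l k) 0 0 = s k.
  rewrite mulmx_suml summxE (bigD1 k) //= -scalemxAl mxE hl eqxx mulr1.
  by rewrite big1 ?addr0 // => i /negPf ik; rewrite -scalemxAl mxE hl ik mulr0.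
have e (k : 'I_7) : a 0 0 * ((6 - k)%:R * q 0 0 ^+ (6 - k).-1 * q 1 0 ^+ k)
         + b 0 0 * (k%:R * q 0 0 ^+ (6 - k) * q 1 0 ^+ k.-1) = 0 :> C.
  have := congr1 (fun M : 'rV[C]_7 => (M *m l k) 0 0) e0.
  rewrite /= mulmxDl -!mulmxA mxE [(a *m _) 0 0]mxE [(b *m _) 0 0]mxE !big_ord1.
  by rewrite !dual mul0mx [RHS]mxE.
have {}e i j : (i + j = 6)%N -> a 0 0 * (i%:R * q 0 0 ^+ i.-1 * q 1 0 ^+ j)
         + b 0 0 * (j%:R * q 0 0 ^+ i * q 1 0 ^+ j.-1) = 0 :> C.
  move=> ij; have := e (inord j); rewrite inordK; last by lia.
  by rewrite (_ : 6 - j = i)%N //; lia.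
have [a0 b0] : a 0 0 = 0 /\ b 0 0 = 0.
  have n6 : (6 : C) != 0 by rewrite pnatr_eq0.
  case: (eqVneq (q 0 0) 0) => [x0|x0].
    have y0 : q 1 0 != 0 by apply: contraNneq nq => y0; rewrite [q]pt_eta pt_eq0 x0 y0 eqxx.
    have := e 1%N 5%N erefl; have := e 0%N 6%N erefl; rewrite /= x0 => e6 e5.
    split; first by apply: (mulIf (expf_neq0 5 y0)); rewrite mul0r -[RHS]e5; ring.
    by apply: (mulIf (mulf_neq0 n6 (expf_neq0 5 y0))); rewrite mul0r -[RHS]e6; ring.
  have a0 : a 0 0 = 0.
    have := e 6%N 0%N erefl; rewrite /= => e0'.
    by apply: (mulIf (mulf_neq0 n6 (expf_neq0 5 x0))); rewrite mul0r -[RHS]e0'; ring.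
  split=> //; have := e 5%N 1%N erefl; rewrite /= a0 => e1.
  by apply: (mulIf (expf_neq0 5 x0)); rewrite mul0r -[RHS]e1; ring.
have az : a = 0 by apply/matrixP => i j; rewrite (ord1 i) (ord1 j) a0 mxE.
have bz : b = 0 by apply/matrixP => i j; rewrite (ord1 i) (ord1 j) b0 mxE.
by rewrite az bz row_mx0.
Qed.

Lemma span2_sub (K : fieldType) n (X Y U V : 'rV[K]_n) (a b c e : K) :
  X = a *: U + b *: V -> Y = c *: U + e *: V -> (col_mx X Y <= col_mx U V)%MS.
Proof.
move=> eX eY; have -> : col_mx X Y =
    col_mx (row_mx a%:M b%:M) (row_mx c%:M e%:M) *m col_mx U V.
  by rewrite mul_col_mx !mul_row_col !mul_scalar_mx eX eY.
exact: submxMl.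
Qed.

(** To first order the path stays in the span of l^6 and l^5 r, which is the
    tangent line at l^6 of the orbit of sixth powers. As F is immersed, its own
    tangent line is no smaller. *)
Lemma tangent_of_path F q d (k a b c e : C) :
  linearly_full (ev F) -> q != 0 -> indep q d ->
  (forall w, exists P : {poly C}, forall z, bev (ev F (q + z *: d)) w =
     k * (a * w 0 0 + b * w 1 0) ^+ 6
     + z * ((a * w 0 0 + b * w 1 0) ^+ 5 * (c * w 0 0 + e * w 1 0)) + z ^+ 2 * P.[z]) ->
  tangent_to_1dim_orbit F.
Proof.
move=> full nq iqd path.
have Fq w : bev (ev F q) w = k * (a * w 0 0 + b * w 1 0) ^+ 6.
  by have [P /(_ 0)] := path w; rewrite scale0r addr0 => ->; ring.
have Dq w : bev (d 0 0 *: ev_dx F q + d 1 0 *: ev_dy F q) w =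
    (a * w 0 0 + b * w 1 0) ^+ 5 * (c * w 0 0 + e * w 1 0).
  have [Q [hQ <-]] := ev_path F q d w; have [P hP] := path w.
  move: hP; move: (k * _ ^+ 6) (_ ^+ 5 * _) => x y hP.
  have -> : Q = x%:P + y *: 'X + 'X ^+ 2 * P.
    by apply: poly_ext => z; rewrite hQ hP !hornerE; ring.
  by rewrite horner_coef0 coef_deriv !coefD coefC coefZ coefX coefXnM /= mulr1 add0r addr0 mulr1n.
have [w _ fw] := bev_neq0 (full_neq0 full nq); rewrite Fq in fw.
have k0 : k != 0 by apply: contraNneq fw => k0; rewrite k0 mul0r.
have [a' [b' det1]] : exists a' b', a * b' - b * a' = 1.
  case: (eqVneq a 0) => [a0|a0]; last by exists 0, a^-1; rewrite mulr0 subr0 mulfV.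
  case: (eqVneq b 0) => [b0|b0]; last by exists (- b^-1), 0; rewrite a0; field.
  by move: fw; rewrite a0 b0 !mul0r addr0 expr0n mulr0 eqxx.
pose B := mat2 a b a' b'; have dB : \det B = 1 by rewrite det_mat2.
have uB : B \in unitmx by rewrite unitmxE dB unitr1.
pose U : 'rV[C]_7 := act (invmx B) (u6 R); pose V : 'rV[C]_7 := act (invmx B) (u5v R).
have hU w' : bev U w' = (a * w' 0 0 + b * w' 1 0) ^+ 6.
  by rewrite bev_act invmxK bev_u6 mulcol2 !mat2E.
have hV w' : bev V w' = (a * w' 0 0 + b * w' 1 0) ^+ 5 * (a' * w' 0 0 + b' * w' 1 0).
  by rewrite bev_act invmxK bev_u5v !mulcol2 !mat2E.
have FU : ev F q = k *: U by apply: bev_inj => w' _; rewrite Fq bevZ hU.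
exists q, (invmx B); split=> //.
- by rewrite det_inv dB invr1.
- by exists k.
pose r0 := c * b' - e * a'; pose r1 := e * a - c * b.
have DU : d 0 0 *: ev_dx F q + d 1 0 *: ev_dy F q = r0 *: U + r1 *: V.
  apply: bev_inj => w' _; rewrite Dq bevD !bevZ hU hV /r0 /r1.
  transitivity ((a * w' 0 0 + b * w' 1 0) ^+ 5 *
     ((a * b' - b * a') * (c * w' 0 0 + e * w' 1 0))); first by rewrite det1 mul1r.
  by ring.
have eu := euler F q; rewrite FU scalerA in eu.
pose D := q 0 0 * d 1 0 - q 1 0 * d 0 0.
have D0 : D != 0 by [].
have sub : (col_mx (ev_dx F q) (ev_dy F q) <= col_mx U V)%MS.
  set X := ev_dx F q in eu DU *; set Y := ev_dy F q in eu DU *.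
  apply: (@span2_sub _ _ _ _ _ _ (d 1 0 * (6 * k) / D - q 1 0 * r0 / D) (- (q 1 0 * r1 / D))
    (q 0 0 * r0 / D - d 0 0 * (6 * k) / D) (q 0 0 * r1 / D)).
    apply: (scalerI D0); rewrite scalerDr !scalerA -/D.
    transitivity (d 1 0 *: ((6 * k) *: U) - q 1 0 *: (r0 *: U + r1 *: V)).
      by rewrite -eu -DU; apply/rowP => j; rewrite !mxE /D; ring.
    by apply/rowP => j; rewrite !mxE; field.
  apply: (scalerI D0); rewrite scalerDr !scalerA -/D.
  transitivity (q 0 0 *: (r0 *: U + r1 *: V) - d 0 0 *: ((6 * k) *: U)).
    by rewrite -eu -DU; apply/rowP => j; rewrite !mxE /D; ring.
  by apply/rowP => j; rewrite !mxE; field.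
have rUV : (\rank (col_mx U V) <= 2)%N by rewrite rank_leq_row.
have rF : \rank (col_mx (ev_dx F q) (ev_dy F q)) = 2%N by exact/eqP/full_row_free.
apply/eqmxP; rewrite -(geq_leqif (mxrank_leqif_eq sub)).
by rewrite rF.
Qed.

End Tangent.

(** * Constructing and normalising lifts of the standard covering *)

Section StandardLifts.
Variable R : realType.
Local Notation C := R[i].
Local Notation xi := (xi1 R).
Implicit Types (q w : 'cV[C]_2) (M A B T : 'M[C]_2) (F : vform (binform R 6) 6).

Lemma binform_of_isform n f : isform n f -> exists b : binform R n, forall w, bev b w = f w.
Proof.
move=> [c hc]; exists (\row_i c i) => w; rewrite hc; apply: eq_bigr => i _.
by rewrite mxE.
Qed.

Lemma biform_exists n m (f : 'cV[C]_2 -> 'cV[C]_2 -> C) :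
  (forall q, isform m (f q)) -> (forall w, isform n (f^~ w)) ->
  exists F : vform (binform R m) n, forall q w, bev (ev F q) w = f q w.
Proof.
move=> h1 h2; have /(_ _)/cid-/all_sig[G hG] := fun q => binform_of_isform (h1 q).
have [|F hF] := @vform_of_isform R n _ G.
  by apply: isform_coef => w; apply: isform_ext (h2 w) => q; rewrite hG.
by exists F => q w; rewrite hF hG.
Qed.

Lemma mx_curve n (g : 'cV[C]_2 -> 'M[C]_2) :
  (forall i j, isform n (fun q => g q i j)) -> (forall q, q != 0 -> g q != 0) -> curve n g.
Proof.
move=> hg ng; split=> //.
have /(_ _)/cid-/all_sig[c hc] := fun ij : 'I_2 * 'I_2 => hg ij.1 ij.2.
exists (fun k => \matrix_(i, j) c (i, j) k) => q; apply/matrixP => i j.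
rewrite (hc (i, j)) /ev summxE; apply: eq_bigr => k _.
by rewrite !mxE mulrC.
Qed.

(** The lifts over the squaring map in terms of forms; h is the common factor of
    the coordinates of f1 o g, and the last condition excludes degenerate g. *)
Definition lift_of n m (g : 'cV[C]_2 -> 'M[C]_2) h F : Prop :=
  [/\ forall i j, isform n (fun q => g q i j), forall q, q != 0 -> g q != 0,
      isform m h, forall q, f1 (g q) = h q *: ev F (square q)
    & exists q, q != 0 /\ \det (g q) != 0].

Lemma deck_square s : deck (@square R) s ->
  exists k : C, k != 0 /\ (s = k%:M \/ s = k *: mat2 1 0 0 (-1)).
Proof.
move=> [us hs].
have e x y : (s 0 0 * x + s 0 1 * y) ^+ 2 * y ^+ 2 = (s 1 0 * x + s 1 1 * y) ^+ 2 * x ^+ 2.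
  case: (eqVneq (pt x y) 0) => [/eqP|nq].
    by rewrite pt_eq0 => /andP[/eqP -> /eqP ->]; ring.
  have [c [_ hc]] := hs _ nq.
  have := congr1 (fun v : 'cV[C]_2 => v 0 0) hc; have := congr1 (fun v : 'cV[C]_2 => v 1 0) hc.
  by rewrite /= !scE !square0 !square1 !mulcol2 !pt0 !pt1 => -> ->; ring.
have s01 : s 0 1 = 0.
  have := e 0 1; rewrite !mulr0 !add0r !mulr1 expr1n mulr1 (expr0n _ 2) mulr0 => /eqP.
  by rewrite expf_eq0 /= => /eqP.
have s10 : s 1 0 = 0.
  have := e 1 0; rewrite !mulr0 !addr0 !mulr1 expr1n mulr1 (expr0n _ 2) mulr0 => /esym/eqP.
  by rewrite expf_eq0 /= => /eqP.
have := e 1 1; rewrite s01 s10 !mulr1 addr0 add0r expr1n !mulr1 => /eqP.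
have d : s 0 0 * s 1 1 != 0 by move: us; rewrite unitmxE unitfE det2 s01 mul0r subr0.
have k0 : s 0 0 != 0 by apply: contraNneq d => ->; rewrite mul0r.
rewrite eq_sym eqf_sqr => /orP[/eqP e1|/eqP e1]; exists (s 0 0); split=> //; [left|right].
  by apply: mx2P; rewrite mxE ?s01 ?s10 ?e1 ?mulr1n ?mulr0n.
by apply: mx2P; rewrite scE !mat2E ?s01 ?s10 ?e1 ?mulr1 ?mulr0 ?mulrN1.
Qed.

(** The deck group of the squaring map consists of 1 and the flip, and the flip
    has holonomy T. *)
Lemma lift_galois n m g h F T : lift_of n m g h F ->
  (forall q, g q = g (flip q) *m T) -> (forall c : C, T != c%:M) ->
  galois_lift (@square R) (ev F) g.
Proof.
move=> [hg ng hh lift [q1 [nq1 d1]]] gT nT.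
have u1 : g q1 \in unitmx by rewrite unitmxE unitfE.
have ghom k q : g (k *: q) = k ^+ n *: g q.
  by apply/matrixP => i j; rewrite (isform_hom _ _ (hg i j)) scE.
have hol s : deck (@square R) s -> exists k : C, k != 0 /\
    [\/ g (s *m q1) \in unitmx /\ (s = k%:M /\ peq (holonomy g s q1) (1%:M : 'M[C]_2))
     | g (s *m q1) \in unitmx /\ (s = k *: mat2 1 0 0 (-1) /\ peq (holonomy g s q1) T)].
  move=> ds; have [k [k0 [sE|sE]]] := deck_square ds; exists k; split=> //; [left|right].
    have e : g (s *m q1) = k ^+ n *: g q1 by rewrite sE mul_scalar_mx ghom.
    have kn : k ^+ n != 0 by rewrite expf_neq0.
    have ue : g (s *m q1) \in unitmx by rewrite e unitmxE detZ unitrM -unitmxE u1 unitfE !expf_neq0.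
    split=> //; split=> //; exists (k ^+ n)^-1; rewrite invr_eq0; split=> //.
    rewrite /holonomy -[X in _ *m X](scalerK kn (g q1)) -e -scalemxAr mulVmx //.
  have e : g (s *m q1) = k ^+ n *: g (flip q1) by rewrite sE -scalemxAl ghom flipE.
  have kn : k ^+ n != 0 by rewrite expf_neq0.
  have uf : g (flip q1) \in unitmx.
    by move: u1; rewrite gT unitmx_mul => /andP[].
  have ue : g (s *m q1) \in unitmx by rewrite e unitmxE detZ unitrM -unitmxE uf unitfE !expf_neq0.
  split=> //; split=> //; exists (k ^+ n)^-1; rewrite invr_eq0; split=> //.
  rewrite /holonomy [X in _ *m X]gT -[X in _ *m (X *m _)](scalerK kn (g (flip q1))) -e.
  by rewrite -scalemxAl -scalemxAr mulmxA mulVmx // mul1mx.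
have nT' : ~ peq T (1%:M : 'M[C]_2).
  by move=> [c [_ hc]]; move/eqP: (nT c); apply; rewrite hc scalemx1.
split.
- by exists q1; split=> //; exact: f1_neq0.
- move=> q nq fq; exists (h q); split; last exact: lift.
  by apply: contraNneq fq => h0; rewrite lift h0 scale0r.
- have peq_sym (V : lmodType C) (v v' : V) : peq v v' -> peq v' v.
    move=> [c [c0 ->]]; exists c^-1.
    by split; [rewrite invr_eq0 | rewrite scalerA mulVf // scale1r].
  move=> s t ds dt H.
  have [k [k0 hs]] := hol s ds; have [l [l0 ht]] := hol t dt.
  have H1 := H q1 nq1 u1.
  case: hs => [[us [sE hs]]|[us [sE hs]]]; case: ht => [[ut [tE ht]]|[ut [tE ht]]].
  + exists (k / l); rewrite mulf_neq0 ?invr_eq0 // sE tE; split=> //.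
    by rewrite scale_scalar_mx divfK.
  + case: nT'; apply: peq_trans (peq_sym _ _ _ ht) _.
    exact: peq_trans (peq_sym _ _ _ (H1 us ut)) hs.
  + case: nT'; apply: peq_trans (peq_sym _ _ _ hs) _.
    exact: peq_trans (H1 us ut) ht.
  + exists (k / l); rewrite mulf_neq0 ?invr_eq0 // sE tE; split=> //.
    by rewrite scalerA divfK.
Qed.

Lemma lift_full n m g h F : lift_of n m g h F ->
  linearly_full (fun q => f1 (g q)) -> linearly_full (ev F).
Proof.
move=> [_ _ _ lift _] full l hl; apply: full => q nq.
by rewrite lift -scalemxAl hl ?scaler0 // square_neq0.
Qed.

Lemma lift_of_sextic n m g h F : lift_of n m g h F -> linearly_full (ev F) ->
  sextic_curve F.
Proof. by move=> [hg _ hh lift d1] full; exact: lift_sextic hg hh d1 full lift. Qed.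

(** A point of tangency lies on the orbit of u^6, so it is a sixth power. *)
Lemma lift_exceptional n g h F (k : C) : lift_of n (2 * n) g h F ->
  linearly_full (ev F) -> k != 0 -> (forall q, \det (g q) = k * h q) ->
  ~ tangent_to_1dim_orbit F.
Proof.
move=> [hg ng hh lift [q1 [nq1 d1]]] full k0 Dh [q [A [nq _ [c [_ hc]] _]]].
have h1 : exists q, q != 0 /\ h q != 0.
  by exists q1; split=> //; apply: contraNneq d1 => h0; rewrite Dh h0 mulr0.
apply: (@lift_not_sixth_power _ _ _ _ _ _ hg ng hh lift k0 Dh h1 full q c
  (invmx A 0 0) (invmx A 0 1) nq).
by move=> w; rewrite hc bevZ bev_act bev_u6 mulcol2.
Qed.

(** After moving g by the octahedral group, its holonomy is one of two standard
    involutions. *)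
Lemma lift_standard n (g : 'cV[C]_2 -> 'M[C]_2) F : curve n g -> sextic_curve F ->
  (exists q, q != 0 /\ f1 (g q) != 0) ->
  (forall q, q != 0 -> f1 (g q) != 0 -> peq (f1 (g q)) (ev F (square q))) ->
  (forall c : C, ~ forall q, g q = c *: g (flip q)) ->
  exists B m h, S4star B /\ let g' q := g q *m B^T in
  [/\ lift_of n m g' h F, (6 * n = m + 12)%N, n = 2%N \/ n = 3%N,
      n = 3%N -> exists k : C, k != 0 /\ forall q, \det (g' q) = k * h q
    & (forall q, g' q = g' (flip q) *m face R) \/ (forall q, g' q = g' (flip q) *m edge R)].
Proof.
move=> cg sF f0 rel nscal.
have hg i j : isform n (fun q => g q i j) := isform_curve i j cg.
have ng := proj2 cg; have full : linearly_full (ev F) by case: sF.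
have [q1 d1] := lift_det_neq0 hg sF f0 rel.
have [m [h [nm hh lift]]] := lift_factor hg full f0 rel.
have nq1 : q1 != 0.
  apply: contraNneq d1 => ->; have n0 : n = n.-1.+1 by lia.
  rewrite det2 -(scale0r (0 : 'cV[C]_2)) !(isform_hom _ _ (hg _ _)) n0 !exprS !mul0r.
  by rewrite subrr.
have gd : exists q, q != 0 /\ \det (g q) != 0 by exists q1.
have [m2n Dh] := lift_degree hg ng hh lift gd.
have [T [gT T2 [k hk]]] := holonomy_const hg ng hh lift gd.
have nT1 : T != 1%:M.
  apply/eqP => T1; apply: (nscal 1) => q; by rewrite scale1r [LHS]gT T1 mulmx1.
have nT2 : T != - 1%:M.
  apply/eqP => T1; apply: (nscal (-1)) => q.
  by rewrite scaleN1r [LHS]gT T1 mulmxN mulmx1.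
have [B [SB TB]] := involution_class T2 nT1 nT2 hk.
have SBt := S4star_tr SB; have [l [l2 hl]] := S4star_f1 SBt.
have uB := S4star_unit SB.
exists B^T, m, (fun q => l * h q); split=> //=; rewrite trmxK in hl *.
have l0 : l != 0.
  by apply/eqP => l0; move/eqP: l2; rewrite l0 expr0n /= eq_sym oner_eq0.
have dB q : \det (g q *m B) = \det (g q) by rewrite det_mulmx (S4star_det SB) mulr1.
split.
- split.
  + move=> i j; apply: isform_ext (isformD (isformZ (B 0 j) (hg i 0)) (isformZ (B 1 j) (hg i 1))) => q.
    by rewrite mulmx2; ring.
  + move=> q nq; have := ng q nq; apply: contraNneq => z.
    by rewrite -[g q](mulmxK uB) z mul0mx.
  + exact: isformZ.
  + by move=> q; rewrite hl lift scalerA.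
  + by exists q1; rewrite dB.
- exact: nm.
- by have := m2n; lia.
- move=> n3; have [|k' [k'0 hk']] := Dh; first by lia.
  exists (k' / l); rewrite mulf_neq0 ?invr_eq0 //; split=> // q.
  by rewrite dB hk'; field.
- by case: TB => TB; [left|right] => q; rewrite -mulmxA -TB mulmxA -gT.
Qed.

End StandardLifts.

(** * The family of degree 2 *)

Section Degree2.
Variable R : realType.
Local Notation C := R[i].
Local Notation xi := (xi1 R).
Implicit Types (q w : 'cV[C]_2) (M A B T : 'M[C]_2) (F : vform (binform R 6) 6).

Lemma g_deg2E (a b : C) q : let x := q 0 0 in let y := q 1 0 in
  g_deg2 a b q = mat2 (x ^+ 2 + a * y ^+ 2) (- xi * (x ^+ 2 + a * y ^+ 2))
    (x * y + b * y ^+ 2) (- xi * (b * y ^+ 2 - x * y)).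
Proof.
move=> x y; rewrite /g_deg2.
by apply: mx2P; rewrite !mat2E mxE !big_ord_recl big_ord0 !mxE /=; rewrite -/x -/y; ring.
Qed.

Lemma isform_deg2 (a b : C) i j : isform 2 (fun q => g_deg2 a b q i j).
Proof.
have hx := isform_x C; have hy := isform_y C.
have x2 := isformX 2 hx; have y2 := isformX 2 hy; have xy := isformM hx hy.
case: (ord2 i) => ->; case: (ord2 j) => ->.
- by apply: isform_ext (isformD x2 (isformZ a y2)) => q; rewrite g_deg2E mat2E.
- by apply: isform_ext (isformZ (- xi) (isformD x2 (isformZ a y2))) => q; rewrite g_deg2E mat2E.
- by apply: isform_ext (isformD xy (isformZ b y2)) => q; rewrite g_deg2E mat2E.
- by apply: isform_ext (isformZ (- xi) (isformB (isformZ b y2) xy)) => q; rewrite g_deg2E mat2E.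
Qed.

Lemma g_deg2_flip (a b : C) q : g_deg2 a b q = g_deg2 a b (flip q) *m edge R.
Proof.
have x0 := xi_neq0 R.
by rewrite !g_deg2E /flip !pt0 !pt1 /edge mat2M; apply: mx2P; rewrite !mat2E; field.
Qed.

Lemma edge_nonscalar (c : C) : edge R != c%:M.
Proof.
apply/eqP => /(congr1 (fun M : 'M[C]_2 => M 0 1)).
by rewrite /= mat2E mxE => /eqP; rewrite oppr_eq0 (negPf (xi_neq0 R)).
Qed.

Lemma g_deg2_neq0 (a b : C) q : (a, b) <> (0, 0) -> q != 0 -> g_deg2 a b q != 0.
Proof.
move=> nab nq; apply/eqP => h; apply: nab.
have x0 := xi_neq0 R.
have e i j : g_deg2 a b q i j = 0 by rewrite h mxE.
have := e 0 0; have := e 1 0; have := e 1 1; rewrite g_deg2E !mat2E.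
move: nq; rewrite {1}[q]pt_eta pt_eq0; move: (q 0 0) (q 1 0) => x y nxy e11 e10 e00.
have xy0 : x * y = 0.
  apply: (mulfI (mulf_neq0 (two_neq0 R) x0)); rewrite mulr0.
  by transitivity (xi * (x * y + b * y ^+ 2) + - xi * (b * y ^+ 2 - x * y)); [ring | rewrite e11 e10; ring].
have y0 : y != 0.
  apply: contraNneq nxy => y0; move: e00.
  by rewrite y0 expr0n mulr0 addr0 eqxx andbT => /eqP; rewrite expf_eq0.
have x00 : x = 0 by apply: (mulIf y0); rewrite mul0r.
have y2 : y ^+ 2 != 0 by rewrite expf_neq0.
have -> : a = 0 by apply: (mulIf y2); rewrite mul0r -[RHS]e00 x00; ring.
by have -> : b = 0 by apply: (mulIf y2); rewrite mul0r -[RHS]e10 x00; ring.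
Qed.

(** The curve f1 o g up to a constant, in the squares X, Y of the coordinates: e
    is the pairing of the even column with w, and o the square of the odd one. *)
Definition deg2_sextic (a b : C) q w : C :=
  let e := (q 0 0 + a * q 1 0) * w 1 0 - b * q 1 0 * w 0 0 in
  let o := q 0 0 * q 1 0 * w 0 0 ^+ 2 in
  e ^+ 6 + 5 * e ^+ 4 * o - 5 * e ^+ 2 * o ^+ 2 - o ^+ 3.

Lemma bev_f1_deg2 (a b : C) q w :
  bev (f1 (g_deg2 a b q)) w = - 2 * xi * deg2_sextic a b (square q) w.
Proof.
rewrite bev_f1 g_deg2E !mat2E /deg2_sextic square0 square1 /oct.
move: (q 0 0) (q 1 0) (w 0 0) (w 1 0) => x y u v.
have x4 := xi_4 R; set z := xi in x4 *.
set e := (x ^+ 2 + a * y ^+ 2) * v - b * y ^+ 2 * u.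
pose o := x * y * u.
have -> : - z * (b * y ^+ 2 - x * y) * u - - z * (x ^+ 2 + a * y ^+ 2) * v = z * (e + o).
  by rewrite /e /o; ring.
have -> : (x ^+ 2 + a * y ^+ 2) * v - (x * y + b * y ^+ 2) * u = e - o.
  by rewrite /e /o; ring.
have -> : x ^+ 2 * y ^+ 2 * u ^+ 2 = o ^+ 2 by rewrite /o; ring.
rewrite exprMn x4; move: e o => e o; ring.
Qed.

Lemma isform_deg2_sextic (a b : C) :
  (forall q, isform 6 (deg2_sextic a b q)) /\ (forall w, isform 6 (deg2_sextic a b ^~ w)).
Proof.
have main (e o : 'cV[C]_2 -> C) : isform 1 e -> isform 2 o ->
    isform 6 (fun q => e q ^+ 6 + 5 * e q ^+ 4 * o q - 5 * e q ^+ 2 * o q ^+ 2 - o q ^+ 3).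
  move=> he ho.
  have h1 := isformX 6 he; have h2 := isformM (isformZ 5 (isformX 4 he)) ho.
  have h3 := isformM (isformZ 5 (isformX 2 he)) (isformX 2 ho); have h4 := isformX 3 ho.
  exact: isformB (isformB (isformD h1 h2) h3) h4.
split=> [q|w]; apply: main.
- apply: isform_ext (isform_lin (- (b * q 1 0)) (q 0 0 + a * q 1 0)) => w; by ring.
- by have h2 := isformZ (q 0 0 * q 1 0) (isformX 2 (isform_x C)); exact: h2.
- apply: isform_ext (isform_lin (w 1 0) (a * w 1 0 - b * w 0 0)) => q; by ring.
- by apply: isform_ext (isformZ (w 0 0 ^+ 2) (isformM (isform_x C) (isform_y C))) => q; ring.
Qed.

(** ** First-order expansions *)

Definition tay (p0 p1 : C) (f : C -> C) : Prop :=
  exists P : {poly C}, forall z, f z = p0 + p1 * z + z ^+ 2 * P.[z].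

Lemma tay_lin (p0 p1 : C) : tay p0 p1 (fun z => p0 + p1 * z).
Proof. by exists 0 => z; rewrite horner0 mulr0 addr0. Qed.

Lemma tayD p0 p1 f r0 r1 g : tay p0 p1 f -> tay r0 r1 g ->
  tay (p0 + r0) (p1 + r1) (fun z => f z + g z).
Proof. by move=> [P hP] [Q hQ]; exists (P + Q) => z; rewrite hP hQ hornerD; ring. Qed.

Lemma tayZ k p0 p1 f : tay p0 p1 f -> tay (k * p0) (k * p1) (fun z => k * f z).
Proof. by move=> [P hP]; exists (k *: P) => z; rewrite hP hornerZ; ring. Qed.

Lemma tayM p0 p1 f r0 r1 g : tay p0 p1 f -> tay r0 r1 g ->
  tay (p0 * r0) (p0 * r1 + p1 * r0) (fun z => f z * g z).
Proof.
move=> [P hP] [Q hQ].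
exists ((p1 * r1)%:P + (p0%:P + p1 *: 'X) * Q + (r0%:P + r1 *: 'X) * P + 'X ^+ 2 * P * Q) => z.
by rewrite hP hQ !(hornerD, hornerM, hornerZ, hornerC, hornerX, hornerXn); ring.
Qed.

Lemma tayX k p0 p1 f : tay p0 p1 f ->
  tay (p0 ^+ k.+1) (k.+1%:R * p0 ^+ k * p1) (fun z => f z ^+ k.+1).
Proof.
move=> hf; elim: k => [|k IH].
  by rewrite expr1 expr0 !mul1r; exact: hf.
have := tayM hf IH; rewrite -exprS (_ : _ + _ = k.+2%:R * p0 ^+ k.+1 * p1).
  by move=> [P hP]; exists P => z; rewrite exprS hP.
by rewrite exprS -[k.+2]addn1 natrD; ring.
Qed.

Lemma tay_eq p0 p1 r0 r1 f : tay p0 p1 f -> p0 = r0 -> p1 = r1 -> tay r0 r1 f.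
Proof. by move=> h <- <-. Qed.

(** At the zeros X = - a Y of x^2 + a y^2, where det g vanishes and the covering
    is unramified unless a = 0, the curve touches the orbit of sixth powers. *)
Lemma deg2_tangent (a b c : C) F (S L : 'M[C]_2) : linearly_full (ev F) ->
  S \in unitmx -> L \in unitmx ->
  (forall q w, deg2_sextic a b q w = c * bev (ev F (S *m q)) (L *m w)) ->
  tangent_to_1dim_orbit F.
Proof.
move=> full uS uL h.
have c0 : c != 0.
  apply/eqP => c0; have := h (pt 1 0) (pt 0 1).
  rewrite c0 mul0r /deg2_sextic !pt0 !pt1 => /eqP; rewrite (_ : _ - _ = 1) ?oner_eq0 //; ring.
pose Li := invmx L.
pose k := c^-1 * (b ^+ 6 - 5 * a * b ^+ 4 - 5 * a ^+ 2 * b ^+ 2 + a ^+ 3).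
pose ru := c^-1 * (5 * b ^+ 4 + 10 * a * b ^+ 2 - 3 * a ^+ 2).
pose rv := c^-1 * (- 6 * b ^+ 5 + 20 * a * b ^+ 3 + 10 * a ^+ 2 * b).
apply: (@tangent_of_path _ F (S *m pt (- a) 1) (S *m pt 1 0) k (Li 0 0) (Li 0 1)
  (ru * Li 0 0 + rv * Li 1 0) (ru * Li 0 1 + rv * Li 1 1)) => //.
- by rewrite unit_mul_neq0 // pt_eq0 oner_eq0 andbF.
- move: uS; rewrite unitmxE unitfE /indep det2 !mulcol2 !pt0 !pt1; apply: contraNneq => e.
  by apply/eqP; rewrite -[RHS]oppr0 -[in RHS]e; ring.
move=> w; pose u := (Li *m w) 0 0; pose v := (Li *m w) 1 0.
have te : tay (- b * u) v (fun z => - b * u + v * z) := tay_lin _ _.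
have to : tay (- a * u ^+ 2) (u ^+ 2) (fun z => - a * u ^+ 2 + u ^+ 2 * z) := tay_lin _ _.
have t6 := tayX 5 te.
have t4 := tayZ 5 (tayM (tayX 3 te) to).
have t2 := tayZ (-5) (tayM (tayX 1 te) (tayX 1 to)).
have t0 := tayZ (-1) (tayX 2 to).
have := tayZ c^-1 (tayD (tayD (tayD t6 t4) t2) t0).
move/(@tay_eq _ _ (k * u ^+ 6) (u ^+ 5 * (ru * u + rv * v))).
have wE i : (Li *m w) i 0 = Li i 0 * w 0 0 + Li i 1 * w 1 0 by exact: mulcol2.
case; [by rewrite /k; ring | by rewrite /ru /rv; ring | move=> P hP].
exists P => z; have -> : S *m pt (- a) 1 + z *: (S *m pt 1 0) = S *m pt (z - a) 1.
  rewrite scalemxAr -mulmxDr; congr (_ *m _); rewrite [LHS]pt_eta !mxE /=.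
  by congr pt; ring.
have -> : bev (ev F (S *m pt (z - a) 1)) w = c^-1 * deg2_sextic a b (pt (z - a) 1) (Li *m w).
  by rewrite h /Li mulKVmx // mulKf.
transitivity (k * u ^+ 6 + u ^+ 5 * (ru * u + rv * v) * z + z ^+ 2 * P.[z]).
  by rewrite -hP /deg2_sextic !pt0 !pt1 -/u -/v; ring.
by rewrite /u /v !wE; ring.
Qed.

Lemma det_deg2 (a b : C) q :
  \det (g_deg2 a b q) = 2 * xi * (q 0 0 * q 1 0 * (q 0 0 ^+ 2 + a * q 1 0 ^+ 2)).
Proof. by rewrite g_deg2E det_mat2; ring. Qed.

Lemma lift_of_deg2 (a b : C) : (a, b) <> (0, 0) -> exists F,
  lift_of 2 0 (g_deg2 a b) (fun=> - 2 * xi) F /\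
  forall q w, bev (ev F q) w = deg2_sextic a b q w.
Proof.
move=> nab; have [h1 h2] := isform_deg2_sextic a b.
have [F hF] := biform_exists h1 h2; exists F; split=> //; split.
- exact: isform_deg2.
- by move=> q; exact: g_deg2_neq0.
- exact: isform_cst.
- by move=> q; apply: bev_inj => w _; rewrite bevZ hF bev_f1_deg2.
have x0 : 2 * xi != 0 by rewrite mulf_neq0 ?two_neq0 ?xi_neq0.
case: (eqVneq a (-1)) => [a1|a1].
  exists (pt 1 2); rewrite pt_eq0 oner_eq0 det_deg2 a1 pt0 pt1; split=> //.
  rewrite mulf_neq0 // (_ : _ * _ = - 6); last by ring.
  by rewrite oppr_eq0 pnatr_eq0.
exists (pt 1 1); rewrite pt_eq0 oner_eq0 det_deg2 pt0 pt1; split=> //.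
rewrite mulf_neq0 // (_ : _ * _ = a + 1); last by ring.
by rewrite -subr_eq0 opprK in a1.
Qed.

Lemma deg2_family (a b : C) : (a, b) <> (0, 0) ->
  curve 2 (g_deg2 a b) /\
  (linearly_full (fun q => f1 (g_deg2 a b q)) ->
   exists F, galois_lift (@square R) (ev F) (g_deg2 a b) /\ generally_ramified F).
Proof.
move=> nab; split.
  by apply: mx_curve => [i j|q]; [exact: isform_deg2 | exact: g_deg2_neq0].
have [F [lift hF]] := lift_of_deg2 nab; move=> full; exists F.
have fullF := lift_full lift full.
split; first exact: lift_galois lift (g_deg2_flip a b) edge_nonscalar.
split; first exact: lift_of_sextic lift fullF.
apply: (@deg2_tangent a b 1 F 1%:M 1%:M fullF); rewrite ?unitmx1 //.
by move=> q w; rewrite !mul1mx mul1r hF.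
Qed.

Lemma det_ad M : \det (ad M) = \det M.
Proof. by rewrite det_mat2 det2; ring. Qed.

(** Two of the three coefficients of x^2, xy, y^2 are independent, up to
    exchanging x and y. *)
Lemma deg2_normal_form g h F : lift_of 2 0 g h F -> linearly_full (ev F) ->
  (forall q, g q = g (flip q) *m edge R) ->
  exists a b : C, [/\ (a, b) <> (0, 0),
    equivalent (@square R) g (@square R) (g_deg2 a b) & tangent_to_1dim_orbit F].
Proof.
move=> [hg ng hh lift [q1 [nq1 d1]]] full gE.
have [h0 hE] := isform0P hh.
have h00 : h0 != 0.
  by move/f1_neq0: d1; apply: contraNneq => h0E; rewrite lift hE h0E scale0r.
have g1 q i : g q i 1 = - xi * g (flip q) i 0.
  by rewrite [in LHS]gE mulmx2 !mat2E; ring.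
have [al0 [be0 [ga0 e0]]] := isform2P (hg 0 0).
have [al1 [be1 [ga1 e1]]] := isform2P (hg 1 0).
have main s a0 b0 c0 a1 b1 c1 : s \in unitmx -> (forall q, square (s *m q) = s *m square q) ->
    (forall q, g (s *m q) = mat2
      (a0 * q 0 0 ^+ 2 + b0 * (q 0 0 * q 1 0) + c0 * q 1 0 ^+ 2)
      (- xi * (a0 * q 0 0 ^+ 2 - b0 * (q 0 0 * q 1 0) + c0 * q 1 0 ^+ 2))
      (a1 * q 0 0 ^+ 2 + b1 * (q 0 0 * q 1 0) + c1 * q 1 0 ^+ 2)
      (- xi * (a1 * q 0 0 ^+ 2 - b1 * (q 0 0 * q 1 0) + c1 * q 1 0 ^+ 2))) ->
    a0 * b1 - b0 * a1 != 0 -> exists a b : C, [/\ (a, b) <> (0, 0),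
    equivalent (@square R) g (@square R) (g_deg2 a b) & tangent_to_1dim_orbit F].
  move=> us hs gs d0; set d := _ - _ in d0.
  pose A := mat2 (b1 / d) (- b0 / d) (- a1 / d) (a0 / d).
  pose a := (b1 * c0 - b0 * c1) / d; pose b := (a0 * c1 - a1 * c0) / d.
  have dA : \det A != 0.
    by rewrite det_mat2 (_ : _ - _ = d^-1) ?invr_eq0 // /d; field.
  have uA : A \in unitmx by rewrite unitmxE unitfE.
  have AE q : A *m g (s *m q) = g_deg2 a b q.
    rewrite gs g_deg2E /A mat2M /a /b; apply: mx2P; rewrite !mat2E /d; field; exact: d0.
  exists a, b; split.
  - move=> [az bz]; have n01 : pt 0 1 != 0 :> 'cV[C]_2 by rewrite pt_eq0 oner_eq0 andbF.
    have /eqP := ng _ (unit_mul_neq0 us n01); apply.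
    rewrite -[g _](mulKmx uA) AE g_deg2E az bz !pt0 !pt1.
    rewrite (_ : mat2 _ _ _ _ = 0) ?mulmx0 //; apply: mx2P; rewrite mat2E mxE; ring.
  - apply: (@equivalentI _ _ _ _ _ s (invmx s) A 1%:M) => //.
    + by rewrite unitmx_inv.
    + exact: S4star1.
    + by move=> q nq; rewrite hs mulKmx //; exact: peqxx.
    + by move=> q nq; rewrite trmx1 mulmx1 AE; exact: peqxx.
  - have uad : ad A \in unitmx.
      by rewrite unitmxE unitfE det_ad.
    apply: (@deg2_tangent a b (h0 / (- 2 * xi)) F s (ad A)) => // q w.
    have [q' ->] := square_surj q.
    have := bev_f1_deg2 a b q' w; rewrite -AE f1_mull lift bevZ hE hs => e.
    have x2 : - 2 * xi != 0 by rewrite mulf_neq0 ?oppr_eq0 ?two_neq0 ?xi_neq0.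
    by apply: (mulfI x2); rewrite -e mulrA [X in _ = X * _]mulrC divfK.
have gcol q i : g q i 0 = (if i == 0 then al0 else al1) * q 0 0 ^+ 2
    + (if i == 0 then be0 else be1) * (q 0 0 * q 1 0) + (if i == 0 then ga0 else ga1) * q 1 0 ^+ 2.
  by case: (ord2 i) => -> /=; rewrite ?e0 ?e1.
case: (eqVneq (al0 * be1 - be0 * al1) 0) => [d0|d0]; last first.
  apply: (@main 1%:M al0 be0 ga0 al1 be1 ga1) => //; first exact: unitmx1.
    by move=> q; rewrite !mul1mx.
  move=> q; rewrite mul1mx; apply: mx2P; rewrite !mat2E ?g1 !gcol /= /flip ?pt0 ?pt1; ring.
pose sw := mat2 0 1 1 0 : 'M[C]_2.
have swE q : sw *m q = pt (q 1 0) (q 0 0).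
  by rewrite [LHS]pt_eta !mulcol2 !mat2E; congr pt; ring.
case: (eqVneq (ga0 * be1 - be0 * ga1) 0) => [d2|d2]; last first.
  apply: (@main sw ga0 be0 al0 ga1 be1 al1) => //.
  - by rewrite unitmx_mat2 mul0r sub0r mulr1 oppr_eq0 oner_eq0.
  - by move=> q; rewrite !swE [LHS]pt_eta !square0 !square1 !pt0 !pt1.
  - move=> q; rewrite swE; apply: mx2P; rewrite !mat2E ?g1 !gcol /= /flip ?pt0 ?pt1; ring.
have /eqP := d1; rewrite det2 !g1 !gcol /= /flip !pt0 !pt1; case.
move: (q1 0 0) (q1 1 0) => x y.
transitivity (2 * xi * (x * y) * ((al0 * be1 - be0 * al1) * x ^+ 2 + (ga0 * be1 - be0 * ga1) * y ^+ 2)).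
  by ring.
by rewrite d0 d2; ring.
Qed.

End Degree2.

(** * Moduli of the family of degree 2 *)

Section Degree2Moduli.
Variable R : realType.
Local Notation C := R[i].
Local Notation xi := (xi1 R).
Implicit Types (q w : 'cV[C]_2) (M A B T : 'M[C]_2) (F : vform (binform R 6) 6).

Lemma peq_const n m k (G G' : 'cV[C]_2 -> 'M[C]_(m, k)) :
  (forall i j, isform n (fun q => G q i j)) -> (forall i j, isform n (fun q => G' q i j)) ->
  (forall q, q != 0 -> G' q != 0) -> (forall q, q != 0 -> peq (G q) (G' q)) ->
  exists2 c : C, c != 0 & forall q, G q = c *: G' q.
Proof.
move=> hG hG' nG' rel.
have nz (M : 'M[C]_(m, k)) : M != 0 -> exists ij : 'I_m * 'I_k, M ij.1 ij.2 != 0.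
  move=> nM; apply: contrapT => hM; move/eqP: nM; apply; apply/matrixP => i j.
  by rewrite mxE; apply: contrapT => /eqP hij; apply: hM; exists (i, j).
pose e (ij : 'I_m * 'I_k) q := G q ij.1 ij.2; pose e' (ij : 'I_m * 'I_k) q := G' q ij.1 ij.2.
have [|||c c0 hc] := @isform_prop_const _ _ n e' e (fun ij => hG' ij.1 ij.2) (fun ij => hG ij.1 ij.2).
- by move=> q nq; exact: nz (nG' q nq).
- move=> q nq; apply: nz; have [c [c0 ->]] := rel q nq.
  by rewrite scaler_eq0 negb_or c0 nG'.
- by move=> q i j nq; have [c [_ hc]] := rel q nq; rewrite /e /e' hc !scE; ring.
by exists c => // q; apply/matrixP => i j; rewrite scE -[LHS]/(e (i, j) q) hc.
Qed.

(** A change of coordinates that respects the squaring map permutes its two branch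
    points. *)
Lemma square_equivalence s t : s \in unitmx -> t \in unitmx ->
  (forall q, q != 0 -> peq (t *m square (s *m q)) (square q)) ->
  (s 0 1 = 0 /\ s 1 0 = 0) \/ (s 0 0 = 0 /\ s 1 1 = 0).
Proof.
move=> us ut rel.
have hsq i j : isform 2 (fun q => square (s *m q) i j).
  rewrite (ord1 j); apply: isform_ext (isformX 2 (isform_row s i)) => q.
  by rewrite mxE.
have hq i j : isform 2 (fun q => (invmx t *m square q) i j).
  rewrite (ord1 j).
  apply: isform_ext (isformD (isformZ (invmx t i 0) (isformX 2 (isform_x C)))
    (isformZ (invmx t i 1) (isformX 2 (isform_y C)))) => q.
  by rewrite mulcol2 square0 square1.
have [||c c0 hc] := peq_const hsq hq.
- by move=> q nq; rewrite unit_mul_neq0 ?unitmx_inv ?square_neq0.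
- move=> q nq; have [c [c0 hc]] := rel q nq; exists c; split=> //.
  by rewrite scalemxAr -hc mulKmx.
have cross i : s i 0 * s i 1 = 0.
  have e x y : (s i 0 * x + s i 1 * y) ^+ 2 = c * (invmx t i 0 * x ^+ 2 + invmx t i 1 * y ^+ 2).
    have := congr1 (fun v : 'cV[C]_2 => v i 0) (hc (pt x y)).
    rewrite /= scE mulcol2 square0 square1 pt0 pt1 => <-.
    by rewrite mxE mulcol2 pt0 pt1.
  have n4 : (4 : C) != 0 by rewrite pnatr_eq0.
  apply: (mulfI n4); rewrite mulr0.
  transitivity ((s i 0 * 1 + s i 1 * 1) ^+ 2 - (s i 0 * 1 + s i 1 * (-1)) ^+ 2); first by ring.
  by rewrite !e; ring.
have d : s 0 0 * s 1 1 - s 0 1 * s 1 0 != 0 by move: us; rewrite unitmxE unitfE det2.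
have := cross 0; have := cross 1; move=> /eqP; rewrite mulf_eq0 => h1 /eqP; rewrite mulf_eq0 => h0.
case/orP: h0 => /eqP z0; case/orP: h1 => /eqP z1.
- by rewrite z0 z1 mul0r mulr0 subrr eqxx in d.
- by right.
- by left.
- by rewrite z0 z1 mul0r mulr0 subrr eqxx in d.
Qed.

Lemma root4_neq0 (K : fieldType) (al : K) : al ^+ 4 = 1 -> al != 0.
Proof.
by move=> h; apply/eqP => z; move/eqP: h; rewrite z expr0n /= eq_sym oner_eq0.
Qed.

(** The hypotheses are the coefficients of A E(s q) N = c E'(q) for the source
    change s = diag (sg, mu) and N = diag (al, 1/al), where E and E' are the
    matrices with even first and odd second column. *)
Lemma diag_param (K : fieldType) (a b a' b' c sg mu al A00 A10 A01 A11 : K) :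
  c != 0 -> sg != 0 -> mu != 0 -> al != 0 -> al ^+ 4 = 1 ->
  A01 * (sg * mu / al) = 0 -> A11 * (sg * mu / al) = c ->
  A00 * (sg ^+ 2 * al) = c -> A10 * (sg ^+ 2 * al) = 0 ->
  (A00 * a + A01 * b) * (mu ^+ 2 * al) = c * a' ->
  (A10 * a + A11 * b) * (mu ^+ 2 * al) = c * b' ->
  a * b' ^+ 2 = a' * b ^+ 2.
Proof.
move=> c0 sg0 mu0 al0 al4 e1 e2 e3 e4 e5 e6.
have n1 : sg * mu / al != 0 by rewrite !mulf_neq0 // invr_eq0.
have n2 : sg ^+ 2 * al != 0 by rewrite mulf_neq0 // expf_neq0.
have z01 : A01 = 0 by apply: (mulIf n1); rewrite mul0r.
have z10 : A10 = 0 by apply: (mulIf n2); rewrite mul0r.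
have E11 : A11 = c / (sg * mu / al) by rewrite -e2 mulfK.
have E00 : A00 = c / (sg ^+ 2 * al) by rewrite -e3 mulfK.
have a'E : a' = mu ^+ 2 * a / sg ^+ 2.
  by apply: (mulfI c0); rewrite -e5 z01 E00; field; rewrite sg0 al0.
have b'E : b' = al ^+ 2 * mu * b / sg.
  by apply: (mulfI c0); rewrite -e6 z10 E11; field; rewrite sg0 mu0 al0.
rewrite a'E b'E; transitivity (al ^+ 4 * (mu ^+ 2 * a / sg ^+ 2 * b ^+ 2)).
  by field.
by rewrite al4 mul1r.
Qed.

(** The same comparison for a source change that exchanges x and y. *)
Lemma antidiag_param (K : fieldType) (a b a' b' c sg mu al A00 A10 A01 A11 : K) :
  c != 0 -> sg != 0 -> mu != 0 -> al != 0 -> al ^+ 4 = 1 ->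
  A01 * (sg * mu / al) = 0 -> A11 * (sg * mu / al) = c ->
  (A00 * a + A01 * b) * (mu ^+ 2 * al) = c ->
  (A10 * a + A11 * b) * (mu ^+ 2 * al) = 0 ->
  A00 * (sg ^+ 2 * al) = c * a' -> A10 * (sg ^+ 2 * al) = c * b' ->
  a * b' ^+ 2 = a' * b ^+ 2.
Proof.
move=> c0 sg0 mu0 al0 al4 e1 e2 e3 e4 e5 e6.
have n1 : sg * mu / al != 0 by rewrite !mulf_neq0 // invr_eq0.
have n2 : mu ^+ 2 * al != 0 by rewrite mulf_neq0 // expf_neq0.
have z01 : A01 = 0 by apply: (mulIf n1); rewrite mul0r.
have E11 : A11 = c / (sg * mu / al) by rewrite -e2 mulfK.
have a0 : a != 0.
  by apply: contraNneq c0 => a0; rewrite -e3 a0 z01 mulr0 mul0r addr0 mul0r.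
have E00 : A00 = c / (a * (mu ^+ 2 * al)).
  by rewrite -e3 z01; field; rewrite mu0 al0 a0.
have E10 : A10 = - (A11 * b) / a.
  apply: (mulIf a0); rewrite divfK //; apply: (mulIf n2).
  by apply/eqP; rewrite -subr_eq0; apply/eqP; rewrite -[RHS]e4; ring.
have a'E : a' = sg ^+ 2 / (a * mu ^+ 2).
  by apply: (mulfI c0); rewrite -e5 E00; field; rewrite mu0 al0 a0.
have b'E : b' = - (al ^+ 2 * sg * b / (a * mu)).
  by apply: (mulfI c0); rewrite -e6 E10 E11; field; rewrite sg0 mu0 al0 a0.
rewrite a'E b'E; transitivity (al ^+ 4 * (sg ^+ 2 / (a * mu ^+ 2) * b ^+ 2)).
  by field; rewrite a0 mu0.
by rewrite al4 mul1r.
Qed.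

(** In the eigenbasis of the holonomy the columns of the curve are an even and
    an odd form, and the octahedral form becomes u^6 + 5u^4v^2 - 5u^2v^4 - v^6.
    Parity makes the element of the octahedral group diagonal in this basis, with
    entries al and 1/al, and the invariance of that form gives al^4 = 1. *)
Lemma equivalent_deg2_parameter (a b a' b' : C) : (a, b) <> (0, 0) -> (a', b') <> (0, 0) ->
  equivalent (@square R) (g_deg2 a b) (@square R) (g_deg2 a' b') ->
  same_parameter (a, b) (a', b').
Proof.
move=> nab nab' [s [t [A [B [[us ut] dA SB hp hg]]]]].
have x0 := xi_neq0 R; have n2 := two_neq0 R.
have hG i j : isform 2 (fun q => (A *m g_deg2 a b (s *m q) *m B^T) i j).
  have h1 k l : isform 2 (fun q => (A *m g_deg2 a b (s *m q)) k l).
    apply: isform_ext (isformD (isformZ (A k 0) (isform_comp s (isform_deg2 a b 0 l)))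
      (isformZ (A k 1) (isform_comp s (isform_deg2 a b 1 l)))) => q.
    by rewrite mulmx2.
  apply: isform_ext (isformD (isformZ (B^T 0 j) (h1 i 0)) (isformZ (B^T 1 j) (h1 i 1))) => q.
  by rewrite mulmx2; ring.
have [c c0 hc] := peq_const hG (isform_deg2 a' b') (fun q => @g_deg2_neq0 R a' b' q nab') hg.
pose E (a b : C) q := mat2 (q 0 0 ^+ 2 + a * q 1 0 ^+ 2) 0 (b * q 1 0 ^+ 2) (q 0 0 * q 1 0).
pose K := mat2 1 (- xi) 1 xi; pose Ki := (2 * xi)^-1 *: mat2 xi xi (-1) 1.
have KKi : K *m Ki = 1%:M.
  by rewrite /Ki -scalemxAr mat2M mat2_1; apply: mx2P; rewrite scE !mat2E; field; rewrite x0.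
have gE a1 b1 q : g_deg2 a1 b1 q = E a1 b1 q *m K.
  by rewrite g_deg2E mat2M; apply: mx2P; rewrite !mat2E; ring.
have KiK : Ki *m K = 1%:M by exact: mulmx1C.
pose N := K *m B^T *m Ki.
have NE q : A *m E a b (s *m q) *m N = c *: E a' b' q.
  have := congr1 (mulmx^~ Ki) (hc q); rewrite /= -scalemxAl !gE -(mulmxA _ K) KKi mulmx1 => <-.
  by rewrite /N !mulmxA.
have dN : N 0 0 * N 1 1 - N 0 1 * N 1 0 = 1.
  rewrite -det2 !det_mulmx det_tr (S4star_det SB) mulr1 -det_mulmx KKi det1.
  by [].
have NK i j : (N *m K) i j = (K *m B^T) i j by rewrite /N -mulmxA KiK mulmx1.
clearbody N.
have [k [_ hk]] := S4star_oct SB.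
pose oK (p r : C) := p ^+ 6 + 5 * p ^+ 4 * r ^+ 2 - 5 * p ^+ 2 * r ^+ 4 - r ^+ 6.
have octK p r : oct (p + r) (- xi * (p - r)) = - 2 * xi * oK p r.
  rewrite /oct exprMn (_ : (- xi) ^+ 4 = xi ^+ 4); last by ring.
  by rewrite xi_4 /oK; ring.
have hN p r : oK (p * N 0 0 + r * N 1 0) (p * N 0 1 + r * N 1 1) = k * oK p r.
  have nx : - 2 * xi != 0 by rewrite mulf_neq0 // oppr_eq0.
  apply: (mulfI nx); rewrite -octK [in RHS]mulrCA -octK.
  have := hk (pt (p + r) (- xi * (p - r))); rewrite !mulcol2 !pt0 !pt1 => <-.
  have := NK 0 0; have := NK 1 0; have := NK 0 1; have := NK 1 1.
  have trE i j : B^T i j = B j i by rewrite mxE.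
  rewrite !mulmx2 !mat2E !trE => e11 e01 e10 e00; congr oct.
    transitivity (p * (N 0 0 * 1 + N 0 1 * 1) + r * (N 1 0 * 1 + N 1 1 * 1)); first by ring.
    by rewrite e00 e10; ring.
  transitivity (p * (N 0 0 * - xi + N 0 1 * xi) + r * (N 1 0 * - xi + N 1 1 * xi)); first by ring.
  by rewrite e01 e11; ring.
have fin al de : N = mat2 al 0 0 de -> al ^+ 4 = 1 /\ de = al^-1.
  move=> NE'; move: dN hN; rewrite NE' !mat2E mulr0 subr0 => ad1 h.
  have al0 : al != 0 by apply/eqP => z; move/eqP: ad1; rewrite z mul0r eq_sym oner_eq0.
  have deE : de = al^-1 by apply: (mulfI al0); rewrite ad1 mulfV.
  split=> //; have h1 := h 1 1; have h2 := h 1 0; have h3 := h 0 1.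
  have e6 : al ^+ 6 = de ^+ 6.
    have k1 : al ^+ 6 = k by transitivity (k * oK 1 0); [rewrite -h2 /oK; ring | rewrite /oK; ring].
    have k2 : - de ^+ 6 = - k by transitivity (k * oK 0 1); [rewrite -h3 /oK; ring | rewrite /oK; ring].
    by rewrite k1 -[RHS]opprK k2 opprK.
  have n5 : (5 : C) != 0 by rewrite pnatr_eq0.
  have e2 : al ^+ 2 = de ^+ 2.
    apply/eqP; rewrite -subr_eq0; apply/eqP; apply: (mulfI n5); rewrite mulr0.
    transitivity (k * oK 1 1 - (al ^+ 6 - de ^+ 6)); last by rewrite e6 /oK; ring.
    rewrite -h1 /oK; transitivity (5 * (al * de) ^+ 2 * (al ^+ 2 - de ^+ 2)); last by ring.
    by rewrite ad1; ring.
  by transitivity (al ^+ 2 * de ^+ 2); [rewrite -e2; ring | rewrite -exprMn ad1 expr1n].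
have ent q i j : (A *m E a b (s *m q) *m N) i j = c * E a' b' q i j by rewrite NE scE.
have dA1 : A 0 0 * A 1 1 - A 0 1 * A 1 0 = 1 by rewrite -det2.
have A1 : A 0 1 = 0 -> A 1 1 = 0 -> False.
  by move=> z0 z1; move/eqP: dA1; rewrite z0 z1 mulr0 mul0r subrr eq_sym oner_eq0.
have A0 : A 0 0 = 0 -> A 1 0 = 0 -> False.
  by move=> z0 z1; move/eqP: dA1; rewrite z0 z1 mulr0 mul0r subrr eq_sym oner_eq0.
have ds : s 0 0 * s 1 1 - s 0 1 * s 1 0 != 0 by move: us; rewrite unitmxE unitfE det2.
have entE q i j : (A i 0 * (s 0 0 * q 0 0 + s 0 1 * q 1 0) ^+ 2
      + (A i 0 * a + A i 1 * b) * (s 1 0 * q 0 0 + s 1 1 * q 1 0) ^+ 2) * N 0 j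
    + A i 1 * (s 0 0 * q 0 0 + s 0 1 * q 1 0) * (s 1 0 * q 0 0 + s 1 1 * q 1 0) * N 1 j
    = c * E a' b' q i j.
  by rewrite -ent !mulmx2 !mat2E !mulcol2; ring.
have s01 : (s 0 1 = 0 /\ s 1 0 = 0) \/ (s 0 0 = 0 /\ s 1 1 = 0).
  exact: square_equivalence us ut hp.
have ee x y i j : (A i 0 * (s 0 0 * x + s 0 1 * y) ^+ 2
      + (A i 0 * a + A i 1 * b) * (s 1 0 * x + s 1 1 * y) ^+ 2) * N 0 j
    + A i 1 * (s 0 0 * x + s 0 1 * y) * (s 1 0 * x + s 1 1 * y) * N 1 j
    = c * mat2 (x ^+ 2 + a' * y ^+ 2) 0 (b' * y ^+ 2) (x * y) i j.
  by have := entE (pt x y) i j; rewrite /E !pt0 !pt1.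
clear entE ent; rewrite /same_parameter /=.
have parity i : A i 1 * (s 0 0 * s 1 1 + s 0 1 * s 1 0) * N 1 0 = 0.
  apply: (mulfI n2); rewrite mulr0.
  transitivity (c * mat2 (1 ^+ 2 + a' * 1 ^+ 2) 0 (b' * 1 ^+ 2) (1 * 1) i 0
    - c * mat2 (1 ^+ 2 + a' * (-1) ^+ 2) 0 (b' * (-1) ^+ 2) (1 * (-1)) i 0).
    move: (s01) => [[z01 z10]|[z00 z11]]; rewrite -!ee ?z01 ?z10 ?z00 ?z11; ring.
  by case: (ord2 i) => ->; rewrite !mat2E; ring.
have s0' : s 0 0 * s 1 1 + s 0 1 * s 1 0 != 0.
  move: ds; case: s01 => [[-> ->]|[-> ->]]; first by rewrite !mul0r subr0 addr0.
  by rewrite ?mulr0 ?mul0r sub0r add0r oppr_eq0.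
have N10 : N 1 0 = 0.
  apply/eqP; case: eqVneq => // n10; have z i : A i 1 = 0.
    by apply: (mulIf (mulf_neq0 s0' n10)); rewrite mulrA parity mul0r.
  by case: (A1 (z 0) (z 1)).
case: s01 => [[z01 z10]|[z00 z11]].
- move: s0' ee; rewrite z01 z10 mul0r addr0; move: (s 0 0) (s 1 1) => sg mu sm ee.
  have sg0 : sg != 0 by apply: contraNneq sm => ->; rewrite mul0r.
  have mu0 : mu != 0 by apply: contraNneq sm => ->; rewrite mulr0.
  have N01 : N 0 1 = 0.
    apply/eqP; case: eqVneq => // n01; have z i : A i 0 = 0.
      apply: (mulIf (mulf_neq0 (expf_neq0 2 sg0) n01)); rewrite mul0r.
      transitivity (c * mat2 (1 ^+ 2 + a' * 0 ^+ 2) 0 (b' * 0 ^+ 2) (1 * 0) i 1); first by rewrite -ee; ring.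
      by case: (ord2 i) => ->; rewrite !mat2E; ring.
    by case: (A0 (z 0) (z 1)).
  have [al4 deE] : N 0 0 ^+ 4 = 1 /\ N 1 1 = (N 0 0)^-1.
    by apply: fin; apply: mx2P; rewrite !mat2E.
  have al0 := root4_neq0 al4.
  apply: (@diag_param C a b a' b' c sg mu (N 0 0) (A 0 0) (A 1 0) (A 0 1) (A 1 1)) => //.
  - by have := ee 1 1 0 1; rewrite !mat2E N01 deE => e; rewrite -[RHS](mulr0 c) -e; ring.
  - have := ee 1 1 1 1; rewrite !mat2E N01 deE => e.
    by transitivity (c * (1 * 1)); [rewrite -e; ring | ring].
  - have := ee 1 0 0 0; rewrite !mat2E N10 => e.
    by transitivity (c * (1 ^+ 2 + a' * 0 ^+ 2)); [rewrite -e; ring | ring].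
  - have := ee 1 0 1 0; rewrite !mat2E N10 => e.
    by transitivity (c * (b' * 0 ^+ 2)); [rewrite -e; ring | ring].
  - have := ee 0 1 0 0; rewrite !mat2E N10 => e.
    by transitivity (c * (0 ^+ 2 + a' * 1 ^+ 2)); [rewrite -e; ring | ring].
  - have := ee 0 1 1 0; rewrite !mat2E N10 => e.
    by transitivity (c * (b' * 1 ^+ 2)); [rewrite -e; ring | ring].
- move: s0' ee; rewrite z00 z11 mul0r add0r; move: (s 0 1) (s 1 0) => sg mu sm ee.
  have sg0 : sg != 0 by apply: contraNneq sm => ->; rewrite mul0r.
  have mu0 : mu != 0 by apply: contraNneq sm => ->; rewrite mulr0.
  have N01 : N 0 1 = 0.
    apply/eqP; case: eqVneq => // n01; have z i : A i 0 = 0.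
      apply: (mulIf (mulf_neq0 (expf_neq0 2 sg0) n01)); rewrite mul0r.
      transitivity (c * mat2 (0 ^+ 2 + a' * 1 ^+ 2) 0 (b' * 1 ^+ 2) (0 * 1) i 1); first by rewrite -ee; ring.
      by case: (ord2 i) => ->; rewrite !mat2E; ring.
    by case: (A0 (z 0) (z 1)).
  have [al4 deE] : N 0 0 ^+ 4 = 1 /\ N 1 1 = (N 0 0)^-1.
    by apply: fin; apply: mx2P; rewrite !mat2E.
  have al0 := root4_neq0 al4.
  apply: (@antidiag_param C a b a' b' c sg mu (N 0 0) (A 0 0) (A 1 0) (A 0 1) (A 1 1)) => //.
  - by have := ee 1 1 0 1; rewrite !mat2E N01 deE => e; rewrite -[RHS](mulr0 c) -e; ring.
  - have := ee 1 1 1 1; rewrite !mat2E N01 deE => e.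
    by transitivity (c * (1 * 1)); [rewrite -e; ring | ring].
  - have := ee 1 0 0 0; rewrite !mat2E N10 => e.
    by transitivity (c * (1 ^+ 2 + a' * 0 ^+ 2)); [rewrite -e; ring | ring].
  - have := ee 1 0 1 0; rewrite !mat2E N10 => e.
    by transitivity (c * (b' * 0 ^+ 2)); [rewrite -e; ring | ring].
  - have := ee 0 1 0 0; rewrite !mat2E N10 => e.
    by transitivity (c * (0 ^+ 2 + a' * 1 ^+ 2)); [rewrite -e; ring | ring].
  - have := ee 0 1 1 0; rewrite !mat2E N10 => e.
    by transitivity (c * (b' * 1 ^+ 2)); [rewrite -e; ring | ring].
Qed.

Lemma parameter_equivalent_deg2 (a b a' b' : C) : (a, b) <> (0, 0) -> (a', b') <> (0, 0) ->
  same_parameter (a, b) (a', b') ->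
  equivalent (@square R) (g_deg2 a b) (@square R) (g_deg2 a' b').
Proof.
rewrite /same_parameter /= => nab nab' e.
have [mu [mu0 aE bE]] : exists mu : C, [/\ mu != 0, a' = a * mu ^+ 2 & b' = b * mu].
  case: (eqVneq b 0) => [b0|b0].
    have a0 : a != 0 by apply/eqP => a0; apply: nab; rewrite a0 b0.
    have b'0 : b' = 0.
      move: e; rewrite b0 expr0n mulr0 => /eqP; rewrite mulf_eq0 (negPf a0) /= expf_eq0 /=.
      by move/eqP.
    have a'0 : a' != 0 by apply/eqP => a'0; apply: nab'; rewrite a'0 b'0.
    exists (sqrtC (a' / a)); split; last by rewrite b0 b'0 mul0r.
      by rewrite sqrtC_eq0 mulf_neq0 // invr_eq0.
    by rewrite sqrtCK mulrC divfK.
  have b'0 : b' != 0.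
    apply/eqP => b'0; move: e; rewrite b'0 expr0n mulr0 => /esym/eqP.
    rewrite mulf_eq0 expf_eq0 (negPf b0) orbF => /eqP a'0.
    by apply: nab'; rewrite a'0 b'0.
  exists (b' / b); rewrite mulf_neq0 ?invr_eq0 //; split=> //; last by rewrite mulrC divfK.
  by apply: (mulIf (expf_neq0 2 b0)); rewrite -e; field.
apply: (@equivalentI _ _ _ _ _ (mat2 1 0 0 mu) (mat2 1 0 0 (mu ^- 2)) (mat2 1 0 0 mu^-1) 1%:M).
- by rewrite unitmx_mat2 mul1r mulr0 subr0.
- by rewrite unitmx_mat2 mul1r mulr0 subr0 invr_eq0 expf_neq0.
- by rewrite det_mat2 mul1r mulr0 subr0 invr_eq0.
- exact: S4star1.
- move=> q nq; rewrite (_ : _ *m _ = square q); first exact: peqxx.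
  rewrite [LHS]pt_eta [RHS]pt_eta !mulcol2 !mat2E !square0 !square1 !mulcol2 !mat2E.
  by congr pt; field.
- move=> q nq; rewrite trmx1 mulmx1 (_ : _ *m _ = g_deg2 a' b' q); first exact: peqxx.
  rewrite !g_deg2E mat2M !mulcol2 !mat2E aE bE.
  by apply: mx2P; rewrite !mat2E; field.
Qed.

Lemma g_deg2_parameter (a b a' b' : C) : (a, b) <> (0, 0) -> (a', b') <> (0, 0) ->
  (equivalent (@square R) (g_deg2 a b) (@square R) (g_deg2 a' b') <->
   same_parameter (a, b) (a', b')).
Proof.
move=> nab nab'; split; first exact: equivalent_deg2_parameter.
exact: parameter_equivalent_deg2.
Qed.

End Degree2Moduli.

(** * Full curves in the family of degree 2 *)

Section Degree2Full.
Variable R : realType.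
Local Notation C := R[i].
Local Notation xi := (xi1 R).
Implicit Types (q w : 'cV[C]_2) (F : vform (binform R 6) 6).

Lemma poly6_zero (e0 e1 e2 e3 e4 e5 e6 : C) :
  (forall t, e0 + e1 * t + e2 * t ^+ 2 + e3 * t ^+ 3 + e4 * t ^+ 4 + e5 * t ^+ 5
     + e6 * t ^+ 6 = 0) ->
  [/\ e0 = 0, e1 = 0, e2 = 0 & [/\ e3 = 0, e4 = 0, e5 = 0 & e6 = 0]].
Proof.
move=> h; pose s := [:: e0; e1; e2; e3; e4; e5; e6].
have p0 : \poly_(i < 7) nth 0 s i = 0.
  apply: poly_all0 => t; rewrite horner_poly !big_ord_recl big_ord0 /=.
  by rewrite -[RHS](h t) /bump /=; ring.
have c (i : nat) : (i < 7)%N -> nth 0 s i = 0.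
  by move=> hi; have := congr1 (fun p : {poly C} => p`_i) p0; rewrite coef_poly hi coef0.
by do !split; [exact: (c 0%N)|exact: (c 1%N)|exact: (c 2%N)|exact: (c 3%N)
  |exact: (c 4%N)|exact: (c 5%N)|exact: (c 6%N)].
Qed.

Lemma functional_of_bev (f : binform R 6) (l : 'cV[C]_7) (c0 c1 c2 c3 c4 c5 c6 : C) :
  (forall x y, bev f (pt x y) = c0 * x ^+ 6 + c1 * (x ^+ 5 * y) + c2 * (x ^+ 4 * y ^+ 2)
    + c3 * (x ^+ 3 * y ^+ 3) + c4 * (x ^+ 2 * y ^+ 4) + c5 * (x * y ^+ 5) + c6 * y ^+ 6) ->
  (f *m l) 0 0 = c0 * l (inord 0) 0 + c1 * l (inord 1) 0 + c2 * l (inord 2) 0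
    + c3 * l (inord 3) 0 + c4 * l (inord 4) 0 + c5 * l (inord 5) 0 + c6 * l (inord 6) 0.
Proof.
move=> h; pose s := [:: c0; c1; c2; c3; c4; c5; c6].
have -> : f = \row_i nth 0 s i.
  by apply: bev_inj => w _; rewrite [w]pt_eta h /bev !big_ord_recl big_ord0 !mxE /=; ring.
transitivity (\sum_(i < 7) nth 0 s i * l (inord i) 0).
  by rewrite mxE; apply: eq_bigr => i _; rewrite mxE inord_val.
by rewrite !big_ord_recl big_ord0 /bump /= addr0 !addrA.
Qed.

Lemma col7_zero (l : 'cV[C]_7) : l (inord 0) 0 = 0 -> l (inord 1) 0 = 0 ->
  l (inord 2) 0 = 0 -> l (inord 3) 0 = 0 -> l (inord 4) 0 = 0 -> l (inord 5) 0 = 0 ->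
  l (inord 6) 0 = 0 -> l = 0.
Proof.
move=> h0 h1 h2 h3 h4 h5 h6; apply/colP => i; rewrite mxE -(inord_val i).
by case: i => [[|[|[|[|[|[|[|i]]]]]]] hi].
Qed.

Definition deg2_bad : {poly C} :=
  Poly [:: 3; -1] * Poly [:: 1; -1] * Poly [:: 3; -6; -1] * Poly [:: 3; -10; -5]
  * Poly [:: 1; -5; -5; 1].

Lemma deg2_badE s : deg2_bad.[s] =
  (3 - s) * (1 - s) * (3 - 6 * s - s ^+ 2) * (3 - 10 * s - 5 * s ^+ 2)
  * (1 - 5 * s - 5 * s ^+ 2 + s ^+ 3).
Proof. by rewrite /deg2_bad !hornerM !horner_Poly /=; ring. Qed.

(** In terms of X + a the coefficients of the curve are triangular with respect
    to the powers of v, and the diagonal entries are these five factors. *)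
Lemma deg2_full (s b : C) : b != 0 -> deg2_bad.[s] != 0 ->
  linearly_full (fun q => f1 (g_deg2 (s * b ^+ 2) b q)).
Proof.
move=> b0 bad l; set a := s * b ^+ 2 => hl.
have nx : - 2 * xi != 0 by rewrite mulf_neq0 ?xi_neq0 // oppr_eq0 two_neq0.
have [h1 h2] := isform_deg2_sextic a b; have [F hF] := biform_exists h1 h2.
have F0 q : q != 0 -> ev F q *m l = 0.
  move=> nq; have [q' qE] := square_surj q; rewrite qE.
  have nq' : q' != 0.
    apply: contraNneq nq => z; rewrite qE z; apply/eqP/colP => i.
    by rewrite !mxE expr0n.
  have e : f1 (g_deg2 a b q') = - 2 * xi *: ev F (square q').
    by apply: bev_inj => w _; rewrite bevZ hF bev_f1_deg2.
  have := hl q' nq'; rewrite e -scalemxAl => /eqP.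
  by rewrite scaler_eq0 (negPf nx) => /eqP.
have n1 t : pt (t - a) 1 != 0 :> 'cV[C]_2 by rewrite pt_eq0 oner_eq0 andbF.
have H t : (ev F (pt (t - a) 1) *m l) 0 0 = 0 by rewrite F0 // mxE.
pose A0 := l (inord 0) 0; pose A1 := l (inord 1) 0; pose A2 := l (inord 2) 0.
pose A3 := l (inord 3) 0; pose A4 := l (inord 4) 0; pose A5 := l (inord 5) 0.
pose A6 := l (inord 6) 0.
have eqn t : (b ^+ 6 + 5 * b ^+ 4 * (t - a) - 5 * b ^+ 2 * (t - a) ^+ 2 - (t - a) ^+ 3) * A0
   + (- 6 * b ^+ 5 * t - 20 * b ^+ 3 * t * (t - a) + 10 * b * t * (t - a) ^+ 2) * A1
   + (15 * b ^+ 4 * t ^+ 2 + 30 * b ^+ 2 * t ^+ 2 * (t - a) - 5 * t ^+ 2 * (t - a) ^+ 2) * A2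
   + (- 20 * b ^+ 3 * t ^+ 3 - 20 * b * t ^+ 3 * (t - a)) * A3
   + (15 * b ^+ 2 * t ^+ 4 + 5 * t ^+ 4 * (t - a)) * A4
   + (- 6 * b * t ^+ 5) * A5 + t ^+ 6 * A6 = 0.
  rewrite -[RHS](H t); symmetry; apply: functional_of_bev => x y.
  by rewrite hF /deg2_sextic !pt0 !pt1; ring.
have [] := @poly6_zero
  ((b ^+ 6 - 5 * a * b ^+ 4 - 5 * a ^+ 2 * b ^+ 2 + a ^+ 3) * A0)
  ((5 * b ^+ 4 + 10 * a * b ^+ 2 - 3 * a ^+ 2) * A0
   + (- 6 * b ^+ 5 + 20 * a * b ^+ 3 + 10 * a ^+ 2 * b) * A1)
  ((- 5 * b ^+ 2 + 3 * a) * A0 + (- 20 * b ^+ 3 - 20 * a * b) * A1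
   + (15 * b ^+ 4 - 30 * a * b ^+ 2 - 5 * a ^+ 2) * A2)
  (- A0 + 10 * b * A1 + (30 * b ^+ 2 + 10 * a) * A2 + (- 20 * b ^+ 3 + 20 * a * b) * A3)
  (- 5 * A2 - 20 * b * A3 + (15 * b ^+ 2 - 5 * a) * A4)
  (5 * A4 - 6 * b * A5) A6.
  by move=> t; rewrite -[RHS](eqn t); ring.
move: bad; rewrite deg2_badE !mulf_eq0 !negb_or -!andbA => /and5P[k4 k3 k2 k1 k0].
have n5 : (5 : C) != 0 by rewrite pnatr_eq0.
have n20 : (20 : C) != 0 by rewrite pnatr_eq0.
move=> e0 e1 e2 [e3 e4 e5 e6].
have z0 : A0 = 0.
  by apply: (mulfI (mulf_neq0 (expf_neq0 6 b0) k0)); rewrite mulr0 -[RHS]e0 /a; ring.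
have z1 : A1 = 0.
  apply: (mulfI (mulf_neq0 (mulf_neq0 (two_neq0 R) (expf_neq0 5 b0)) k1)).
  by rewrite mulr0 -[RHS]oppr0 -[in RHS]e1 z0 /a; ring.
have z2 : A2 = 0.
  apply: (mulfI (mulf_neq0 (mulf_neq0 n5 (expf_neq0 4 b0)) k2)).
  by rewrite mulr0 -[RHS]e2 z0 z1 /a; ring.
have z3 : A3 = 0.
  apply: (mulfI (mulf_neq0 (mulf_neq0 n20 (expf_neq0 3 b0)) k3)).
  by rewrite mulr0 -[RHS]oppr0 -[in RHS]e3 z0 z1 z2 /a; ring.
have z4 : A4 = 0.
  apply: (mulfI (mulf_neq0 (mulf_neq0 n5 (expf_neq0 2 b0)) k4)).
  by rewrite mulr0 -[RHS]e4 z2 z3 /a; ring.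
have z5 : A5 = 0.
  have n6 : (6 : C) != 0 by rewrite pnatr_eq0.
  by apply: (mulfI (mulf_neq0 n6 b0)); rewrite mulr0 -[RHS]oppr0 -[in RHS]e5 z4; ring.
exact: col7_zero z0 z1 z2 z3 z4 z5 e6.
Qed.

Lemma poly_roots_list (p : {poly C}) : p != 0 -> exists rs : seq C,
  forall x, p.[x] = 0 -> x \in rs.
Proof.
move=> p0; have [rs e] := closed_field_poly_normal p; exists rs => x.
rewrite e hornerZ => /eqP; rewrite mulf_eq0 lead_coef_eq0 (negPf p0) /=.
by rewrite -/(root _ _) root_prod_XsubC.
Qed.

Lemma deg2_generic : exists e : seq (C * C),
  (forall p, p \in e -> p <> (0, 0)) /\
  forall a b : C, (a, b) <> (0, 0) ->
    (forall p, p \in e -> ~ same_parameter (a, b) p) ->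
    linearly_full (fun q => f1 (g_deg2 a b q)).
Proof.
have bad0 : deg2_bad != 0.
  apply/eqP => z; have := congr1 (fun p : {poly C} => p.[0]) z.
  rewrite /= deg2_badE horner0 => /eqP; apply/negP.
  by rewrite (_ : _ * _ = 27) ?pnatr_eq0 //; ring.
have [rs hrs] := poly_roots_list bad0.
exists ((1, 0) :: [seq (r, 1) | r <- rs]); split.
  move=> p; rewrite inE => /orP[/eqP ->|/mapP[r _ ->]] [] /eqP; rewrite ?oner_eq0 //.
  by move=> _ /eqP; rewrite oner_eq0.
move=> a b _ h.
have b0 : b != 0.
  apply/eqP => b0; apply: (h (1, 0)); first by rewrite inE eqxx.
  by rewrite /same_parameter /= b0 expr0n !mulr0.
have b2 : b ^+ 2 != 0 by rewrite expf_neq0.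
rewrite -(divfK b2 a); apply: deg2_full => //; apply/eqP => /hrs ab; apply: (h (a / b ^+ 2, 1)).
  by rewrite inE; apply/orP; right; apply/mapP; exists (a / b ^+ 2).
by rewrite /same_parameter /= expr1n mulr1 divfK.
Qed.

End Degree2Full.

(** * Transport of lifts *)

Section Transport.
Variable R : realType.
Local Notation C := R[i].
Implicit Types (q w : 'cV[C]_2) (M A B T L S : 'M[C]_2) (F : vform (binform R 6) 6).

(** Evaluation at w is a linear functional on binary forms. *)
Lemma not_full_eval (G : 'cV[C]_2 -> binform R 6) w : w != 0 ->
  (forall q, bev (G q) w = 0) -> ~ linearly_full G.
Proof.
move=> nw h full; set l := \col_(i < 7) (w 0 0 ^+ (6 - i) * w 1 0 ^+ i).
have l0 : l = 0.
  apply: full => q _; apply/matrixP => i j; rewrite (ord1 i) (ord1 j) [RHS]mxE.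
  by rewrite -[RHS](h q) bev_mx.
move/eqP: nw; apply; rewrite [w]pt_eta; apply/eqP; rewrite pt_eq0.
have := congr1 (fun v : 'cV[C]_7 => v ord0 0) l0; have := congr1 (fun v : 'cV[C]_7 => v ord_max 0) l0.
rewrite /= !mxE /= subn0 expr0 mulr1 mul1r => /eqP; rewrite expf_eq0 /= => -> /eqP.
by rewrite expf_eq0 /= => ->.
Qed.

Lemma act_linear n A k (f g : binform R n) : act A (k *: f + g) = k *: act A f + act A g.
Proof.
by apply: bev_inj => w _; rewrite bev_act bevD bevZ bevD bevZ !bev_act.
Qed.

Lemma act_functional A (l : 'cV[C]_7) : exists l' : 'cV[C]_7,
  forall f : binform R 6, f *m l' = act A f *m l.
Proof.
exists (\col_i (act A (delta_mx 0 i : binform R 6) *m l) 0 0) => f.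
have act0 : act A (0 : binform R 6) = 0.
  by apply: bev_inj => w _; rewrite bev_act !bev0.
have actS (s : seq 'I_7) : act A (\sum_(i <- s) f 0 i *: (delta_mx 0 i : binform R 6)) =
    \sum_(i <- s) f 0 i *: act A (delta_mx 0 i : binform R 6).
  elim: s => [|i s IH]; first by rewrite !big_nil.
  by rewrite !big_cons act_linear IH.
rewrite [in RHS](row_sum_delta f) actS mulmx_suml.
apply/matrixP => i j; rewrite (ord1 i) (ord1 j) mxE summxE; apply: eq_bigr => k _.
by rewrite mxE -scalemxAl [RHS]mxE.
Qed.

Lemma full_subst F F' S L : linearly_full (ev F) -> S \in unitmx -> L \in unitmx ->
  (forall q w, bev (ev F' q) w = bev (ev F (S *m q)) (L *m w)) -> linearly_full (ev F').
Proof.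
move=> full uS uL h l hl.
have FA q : ev F' q = act (invmx L) (ev F (S *m q)).
  by apply: bev_inj => w _; rewrite h bev_act invmxK.
have [l' hl'] := act_functional (invmx L) l.
have l'0 : l' = 0.
  apply: full => q nq; have := hl (invmx S *m q); rewrite FA mulKVmx // -hl'; apply.
  by rewrite unit_mul_neq0 // unitmx_inv.
have kill (f : binform R 6) : f *m l = 0.
  have -> : f = act (invmx L) (act L f).
    by apply: bev_inj => w _; rewrite !bev_act invmxK mulKmx.
  by rewrite -hl' l'0 mulmx0.
apply/colP => i; have := congr1 (fun M : 'M[C]_1 => M 0 0) (kill (delta_mx 0 i)).
by rewrite -rowE !mxE.
Qed.

(** An equivalence that respects the squaring map moves F by projectivities of its
    source and its target. *)
Lemma lift_transport n m g h F s S A B (k : C) : lift_of n m g h F -> linearly_full (ev F) ->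
  s \in unitmx -> (forall q, square (s *m q) = S *m square q) -> S \in unitmx ->
  A \in unitmx -> S4star B -> k != 0 -> (forall q, \det (g q) = k * h q) ->
  exists h' F' (k' : C), [/\ lift_of n m (fun q => A *m g (s *m q) *m B^T) h' F',
    linearly_full (ev F'), k' != 0 & forall q, \det (A *m g (s *m q) *m B^T) = k' * h' q].
Proof.
move=> [hg ng hh lift [q1 [nq1 d1]]] full us sS uS uA SB k0 Dh.
have [l [l2 hl]] := S4star_f1 SB.
have l0 : l != 0.
  by apply/eqP => z; move/eqP: l2; rewrite z expr0n /= eq_sym oner_eq0.
have uad : ad A \in unitmx by rewrite unitmxE unitfE det_ad -unitfE -unitmxE.
have [F' hF'] : exists F' : vform (binform R 6) 6,
    forall q w, bev (ev F' q) w = bev (ev F (S *m q)) (ad A *m w).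
  apply: (@biform_exists _ 6 6 (fun q w => bev (ev F (S *m q)) (ad A *m w))).
    by move=> q; exact: isform_comp (isform_bev _).
  by move=> w; exact: isform_comp (isform_bev_ev F (ad A *m w)).
have dA : \det A != 0 by rewrite -unitfE -unitmxE.
have dB : \det B^T = 1 by rewrite det_tr (S4star_det SB).
have uB : B^T \in unitmx by rewrite unitmxE dB unitr1.
exists (fun q => l * h (s *m q)), F', (\det A * k / l); split.
- split.
  + move=> i j.
    have h1 a b : isform n (fun q => (A *m g (s *m q)) a b).
      apply: isform_ext (isformD (isformZ (A a 0) (isform_comp s (hg 0 b)))
        (isformZ (A a 1) (isform_comp s (hg 1 b)))) => q.
      by rewrite [LHS]mulmx2.
    apply: isform_ext (isformD (isformZ (B^T 0 j) (h1 i 0)) (isformZ (B^T 1 j) (h1 i 1))) => q.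
    by rewrite [LHS]mulmx2; ring.
  + move=> q nq; have := ng _ (unit_mul_neq0 us nq); apply: contraNneq => z.
    by rewrite -[g _](mulKmx uA) -[A *m _](mulmxK uB) z mul0mx mulmx0.
  + exact: isformZ (isform_comp s hh).
  + move=> q; apply: bev_inj => w _; rewrite hl !bevZ f1_mull lift bevZ hF' sS.
    by rewrite mulrA.
  + have us' : invmx s \in unitmx by rewrite unitmx_inv.
    exists (invmx s *m q1); split; first exact: unit_mul_neq0 us' nq1.
    rewrite (mulKVmx us) 2!det_mulmx dB mulr1.
    exact: mulf_neq0 dA d1.
- exact: full_subst full uS uad hF'.
- by rewrite !mulf_neq0 // invr_eq0.
- by move=> q; rewrite !det_mulmx dB mulr1 Dh; field.
Qed.

End Transport.

(** * The family of degree 3 *)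

Section Degree3.
Variable R : realType.
Local Notation C := R[i].
Implicit Types (q w : 'cV[C]_2) (M A B T : 'M[C]_2) (F : vform (binform R 6) 6).

Lemma g_deg3E (a3 a4 b3 b4 : C) q : let x := q 0 0 in let y := q 1 0 in
  g_deg3 (plane a3 a4 b3 b4) q = mat2 (x * (x ^+ 2 + a3 * y ^+ 2)) (y * (a4 * y ^+ 2))
    (x * (b3 * y ^+ 2)) (y * (x ^+ 2 + b4 * y ^+ 2)).
Proof.
move=> x y; rewrite /g_deg3 /plane.
by apply: mx2P; rewrite !mat2E mxE !big_ord_recl big_ord0 !mxE /=; rewrite -/x -/y; ring.
Qed.

Lemma isform_deg3 (a3 a4 b3 b4 : C) i j :
  isform 3 (fun q => g_deg3 (plane a3 a4 b3 b4) q i j).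
Proof.
have hx := isform_x C; have hy := isform_y C; have x2 := isformX 2 hx; have y2 := isformX 2 hy.
case: (ord2 i) => ->; case: (ord2 j) => ->.
- have h := isformM hx (isformD x2 (isformZ a3 y2)).
  by apply: isform_ext h => q; rewrite g_deg3E mat2E.
- have h := isformM hy (isformZ a4 y2).
  by apply: isform_ext h => q; rewrite g_deg3E mat2E.
- have h := isformM hx (isformZ b3 y2).
  by apply: isform_ext h => q; rewrite g_deg3E mat2E.
- have h := isformM hy (isformD x2 (isformZ b4 y2)).
  by apply: isform_ext h => q; rewrite g_deg3E mat2E.
Qed.

Lemma g_deg3_flip (a3 a4 b3 b4 : C) q :
  g_deg3 (plane a3 a4 b3 b4) q = g_deg3 (plane a3 a4 b3 b4) (flip q) *m face R.
Proof.
by rewrite !g_deg3E /flip !pt0 !pt1 /face mat2M; apply: mx2P; rewrite !mat2E; ring.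
Qed.

Lemma face_nonscalar (c : C) : face R != c%:M.
Proof.
apply/eqP => h; have h0 := congr1 (fun M : 'M[C]_2 => M 0 0) h.
have h1 := congr1 (fun M : 'M[C]_2 => M 1 1) h.
move: h0 h1; rewrite /= !mat2E !mxE !eqxx /= => <- /eqP.
by rewrite eq_sym -subr_eq0 opprK (negPf (two_neq0 R)).
Qed.

(** The equations of the plane, in terms of s = i t. *)
Definition plane_eqs (s a3 a4 b3 b4 : C) : Prop :=
  [/\ a4 = 1 + a3, b4 = b3 - 1, a3 * (s - 1) = 1 + s ^+ 3 & b3 * (s - 1) = - (1 + s ^+ 2)].

Lemma perpendicular_eqs (t a3 a4 b3 b4 : C) :
  perpendicular t (plane a3 a4 b3 b4) <-> plane_eqs (xi1 R ^+ 2 * t) a3 a4 b3 b4.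
Proof.
have J2 : (xi1 R ^+ 2) ^+ 2 = -1 by rewrite -exprM xi_4.
rewrite /perpendicular -complexiE -xi_sq; set J := xi1 R ^+ 2 in J2 *.
have v1 i : (plane a3 a4 b3 b4 *m (mx_of 1 4 [:: [:: 1; -1; 1; -1]])^T) i 0 =
    if i == 0 then 1 + a3 - a4 else - 1 + b3 - b4.
  by case: (ord2 i) => ->; rewrite mxE !big_ord_recl big_ord0 !mxE /=; ring.
have v2 i : (plane a3 a4 b3 b4 *m
    (mx_of 1 4 [:: [:: J * t ^+ 3; - t ^+ 2; J * t; -1]])^T) i 0 =
    if i == 0 then J * t ^+ 3 + a3 * (J * t) - a4 else - t ^+ 2 + b3 * (J * t) - b4.
  by case: (ord2 i) => ->; rewrite mxE !big_ord_recl big_ord0 !mxE /=; ring.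
have s3 : (J * t) ^+ 3 = - (J * t ^+ 3) by rewrite exprMn (exprS _ 2) J2; ring.
have s2 : (J * t) ^+ 2 = - t ^+ 2 by rewrite exprMn J2; ring.
split.
- case=> h1 h2.
  have := v1 0; have := v1 1; have := v2 0; have := v2 1; rewrite h1 h2 !mxE /= => e4 e3 e2 e1.
  have a4E : a4 = 1 + a3 by apply/eqP; rewrite -subr_eq0 -oppr_eq0 opprB -e1.
  have b4E : b4 = b3 - 1.
    by apply/eqP; rewrite -subr_eq0 -oppr_eq0 opprB [_ - b4](_ : _ = - 1 + b3 - b4) ?e2 //; ring.
  split=> //; apply/eqP; rewrite -subr_eq0; apply/eqP.
    by rewrite s3 [RHS]e3 a4E; ring.
  by rewrite s2 [RHS]e4 b4E; ring.
- case=> a4E b4E e3 e4; split; apply/matrixP => i j; rewrite (ord1 j) [RHS]mxE.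
    by rewrite v1 a4E b4E; case: ifP => _; ring.
  rewrite v2 a4E b4E; case: ifP => _.
    transitivity (a3 * (J * t - 1) - (1 + (J * t) ^+ 3)); last by rewrite e3 subrr.
    by rewrite s3; ring.
  transitivity (b3 * (J * t - 1) + (1 + (J * t) ^+ 2)); last by rewrite e4 addNr.
  by rewrite s2; ring.
Qed.

(** For s = 1 the two equations for a3 and b3 would read 0 = 2 and 0 = -2. *)
Lemma plane_eqs_neq1 (s a3 a4 b3 b4 : C) : plane_eqs s a3 a4 b3 b4 -> s - 1 != 0.
Proof.
case=> _ _ e _; apply: contraTneq isT => /eqP; rewrite subr_eq0 => /eqP s1.
by move: e; rewrite s1 subrr mulr0 expr1n => /eqP; rewrite eq_sym (negPf (two_neq0 R)).
Qed.

Lemma plane_exists (s : C) : s - 1 != 0 ->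
  exists a3 a4 b3 b4, plane_eqs s a3 a4 b3 b4.
Proof.
move=> r0; exists ((1 + s ^+ 3) / (s - 1)), (1 + (1 + s ^+ 3) / (s - 1)),
  (- (1 + s ^+ 2) / (s - 1)), (- (1 + s ^+ 2) / (s - 1) - 1).
by split=> //; rewrite divfK.
Qed.

Lemma plane_eqs_solve (s a3 a4 b3 b4 : C) : plane_eqs s a3 a4 b3 b4 ->
  [/\ a3 = (1 + s ^+ 3) / (s - 1), a4 = (s + s ^+ 3) / (s - 1),
      b3 = - (1 + s ^+ 2) / (s - 1) & b4 = - (s + s ^+ 2) / (s - 1)].
Proof.
move=> h; have r0 := plane_eqs_neq1 h; case: h => -> -> e3 e4.
have E3 : a3 = (1 + s ^+ 3) / (s - 1) by rewrite -e3 mulfK.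
have E4 : b3 = - (1 + s ^+ 2) / (s - 1) by rewrite -e4 mulfK.
by split=> //; rewrite ?E3 ?E4; field.
Qed.

(** The two vectors span a plane, whose orthogonal has dimension 2. *)
Lemma plane_unique (t a3 a4 b3 b4 : C) : perpendicular t (plane a3 a4 b3 b4) ->
  unique_perpendicular_plane t (plane a3 a4 b3 b4).
Proof.
move=> perp; have r0 := plane_eqs_neq1 (proj1 (perpendicular_eqs _ _ _ _ _) perp).
rewrite xi_sq complexiE in r0.
pose v1 : 'cV[C]_4 := (mx_of 1 4 [:: [:: 1; -1; 1; -1]])^T.
pose v2 : 'cV[C]_4 := (mx_of 1 4 [:: [:: 'i * t ^+ 3; - t ^+ 2; 'i * t; -1]])^T.
pose W : 'M[C]_(4, 1 + 1) := row_mx v1 v2.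
have rkM : \rank (plane a3 a4 b3 b4) = 2.
  apply/eqP; rewrite -[_ == _]/(row_free _); apply/row_freeP.
  exists (\matrix_(i < 4, j < 2) ((i == j :> nat)%:R : C)).
  apply: mx2P; rewrite mxE !big_ord_recl big_ord0 !mxE /=; ring.
have rkW : \rank W = 2.
  apply/eqP; rewrite -[_ == _]/(row_full _); apply/row_fullP.
  pose k := ('i * t - 1)^-1.
  exists (\matrix_(i < 2, j < 4) nth 0 (nth [::] [:: [:: 0; 0; - k; - k * ('i * t)];
     [:: 0; 0; k; k]] i) j).
  have kE : k * ('i * t - 1) = 1 by rewrite mulVf.
  have Wl i : W i 0 = v1 i 0.
    by rewrite -(row_mxEl v1 v2); congr (row_mx _ _ _ _); apply: val_inj.
  have Wr i : W i 1 = v2 i 0.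
    by rewrite -(row_mxEr v1 v2); congr (row_mx _ _ _ _); apply: val_inj.
  apply: mx2P; rewrite mxE !big_ord_recl big_ord0 ?Wl ?Wr !mxE /=.
  - by rewrite -[RHS]kE; ring.
  - ring.
  - ring.
  - by rewrite -[RHS]kE; ring.
have ker (N : 'M[C]_(2, 4)) : \rank N = 2 -> perpendicular t N -> (N :=: kermx W)%MS.
  move=> rkN [h1 h2]; apply/eqmxP.
  have sub : (N <= kermx W)%MS by apply/sub_kermxP; rewrite mul_mx_row h1 h2 row_mx0.
  by rewrite -(mxrank_leqif_eq sub) rkN mxrank_ker rkW.
split=> // N rkN pN; apply: eqmx_trans (ker N rkN pN) (eqmx_sym (ker _ rkM perp)).
Qed.

(** The degree 3 curve in the squares X, Y of the coordinates. The quadratic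
    factors of Y^2 L^4 - X^2 E^4 are X E^2 - Y L^2 and X E^2 + Y L^2; they
    vanish identically in w at the two zeros X = Y and X = - s^2 Y of det g,
    where E and L are proportional, and S1, S2 are the quotients. *)
Definition deg3_sextic (s a3 a4 b3 b4 : C) q w : C :=
  let X := q 0 0 in let Y := q 1 0 in let u := w 0 0 in let v := w 1 0 in
  let E := (X + a3 * Y) * v - b3 * Y * u in
  let L := (X + b4 * Y) * u - a4 * Y * v in
  let S1 := ((X + a4 * Y) * v - b4 * Y * u) ^+ 2 - X * Y * (u + v) ^+ 2 in
  let S2 := ((X + (a3 - s ^+ 2) * Y) * v - (b3 + s) * Y * u) ^+ 2
            + X * Y * (s * v + u) ^+ 2 in
  L * E * (S1 * S2).

Lemma det_deg3 (s a3 a4 b3 b4 : C) q : plane_eqs s a3 a4 b3 b4 ->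
  \det (g_deg3 (plane a3 a4 b3 b4) q) = q 0 0 * q 1 0 *
    ((q 0 0 ^+ 2 - q 1 0 ^+ 2) * (q 0 0 ^+ 2 + s ^+ 2 * q 1 0 ^+ 2)).
Proof.
move=> h; have r0 := plane_eqs_neq1 h; have [-> -> -> ->] := plane_eqs_solve h.
rewrite g_deg3E det_mat2 /=; move: (q 0 0) (q 1 0) => x y; field; exact: r0.
Qed.

Lemma bev_f1_deg3 (s a3 a4 b3 b4 : C) q w : plane_eqs s a3 a4 b3 b4 ->
  bev (f1 (g_deg3 (plane a3 a4 b3 b4) q)) w =
  - \det (g_deg3 (plane a3 a4 b3 b4) q) * deg3_sextic s a3 a4 b3 b4 (square q) w.
Proof.
move=> h; rewrite (det_deg3 _ h) bev_f1 g_deg3E !mat2E /deg3_sextic square0 square1 /oct.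
have r0 := plane_eqs_neq1 h; have [a3E a4E b3E b4E] := plane_eqs_solve h.
move: (q 0 0) (q 1 0) (w 0 0) (w 1 0) => x y u v.
set E := (x ^+ 2 + a3 * y ^+ 2) * v - b3 * y ^+ 2 * u.
set L := (x ^+ 2 + b4 * y ^+ 2) * u - a4 * y ^+ 2 * v.
pose S1 := ((x ^+ 2 + a4 * y ^+ 2) * v - b4 * y ^+ 2 * u) ^+ 2
  - x ^+ 2 * y ^+ 2 * (u + v) ^+ 2.
pose S2 := ((x ^+ 2 + (a3 - s ^+ 2) * y ^+ 2) * v - (b3 + s) * y ^+ 2 * u) ^+ 2
  + x ^+ 2 * y ^+ 2 * (s * v + u) ^+ 2.
rewrite -/S1 -/S2.
have e1 : x ^+ 2 * E ^+ 2 - y ^+ 2 * L ^+ 2 = (x ^+ 2 - y ^+ 2) * S1.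
  by rewrite /E /L /S1; case: h => -> -> _ _; ring.
have e2 : x ^+ 2 * E ^+ 2 + y ^+ 2 * L ^+ 2 = (x ^+ 2 + s ^+ 2 * y ^+ 2) * S2.
  by rewrite /E /L /S2 a3E a4E b3E b4E; field.
transitivity (- (x * y * (L * E)) * ((x ^+ 2 * E ^+ 2 - y ^+ 2 * L ^+ 2)
   * (x ^+ 2 * E ^+ 2 + y ^+ 2 * L ^+ 2))).
  by rewrite /E /L; ring.
by rewrite e1 e2; ring.
Qed.

Lemma isform_deg3_sextic (s a3 a4 b3 b4 : C) :
  (forall q, isform 6 (deg3_sextic s a3 a4 b3 b4 q)) /\
  (forall w, isform 6 (deg3_sextic s a3 a4 b3 b4 ^~ w)).
Proof.
have hx := isform_x C; have hy := isform_y C; have hxy := isformM hx hy.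
split=> [q|w].
- have hE := isform_lin (- (b3 * q 1 0)) (q 0 0 + a3 * q 1 0).
  have hL := isform_lin (q 0 0 + b4 * q 1 0) (- (a4 * q 1 0)).
  have hS1 := isformB (isformX 2 (isform_lin (- (b4 * q 1 0)) (q 0 0 + a4 * q 1 0)))
    (isformZ (q 0 0 * q 1 0) (isformX 2 (isform_lin 1 1))).
  have hS2 := isformD (isformX 2 (isform_lin (- ((b3 + s) * q 1 0))
    (q 0 0 + (a3 - s ^+ 2) * q 1 0))) (isformZ (q 0 0 * q 1 0) (isformX 2 (isform_lin 1 s))).
  have h := isformM (isformM hL hE) (isformM hS1 hS2).
  by apply: isform_ext h => w; rewrite /deg3_sextic; ring.
- have hE := isform_lin (w 1 0) (a3 * w 1 0 - b3 * w 0 0).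
  have hL := isform_lin (w 0 0) (b4 * w 0 0 - a4 * w 1 0).
  have hS1 := isformB (isformX 2 (isform_lin (w 1 0) (a4 * w 1 0 - b4 * w 0 0)))
    (isformZ ((w 0 0 + w 1 0) ^+ 2) hxy).
  have hS2 := isformD (isformX 2 (isform_lin (w 1 0) ((a3 - s ^+ 2) * w 1 0 - (b3 + s) * w 0 0)))
    (isformZ ((s * w 1 0 + w 0 0) ^+ 2) hxy).
  have h := isformM (isformM hL hE) (isformM hS1 hS2).
  by apply: isform_ext h => q; rewrite /deg3_sextic; ring.
Qed.

(** A common zero of the entries forces g = x (X - Y, 0), y (0, X - Y). *)
Lemma g_deg3_neq0 (s a3 a4 b3 b4 : C) q : s != 0 -> plane_eqs s a3 a4 b3 b4 ->
  ~ (a4 = 0 /\ b3 = 0) -> q != 0 -> g_deg3 (plane a3 a4 b3 b4) q != 0.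
Proof.
move=> s0 [a4E b4E e3 e4] bad nq; apply/eqP => h; apply: bad.
have e i j : g_deg3 (plane a3 a4 b3 b4) q i j = 0 by rewrite h mxE.
have := e 0 0; have := e 0 1; have := e 1 0; have := e 1 1; rewrite g_deg3E !mat2E.
move: nq; rewrite {1}[q]pt_eta pt_eq0; move: (q 0 0) (q 1 0) => x y nxy e11 e10 e01 e00.
have y0 : y != 0.
  apply: contraNneq nxy => y0; move: e00; rewrite y0 eqxx andbT expr0n mulr0 addr0 -exprS => /eqP.
  by rewrite expf_eq0.
have a40 : a4 = 0.
  by apply: (mulfI (expf_neq0 3 y0)); rewrite mulr0 -[RHS]e01; ring.
split=> //; case: (eqVneq x 0) => [x0|x0]; last first.
  by apply: (mulfI (mulf_neq0 x0 (expf_neq0 2 y0))); rewrite mulr0 -[RHS]e10; ring.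
have b40 : b4 = 0.
  by apply: (mulfI (expf_neq0 3 y0)); rewrite mulr0 -[RHS]e11 x0; ring.
have b31 : b3 = 1 by apply/eqP; rewrite -subr_eq0 -b4E b40.
have a31 : a3 = -1 by apply/eqP; rewrite -subr_eq0 opprK addrC -a4E a40.
have s1 : s = -1.
  apply: (mulfI s0); apply/eqP; rewrite -subr_eq0; apply/eqP.
  transitivity (s - 1 + (1 + s ^+ 2)); first by ring.
  by move: e4; rewrite b31 mul1r => ->; rewrite addNr.
move: e3; rewrite a31 s1 => /eqP; rewrite -subr_eq0 (_ : _ - _ = 2); last by ring.
by rewrite (negPf (two_neq0 R)).
Qed.

Lemma lift_of_deg3 (s a3 a4 b3 b4 : C) : s != 0 -> plane_eqs s a3 a4 b3 b4 ->
  ~ (a4 = 0 /\ b3 = 0) -> exists F,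
  lift_of 3 (2 * 3) (g_deg3 (plane a3 a4 b3 b4))
    (fun q => - \det (g_deg3 (plane a3 a4 b3 b4) q)) F /\
  forall q w, bev (ev F q) w = deg3_sextic s a3 a4 b3 b4 q w.
Proof.
move=> s0 he nab; have [h1 h2] := isform_deg3_sextic s a3 a4 b3 b4.
have [F hF] := biform_exists h1 h2; exists F; split=> //; split.
- exact: isform_deg3.
- by move=> q; exact: g_deg3_neq0 he nab.
- by apply: isformN; apply: isform_det => i j; exact: isform_deg3.
- by move=> q; apply: bev_inj => w _; rewrite bevZ hF -bev_f1_deg3.
have n2 : (2 : C) != 0 := two_neq0 R; have n3 : (3 : C) != 0 by rewrite pnatr_eq0.
have n5 : (5 : C) != 0 by rewrite pnatr_eq0.
(* one of the points x = 2 y and x = 3 y avoids the zeros of det g *)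
case: (eqVneq (4 + s ^+ 2) 0) => [s4|s4].
  exists (pt 3 1); rewrite pt_eq0 (negPf n3) (det_deg3 _ he) pt0 pt1; split=> //.
  rewrite (_ : _ * _ = 3 * 2 * 2 * 2 * ((4 + s ^+ 2) + 5)); last by ring.
  by rewrite s4 add0r !mulf_neq0.
exists (pt 2 1); rewrite pt_eq0 (negPf n2) (det_deg3 _ he) pt0 pt1; split=> //.
rewrite (_ : _ * _ = 2 * 3 * (4 + s ^+ 2)); last by ring.
by rewrite !mulf_neq0.
Qed.

Lemma deg3_not_full (s a3 a4 b3 b4 : C) : plane_eqs s a3 a4 b3 b4 -> a4 = 0 /\ b3 = 0 ->
  ~ linearly_full (fun q => f1 (g_deg3 (plane a3 a4 b3 b4) q)).
Proof.
move=> he [a40 b30]; apply: (@not_full_eval _ _ (pt 1 0)).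
  by rewrite pt_eq0 oner_eq0.
by move=> q; rewrite bev_f1 g_deg3E !mat2E pt0 pt1 a40 b30 /oct; ring.
Qed.

Lemma deg3_family (t a3 a4 b3 b4 : C) : t <> 0 ->
  unique_perpendicular_plane t (plane a3 a4 b3 b4) ->
  linearly_full (fun q => f1 (g_deg3 (plane a3 a4 b3 b4) q)) ->
  curve 3 (g_deg3 (plane a3 a4 b3 b4)) /\
  exists F, galois_lift (@square R) (ev F) (g_deg3 (plane a3 a4 b3 b4)) /\
    exceptional_transversal F.
Proof.
move=> /eqP t0 [_ perp _] full.
have he := proj1 (perpendicular_eqs _ _ _ _ _) perp.
have s0 : xi1 R ^+ 2 * t != 0 by rewrite mulf_neq0 // expf_neq0 // xi_neq0.
have nab : ~ (a4 = 0 /\ b3 = 0) by move=> h; exact: (deg3_not_full he h full).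
split.
  by apply: mx_curve => [i j|q]; [exact: isform_deg3 | exact: g_deg3_neq0 s0 he nab].
have [F [lift _]] := lift_of_deg3 s0 he nab; exists F; have fullF := lift_full lift full.
split; first exact: lift_galois lift (g_deg3_flip a3 a4 b3 b4) face_nonscalar.
split; first exact: lift_of_sextic lift fullF.
apply: (@lift_exceptional _ 3 _ _ _ (-1) lift fullF); first by rewrite oppr_eq0 oner_eq0.
by move=> q; rewrite mulN1r opprK.
Qed.

End Degree3.

(** * Generic fullness *)

Section GenericFullness.
Variable R : realType.
Local Notation C := R[i].
Implicit Types (q w : 'cV[C]_2).

Definition ispoly (f : C -> C) : Prop := exists p : {poly C}, forall s, f s = p.[s].

Lemma ispoly_ext f g : (forall s, f s = g s) -> ispoly g -> ispoly f.
Proof. by move=> h [p hp]; exists p => s; rewrite h. Qed.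

Lemma ispoly_cst c : ispoly (fun=> c).
Proof. by exists c%:P => s; rewrite hornerC. Qed.

Lemma ispoly_id : ispoly (fun s => s).
Proof. by exists 'X => s; rewrite hornerX. Qed.

Lemma ispolyD f g : ispoly f -> ispoly g -> ispoly (fun s => f s + g s).
Proof. by move=> [p hp] [r hr]; exists (p + r) => s; rewrite hornerD hp hr. Qed.

Lemma ispolyM f g : ispoly f -> ispoly g -> ispoly (fun s => f s * g s).
Proof. by move=> [p hp] [r hr]; exists (p * r) => s; rewrite hornerM hp hr. Qed.

Lemma ispolyB f g : ispoly f -> ispoly g -> ispoly (fun s => f s - g s).
Proof. by move=> [p hp] [r hr]; exists (p - r) => s; rewrite hornerD hornerN hp hr. Qed.

Lemma ispolyX k f : ispoly f -> ispoly (fun s => f s ^+ k).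
Proof. by move=> [p hp]; exists (p ^+ k) => s; rewrite horner_exp hp. Qed.

Lemma ispoly_sum (I : Type) (r : seq I) (f : I -> C -> C) :
  (forall i, ispoly (f i)) -> ispoly (fun s => \sum_(i <- r) f i s).
Proof.
move=> h; elim: r => [|i r IH].
  by apply: ispoly_ext (ispoly_cst 0) => s; rewrite big_nil.
by apply: ispoly_ext (ispolyD (h i) IH) => s; rewrite big_cons.
Qed.

Lemma ispoly_prod (I : Type) (r : seq I) (f : I -> C -> C) :
  (forall i, ispoly (f i)) -> ispoly (fun s => \prod_(i <- r) f i s).
Proof.
move=> h; elim: r => [|i r IH].
  by apply: ispoly_ext (ispoly_cst 1) => s; rewrite big_nil.
by apply: ispoly_ext (ispolyM (h i) IH) => s; rewrite big_cons.
Qed.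

Lemma ispoly_det n (M : C -> 'M[C]_n) :
  (forall i j, ispoly (fun s => M s i j)) -> ispoly (fun s => \det (M s)).
Proof.
move=> h; rewrite /determinant; apply: ispoly_sum => S; apply: ispolyM; first exact: ispoly_cst.
by apply: ispoly_prod => i; exact: h.
Qed.

Lemma isform_samples n (f : 'cV[C]_2 -> C) : isform n f ->
  (forall k : 'I_n.+1, f (pt k%:R 1) = 0) -> forall q, f q = 0.
Proof.
move=> hf h; have ind : indep (pt 0 1) (pt 1 0 : 'cV[C]_2).
  by rewrite /indep !pt0 !pt1 mul0r sub0r mul1r oppr_eq0 oner_eq0.
apply: (isform_line0 hf ind); have [p [sp hp _]] := isform_line (pt 0 1) (pt 1 0) hf.
have p00 : p = 0.
  case: (eqVneq p 0) => // p0; pose rs := [seq (i%:R : C) | i <- iota 0 n.+1].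
  have us : uniq rs.
    by rewrite map_inj_uniq ?iota_uniq // => i j /eqP; rewrite eqr_nat => /eqP.
  have ar : all (root p) rs.
    apply/allP => x /mapP[k]; rewrite mem_iota add0n => /andP[_ kn] ->.
    rewrite /root hp -[X in _ == X](h (Ordinal kn)); apply/eqP; congr f.
    by apply/colP => i; rewrite !mxE; case: eqP; rewrite ?mulr1 ?mulr0 ?addr0 ?add0r.
  by have := max_poly_roots p0 ar us; rewrite size_map size_iota ltnNge sp.
by move=> z; rewrite -hp p00 horner0.
Qed.

(** Fullness amounts to the maximal rank of the values at enough points, and
    a minor that is nonzero for one value of the parameter is nonzero for all
    but finitely many. *)
Lemma generic_full n m (G : C -> 'cV[C]_2 -> binform R m) s0 :
  (forall s i, isform n (fun q => G s q 0 i)) ->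
  (forall q i, ispoly (fun s => G s q 0 i)) -> linearly_full (G s0) ->
  exists p : {poly C}, p != 0 /\ forall s, p.[s] != 0 -> linearly_full (G s).
Proof.
move=> formG polyG full0.
pose Phi s : 'M[C]_(n.+1, m.+1) := \matrix_(k, i) G s (pt (k : nat)%:R 1) 0 i.
have PhiE s k (l : 'cV[C]_m.+1) : (Phi s *m l) k 0 = (G s (pt (k : nat)%:R 1) *m l) 0 0.
  by rewrite !mxE; apply: eq_bigr => i _; rewrite mxE.
have rf : row_full (Phi s0).
  rewrite -cokermx_eq0; apply/eqP/matrixP => i j; rewrite [RHS]mxE.
  suff -> : cokermx (Phi s0) i j = (col j (cokermx (Phi s0))) i 0.
    rewrite (_ : col j _ = 0) ?mxE //; apply: full0 => q nq.
    apply/matrixP => a b; rewrite (ord1 a) (ord1 b) [RHS]mxE.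
    apply: (isform_samples (isform_mulmx _ (formG s0))) => k.
    by rewrite -PhiE colE mulmxA mulmx_coker mul0mx mxE.
  by rewrite [RHS]mxE.
pose f := fullrankfun rf.
have [p hp] : ispoly (fun s => \det (rowsub f (Phi s))).
  by apply: ispoly_det => i j; apply: ispoly_ext (polyG (pt (f i : nat)%:R 1) j) => s; rewrite !mxE.
exists p; split.
  apply/eqP => p0; have := fullrowsub_unit rf.
  by rewrite unitmxE unitfE hp p0 horner0 eqxx.
move=> s; rewrite -hp -unitfE -unitmxE => us l hl.
rewrite -[l](mulKmx us) (_ : _ *m l = 0) ?mulmx0 //.
apply/colP => k; rewrite [RHS]mxE.
transitivity ((Phi s *m l) (f k) 0); first by rewrite !mxE; apply: eq_bigr => i _; rewrite !mxE.
by rewrite PhiE hl ?mxE // pt_eq0 oner_eq0 andbF.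
Qed.

Lemma full_of_lift n m g h F : @lift_of R n m g h F -> linearly_full (ev F) ->
  linearly_full (fun q => f1 (g q)).
Proof.
move=> [_ _ hh lift [q1 [nq1 d1]]] full l hl.
have fF := isform_mulmx l (isform_coef (isform_bev_square F)).
have h1 : h q1 != 0.
  by move/f1_neq0: d1; apply: contraNneq => z; rewrite lift z scale0r.
apply: full => Q _; have [q ->] := square_surj Q.
apply/matrixP => i j; rewrite (ord1 i) (ord1 j) [RHS]mxE.
case: (isform_dom hh fF) => [q' nq'|z|->] //.
  by have := hl q' nq'; rewrite lift -scalemxAl => /(congr1 (fun M : 'M[C]_1 => M 0 0)); rewrite !mxE.
by rewrite z eqxx in h1.
Qed.

Lemma elimination (A0 A1 A2 A3 A4 A5 A6 : C) :
  - (9 * 1000 + 720) * A0 - (98 * 1000 + 496) * A1 - (415 * 1000 + 800) * A2 - (936 * 1000) * A3 - (1185 * 1000) * A4 - (800 * 1000) * A5 - (225 * 1000) * A6 = 0 ->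
  810 * A0 - (7 * 1000 + 236) * A1 - (95 * 1000 + 850) * A2 - (363 * 1000) * A3 - (646 * 1000 + 250) * A4 - (562 * 1000 + 500) * A5 - (193 * 1000 + 750) * A6 = 0 ->
  165 * A0 + 3209 * A1 + (10 * 1000 + 350) * A2 - (5 * 1000 + 750) * A3 - (71 * 1000 + 775) * A4 - (110 * 1000 + 739) * A5 - (53 * 1000 + 940) * A6 = 0 ->
  - 5 * A0 + 24 * A1 + 1300 * A2 + (4 * 1000 + 500) * A3 + 2325 * A4 - (6 * 1000 + 984) * A5 - (6 * 1000 + 880) * A6 = 0 ->
  - A1 + 250 * A3 + 675 * A4 + 186 * A5 - 420 * A6 = 0 ->
  25 * A4 + 36 * A5 - 10 * A6 = 0 ->
  A5 = 0 ->
  [/\ A0 = 0, A1 = 0, A2 = 0 & A3 = 0] /\ [/\ A4 = 0, A5 = 0 & A6 = 0].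
Proof.
move=> e0 e1 e2 e3 e4 e5 z5.
have n5 : (5 : C) != 0 by rewrite pnatr_eq0.
have n750 : (750 : C) != 0 by rewrite pnatr_eq0.
have n3000 : (3000 : C) != 0 by rewrite pnatr_eq0.
have big a b : (a.+1%:R * 1000 + b%:R : C) != 0.
  by rewrite -natrM -natrD pnatr_eq0 addn_eq0 muln_eq0.
(* 25 A4 = 10 A6 is solved by multiples of one number S *)
have [S E4 E6] : exists2 S, A4 = 2 * S & A6 = 5 * S.
  exists (A4 / 2); first by rewrite mulrC divfK ?(two_neq0 R).
  apply: (mulfI (mulf_neq0 (two_neq0 R) n5)); apply/eqP; rewrite -subr_eq0 -oppr_eq0; apply/eqP.
  by rewrite -[RHS]e5 z5; field.
have E1 : A1 = 250 * A3 - 750 * S.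
  apply/eqP; rewrite -subr_eq0 -oppr_eq0; apply/eqP.
  by rewrite -[RHS]e4 z5 E6 E4; ring.
have E0 : A0 = 260 * A2 + 2100 * A3 - (9 * 1000 + 550) * S.
  apply: (mulfI n5); apply/eqP; rewrite -subr_eq0 -oppr_eq0; apply/eqP.
  by rewrite -[RHS]e3 z5 E6 E4 E1; ring.
have f1 : 71 * A2 + 1524 * A3 - (5 * 1000 + 861) * S = 0.
  by apply: (mulfI n750); rewrite mulr0 -[RHS]e2 z5 E6 E4 E0 E1; ring.
have f2 : 153 * A2 - 628 * A3 - (6 * 1000 + 93) * S = 0.
  by apply: (mulfI n750); rewrite mulr0 -[RHS]e1 z5 E6 E4 E0 E1; ring.
have f3 : - 981 * A2 - (15 * 1000 + 324) * A3 + (54 * 1000 + 401) * S = 0.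
  by apply: (mulfI n3000); rewrite mulr0 -[RHS]e0 z5 E6 E4 E0 E1; ring.
have nD : ((26 * 1000 + 192) * 1000 + 255 : C) != 0.
  have big3 a b c k : ((a.+1%:R * k.+1%:R + b%:R) * k.+1%:R + c%:R : C) != 0.
    by rewrite -natrM -natrD -natrM -natrD pnatr_eq0 addn_eq0 muln_eq0 addn_eq0 muln_eq0.
  exact: (big3 25 192 255 999)%N.
have S0 : S = 0.
  apply: (mulfI nD); apply: (mulfI (mulf_neq0 (two_neq0 R) n5)); rewrite !mulr0.
  transitivity (318 * (153 * (71 * A2 + 1524 * A3 - (5 * 1000 + 861) * S)
      - 71 * (153 * A2 - 628 * A3 - (6 * 1000 + 93) * S))
    - 217 * (981 * (71 * A2 + 1524 * A3 - (5 * 1000 + 861) * S)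
      + 71 * (- 981 * A2 - (15 * 1000 + 324) * A3 + (54 * 1000 + 401) * S))); first by ring.
  by rewrite f1 f2 f3; ring.
have z3 : A3 = 0.
  apply: (mulfI (big 276 760)); rewrite mulr0.
  transitivity (153 * (71 * A2 + 1524 * A3 - (5 * 1000 + 861) * S)
      - 71 * (153 * A2 - 628 * A3 - (6 * 1000 + 93) * S) + (464 * 1000 + 130) * S); first by ring.
  by rewrite f1 f2 S0; ring.
have z2 : A2 = 0.
  have n71 : (71 : C) != 0 by rewrite pnatr_eq0.
  by apply: (mulfI n71); rewrite mulr0 -[RHS]f1 z3 S0; ring.
have z4 : A4 = 0 by rewrite E4 S0 mulr0.
have z6 : A6 = 0 by rewrite E6 S0 mulr0.
have z1 : A1 = 0 by rewrite E1 z3 S0 !mulr0 subr0.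
have z0 : A0 = 0 by rewrite E0 z2 z3 S0 !mulr0 addr0 subr0.
by split; [exact: And4 z0 z1 z2 z3 | exact: And3 z4 z5 z6].
Qed.

(** At s = 2, that is t = - 2 i, the coefficients of the curve are found to be
    independent by elimination. *)
Lemma deg3_full2 : linearly_full (fun q => f1 (g_deg3 (plane 9 10 (-5) (-6)) q) : binform R 6).
Proof.
have he : plane_eqs (2 : C) 9 10 (-5) (-6) by split; ring.
have nab : ~ ((10 : C) = 0 /\ (-5 : C) = 0) by case=> /eqP; rewrite pnatr_eq0.
have [F [lift hF]] := lift_of_deg3 (two_neq0 R) he nab; apply: (full_of_lift lift) => l hl.
have n1 (t : C) : pt t 1 != 0 :> 'cV[C]_2 by rewrite pt_eq0 oner_eq0 andbF.
have H t : (ev F (pt t 1) *m l) 0 0 = 0 by rewrite hl // mxE.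
pose A0 := l (inord 0) 0; pose A1 := l (inord 1) 0; pose A2 := l (inord 2) 0.
pose A3 := l (inord 3) 0; pose A4 := l (inord 4) 0; pose A5 := l (inord 5) 0.
pose A6 := l (inord 6) 0.
have eqn t : (- 5 * t ^+ 3 + 165 * t ^+ 2 + 810 * t - (9 * 1000 + 720)) * A0
   + (- t ^+ 4 + 24 * t ^+ 3 + 3209 * t ^+ 2 - (7 * 1000 + 236) * t - (98 * 1000 + 496)) * A1
   + (1300 * t ^+ 3 + (10 * 1000 + 350) * t ^+ 2 - (95 * 1000 + 850) * t - (415 * 1000 + 800)) * A2
   + (250 * t ^+ 4 + (4 * 1000 + 500) * t ^+ 3 - (5 * 1000 + 750) * t ^+ 2 - (363 * 1000) * t - (936 * 1000)) * A3
   + (25 * t ^+ 5 + 675 * t ^+ 4 + 2325 * t ^+ 3 - (71 * 1000 + 775) * t ^+ 2 - (646 * 1000 + 250) * t - (1185 * 1000)) * A4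
   + (t ^+ 6 + 36 * t ^+ 5 + 186 * t ^+ 4 - (6 * 1000 + 984) * t ^+ 3 - (110 * 1000 + 739) * t ^+ 2 - (562 * 1000 + 500) * t - (800 * 1000)) * A5
   + (- 10 * t ^+ 5 - 420 * t ^+ 4 - (6 * 1000 + 880) * t ^+ 3 - (53 * 1000 + 940) * t ^+ 2 - (193 * 1000 + 750) * t - (225 * 1000)) * A6 = 0.
  rewrite -[RHS](H t); symmetry; apply: functional_of_bev => x y.
  by rewrite hF /deg3_sextic !pt0 !pt1; ring.
have [] := @poly6_zero R
  (- (9 * 1000 + 720) * A0 - (98 * 1000 + 496) * A1 - (415 * 1000 + 800) * A2 - (936 * 1000) * A3 - (1185 * 1000) * A4 - (800 * 1000) * A5 - (225 * 1000) * A6)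
  (810 * A0 - (7 * 1000 + 236) * A1 - (95 * 1000 + 850) * A2 - (363 * 1000) * A3 - (646 * 1000 + 250) * A4 - (562 * 1000 + 500) * A5 - (193 * 1000 + 750) * A6)
  (165 * A0 + 3209 * A1 + (10 * 1000 + 350) * A2 - (5 * 1000 + 750) * A3 - (71 * 1000 + 775) * A4 - (110 * 1000 + 739) * A5 - (53 * 1000 + 940) * A6)
  (- 5 * A0 + 24 * A1 + 1300 * A2 + (4 * 1000 + 500) * A3 + 2325 * A4 - (6 * 1000 + 984) * A5 - (6 * 1000 + 880) * A6)
  (- A1 + 250 * A3 + 675 * A4 + 186 * A5 - 420 * A6)
  (25 * A4 + 36 * A5 - 10 * A6)
  (A5).
  by move=> t; rewrite -[RHS](eqn t); ring.
move=> e0 e1 e2 [e3 e4 e5 e6].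
have [[z0 z1 z2 z3] [z4 z5 z6]] := elimination e0 e1 e2 e3 e4 e5 e6.
exact: col7_zero z0 z1 z2 z3 z4 z5 z6.
Qed.

(** The matrix g multiplied by s - 1, the denominator of its entries. *)
Definition scaled_deg3 (s : C) q : 'M[C]_2 :=
  let x := q 0 0 in let y := q 1 0 in
  mat2 (x * ((s - 1) * x ^+ 2 + (1 + s ^+ 3) * y ^+ 2)) (y * ((s + s ^+ 3) * y ^+ 2))
    (x * (- (1 + s ^+ 2) * y ^+ 2)) (y * ((s - 1) * x ^+ 2 - (s + s ^+ 2) * y ^+ 2)).

Lemma scaled_deg3E (s a3 a4 b3 b4 : C) q : plane_eqs s a3 a4 b3 b4 ->
  scaled_deg3 s q = (s - 1) *: g_deg3 (plane a3 a4 b3 b4) q.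
Proof.
move=> h; have r0 := plane_eqs_neq1 h; have [-> -> -> ->] := plane_eqs_solve h.
by rewrite g_deg3E /scaled_deg3; apply: mx2P; rewrite scE !mat2E; field; exact: r0.
Qed.

Lemma f1Z (k : C) (M : 'M[C]_2) : f1 (k *: M) = k ^+ 6 *: f1 M.
Proof.
by apply: bev_inj => w _; rewrite bevZ !bev_f1 !scE -octZ; congr oct; ring.
Qed.

Lemma scaled_deg3_full (s a3 a4 b3 b4 : C) : plane_eqs s a3 a4 b3 b4 ->
  linearly_full (fun q => f1 (scaled_deg3 s q)) <->
  linearly_full (fun q => f1 (g_deg3 (plane a3 a4 b3 b4) q)).
Proof.
move=> h; have r6 : (s - 1) ^+ 6 != 0 by rewrite expf_neq0 // (plane_eqs_neq1 h).
have E q : f1 (scaled_deg3 s q) = (s - 1) ^+ 6 *: f1 (g_deg3 (plane a3 a4 b3 b4) q).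
  by rewrite (scaled_deg3E _ h) f1Z.
split=> full l hl; apply: full => q nq.
  by rewrite E -scalemxAl hl ?scaler0.
by apply: (scalerI r6); rewrite scaler0 scalemxAl -E hl.
Qed.

Lemma deg3_generic : exists e : seq C,
  forall t : C, t <> 0 -> t \notin e ->
    exists a3 a4 b3 b4 : C,
      unique_perpendicular_plane t (plane a3 a4 b3 b4) /\
      linearly_full (fun q => f1 (g_deg3 (plane a3 a4 b3 b4) q)).
Proof.
have he : plane_eqs (2 : C) 9 10 (-5) (-6) by split; ring.
have [] := @generic_full (6 * 3) 6 (fun s q => f1 (scaled_deg3 s q)) 2.
- move=> s i; apply: isform_coef => w; apply: isform_f1 => {}i j.
  have hx := isform_x C; have hy := isform_y C; have x2 := isformX 2 hx; have y2 := isformX 2 hy.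
  case: (ord2 i) => ->; case: (ord2 j) => ->.
  + have h := isformM hx (isformD (isformZ (s - 1) x2) (isformZ (1 + s ^+ 3) y2)).
    by apply: isform_ext h => q; rewrite /scaled_deg3 mat2E.
  + have h := isformM hy (isformZ (s + s ^+ 3) y2).
    by apply: isform_ext h => q; rewrite /scaled_deg3 mat2E.
  + have h := isformM hx (isformZ (- (1 + s ^+ 2)) y2).
    by apply: isform_ext h => q; rewrite /scaled_deg3 mat2E.
  + have h := isformM hy (isformB (isformZ (s - 1) x2) (isformZ (s + s ^+ 2) y2)).
    by apply: isform_ext h => q; rewrite /scaled_deg3 mat2E.
- move=> q i; have [c hc] := @coef_bev R _ i.
  apply: ispoly_ext (fun s => hc (f1 (scaled_deg3 s q))) _.
  apply: ispoly_sum => k; apply: ispolyM; first exact: ispoly_cst.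
  have hs := ispoly_id; have h1 := ispoly_cst; have hr := ispolyB hs (h1 1).
  pose x := q 0 0; pose y := q 1 0; pose u : C := pt 1 k%:R 0 0; pose v : C := pt 1 k%:R 1 0.
  have hl : ispoly (fun s => scaled_deg3 s q 1 1 * u - scaled_deg3 s q 0 1 * v).
    have h := ispolyB (ispolyM (h1 (y * u)) (ispolyB (ispolyM hr (h1 (x ^+ 2)))
      (ispolyM (ispolyD hs (ispolyX 2 hs)) (h1 (y ^+ 2)))))
      (ispolyM (h1 (y * v)) (ispolyM (ispolyD hs (ispolyX 3 hs)) (h1 (y ^+ 2)))).
    by apply: ispoly_ext h => s; rewrite /scaled_deg3 !mat2E -/x -/y -/u -/v; ring.
  have hm : ispoly (fun s => scaled_deg3 s q 0 0 * v - scaled_deg3 s q 1 0 * u).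
    have h := ispolyD (ispolyM (h1 (x * v)) (ispolyD (ispolyM hr (h1 (x ^+ 2)))
      (ispolyM (ispolyD (h1 1) (ispolyX 3 hs)) (h1 (y ^+ 2)))))
      (ispolyM (h1 (x * u)) (ispolyM (ispolyD (h1 1) (ispolyX 2 hs)) (h1 (y ^+ 2)))).
    by apply: ispoly_ext h => s; rewrite /scaled_deg3 !mat2E -/x -/y -/u -/v; ring.
  have h := ispolyM (ispolyM hl hm) (ispolyB (ispolyX 4 hl) (ispolyX 4 hm)).
  by apply: ispoly_ext h => s; rewrite bev_f1.
- exact: (proj2 (scaled_deg3_full he) deg3_full2).
move=> p [p0 hp]; have [rs hrs] := poly_roots_list p0.
pose J := xi1 R ^+ 2; have J0 : J != 0 by rewrite expf_neq0 // xi_neq0.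
exists (J^-1 :: [seq r / J | r <- rs]) => t t0; rewrite inE negb_or => /andP[t1 tr].
have r0 : J * t - 1 != 0.
  by apply: contraNneq t1 => /eqP; rewrite subr_eq0 => /eqP e; rewrite -[t](mulKf J0) e mulr1.
have [a3 [a4 [b3 [b4 he']]]] := plane_exists r0; exists a3, a4, b3, b4; split.
  exact: plane_unique (proj2 (perpendicular_eqs _ _ _ _ _) he').
apply: (proj1 (scaled_deg3_full he')); apply: hp; apply/eqP => /hrs h.
move/negP: tr; apply; apply/mapP; exists (J * t) => //.
by rewrite mulrC mulKf.
Qed.

End GenericFullness.

(** * Classification in degree 3 *)

Section Degree3Classification.
Variable R : realType.
Local Notation C := R[i].
Implicit Types (q w Q al ga be de : 'cV[C]_2) (M A B T : 'M[C]_2) (F : vform (binform R 6) 6).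

Definition cross (a b : 'cV[C]_2) : C := a 0 0 * b 1 0 - a 1 0 * b 0 0.

Definition moving al ga Q : 'cV[C]_2 := Q 0 0 *: al + Q 1 0 *: ga.

Lemma moving_pt (a b c d x y : C) :
  moving (pt a b) (pt c d) (pt x y) = pt (x * a + y * c) (x * b + y * d).
Proof. by rewrite [LHS]pt_eta !mxE. Qed.

Lemma cross_pt (a b c d : C) : cross (pt a b) (pt c d) = a * d - b * c.
Proof. by rewrite /cross !mxE. Qed.

(** The curves that are invariant under a half turn about a face axis. *)
Definition cubic al ga be de q : 'M[C]_2 :=
  row_mx (q 0 0 *: moving al ga (square q)) (q 1 0 *: moving be de (square q)).

Lemma movingE al ga Q i : moving al ga Q i 0 = Q 0 0 * al i 0 + Q 1 0 * ga i 0.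
Proof. by rewrite !mxE. Qed.

Lemma cubicE al ga be de q : cubic al ga be de q =
  mat2 (q 0 0 * moving al ga (square q) 0 0) (q 1 0 * moving be de (square q) 0 0)
       (q 0 0 * moving al ga (square q) 1 0) (q 1 0 * moving be de (square q) 1 0).
Proof.
have cl (a b : 'cV[C]_2) i : (row_mx a b : 'M[C]_2) i 0 = a i 0.
  by rewrite -(row_mxEl a b); congr (row_mx _ _ _ _); apply: val_inj.
have cr (a b : 'cV[C]_2) i : (row_mx a b : 'M[C]_2) i 1 = b i 0.
  by rewrite -(row_mxEr a b); congr (row_mx _ _ _ _); apply: val_inj.
by apply: mx2P; rewrite /cubic ?cl ?cr scE mat2E.
Qed.

Lemma cubic_col0 al ga be de q i : cubic al ga be de q i 0 =
  q 0 0 * (q 0 0 ^+ 2 * al i 0 + q 1 0 ^+ 2 * ga i 0).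
Proof. by rewrite cubicE -square0 -square1 -movingE; case: (ord2 i) => ->; rewrite mat2E. Qed.

Lemma cubic_col1 al ga be de q i : cubic al ga be de q i 1 =
  q 1 0 * (q 0 0 ^+ 2 * be i 0 + q 1 0 ^+ 2 * de i 0).
Proof. by rewrite cubicE -square0 -square1 -movingE; case: (ord2 i) => ->; rewrite mat2E. Qed.

Lemma isform_cross a : isform 1 (cross a).
Proof. by apply: isform_ext (isform_lin (- a 1 0) (a 0 0)) => w; rewrite /cross; ring. Qed.

Lemma isform_moving al ga i : isform 1 (fun Q => moving al ga Q i 0).
Proof. by apply: isform_ext (isform_lin (al i 0) (ga i 0)) => Q; rewrite movingE; ring. Qed.

Lemma isform_discr al ga be de :
  isform 2 (fun Q => cross (moving al ga Q) (moving be de Q)).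
Proof.
have h := isformB (isformM (isform_moving al ga 0) (isform_moving be de 1))
  (isformM (isform_moving al ga 1) (isform_moving be de 0)).
by apply: isform_ext h => Q.
Qed.

Lemma crossC a b : cross a b = - cross b a.
Proof. by rewrite /cross; ring. Qed.

Lemma crossZl (k : C) a b : cross (k *: a) b = k * cross a b.
Proof. by rewrite /cross !mxE; ring. Qed.

Lemma crossxx a : cross a a = 0.
Proof. by rewrite /cross; ring. Qed.

Lemma common_direction a b : cross a b = 0 ->
  exists w, [/\ w != 0, cross a w = 0 & cross b w = 0].
Proof.
move=> ab; case: (eqVneq a 0) => [a0|a0]; last first.
  by exists a; rewrite crossxx crossC ab oppr0.
case: (eqVneq b 0) => [b0|b0]; last by exists b; rewrite crossxx ab.
exists (pt 1 0); rewrite a0 b0 pt_eq0 oner_eq0 /cross !mxE !mul0r subrr; by [].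
Qed.

Lemma cross_neq0 a b : a != 0 -> b != 0 -> exists w, cross a w != 0 /\ cross b w != 0.
Proof.
move=> a0 b0; apply: contrapT => h.
have nz c : c != 0 -> ~ forall w, cross c w = 0.
  move=> c0 z; move/eqP: c0; apply; rewrite [c]pt_eta; apply/eqP; rewrite pt_eq0.
  have := z (pt 0 1); have := z (pt 1 0); rewrite /cross !pt0 !pt1.
  rewrite !mulr1 !mulr0 subr0 sub0r => /eqP; rewrite oppr_eq0 => -> /eqP ->; by [].
case: (isform_dom (isform_cross a) (isform_cross b)) => [w _| |]; [|exact: nz|exact: nz].
apply: contrapT => /eqP; rewrite mulf_eq0 negb_or => /andP[h1 h2].
by apply: h; exists w.
Qed.

(** The relation between f1 o g and F, cleared of the common factor x y. *)
Definition cubic_relation (k : C) F al ga be de : Prop := forall Q w,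
  let e := moving al ga Q in let o := moving be de Q in
  cross e o * bev (ev F Q) w = k * (cross e w * cross o w *
    (Q 0 0 ^+ 2 * cross e w ^+ 4 - Q 1 0 ^+ 2 * cross o w ^+ 4)).

Lemma cubic_relation_of_lift m h F al ga be de (k : C) :
  lift_of 3 m (cubic al ga be de) h F ->
  (forall q, \det (cubic al ga be de q) = k * h q) ->
  cubic_relation k F al ga be de /\
  exists Q, cross (moving al ga Q) (moving be de Q) != 0.
Proof.
move=> [_ _ _ lift [q1 [_ d1]]] Dh.
have detE q : \det (cubic al ga be de q) =
    q 0 0 * q 1 0 * cross (moving al ga (square q)) (moving be de (square q)).
  by rewrite cubicE det_mat2 /cross; ring.
split; last first.
  exists (square q1); apply: contraNneq d1 => z; by rewrite detE z mulr0.
move=> Q w e o; have [q' QE] := square_surj Q.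
have sq i : isform 2 (fun q => square q i 0).
  by have h1 := isformX 2 (@isform_coord R i); apply: isform_ext h1 => q; rewrite mxE.
have mv a b i : isform 2 (fun q => moving a b (square q) i 0).
  have h1 := isformD (isformZ (a i 0) (sq 0)) (isformZ (b i 0) (sq 1)).
  by apply: isform_ext h1 => q; rewrite movingE; ring.
have cr a b : isform 2 (fun q => cross (moving a b (square q)) w).
  have h1 := isformB (isformZ (w 1 0) (mv a b 0)) (isformZ (w 0 0) (mv a b 1)).
  by apply: isform_ext h1 => q; rewrite /cross; ring.
have dd : isform 4 (fun q => cross (moving al ga (square q)) (moving be de (square q))).
  have h1 := isformB (isformM (mv al ga 0) (mv be de 1)) (isformM (mv al ga 1) (mv be de 0)).
  by apply: isform_ext h1 => q.
have lhs := isformM dd (isform_bev_square F w).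
have rhs := isformZ k (isformM (isformM (cr al ga) (cr be de))
  (isformB (isformM (isformX 2 (sq 0)) (isformX 4 (cr al ga)))
           (isformM (isformX 2 (sq 1)) (isformX 4 (cr be de))))).
rewrite /e /o QE.
apply: (isform_cancel (isformM (isform_x C) (isform_y C)) lhs rhs).
  exists (pt 1 1); by rewrite pt0 pt1 mulr1 oner_eq0.
move=> q _; transitivity (\det (cubic al ga be de q) * bev (ev F (square q)) w).
  by rewrite detE; ring.
rewrite Dh -[LHS]mulrA -bevZ -lift bev_f1 cubicE !mat2E.
by rewrite !square0 !square1 /cross /oct; ring.
Qed.

Section Relation.
Variables (k : C) (F : vform (binform R 6) 6) (al ga be de : 'cV[C]_2).
Hypothesis k0 : k != 0.
Hypothesis full : linearly_full (ev F).
Hypothesis rel : cubic_relation k F al ga be de.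
Hypothesis nd : exists Q, cross (moving al ga Q) (moving be de Q) != 0.

Lemma no_constant_direction w : w != 0 ->
  ~ forall Q, cross (moving al ga Q) w * cross (moving be de Q) w = 0.
Proof.
move=> nw h; have z Q : bev (ev F Q) w = 0.
  case: (isform_dom (isform_discr al ga be de) (isform_bev_ev F w)) => [q _|d0|//].
    by rewrite rel h mul0r mulr0.
  by have [Q' /eqP] := nd.
exact: (not_full_eval nw z full).
Qed.

Lemma cross_moving al' ga' Q w :
  cross (moving al' ga' Q) w = Q 0 0 * cross al' w + Q 1 0 * cross ga' w.
Proof. by rewrite /cross !movingE; ring. Qed.

Lemma indep_even : cross al ga != 0.
Proof.
apply/eqP => /common_direction[w [nw h1 h2]]; apply: (no_constant_direction nw) => Q.
by rewrite cross_moving h1 h2 !mulr0 addr0 mul0r.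
Qed.

Lemma indep_odd : cross be de != 0.
Proof.
apply/eqP => /common_direction[w [nw h1 h2]]; apply: (no_constant_direction nw) => Q.
by rewrite (cross_moving be) h1 h2 !mulr0 addr0 mulr0.
Qed.

Lemma moving_neq0 al' ga' Q : cross al' ga' != 0 -> Q != 0 -> moving al' ga' Q != 0.
Proof.
move=> c; apply: contraNneq => z; rewrite [Q]pt_eta pt_eq0.
have h1 : Q 0 0 * cross al' ga' = 0.
  by have := cross_moving al' ga' Q ga'; rewrite z crossxx mulr0 addr0 => <-; rewrite /cross !mxE; ring.
have h2 : Q 1 0 * cross ga' al' = 0.
  by have := cross_moving al' ga' Q al'; rewrite z crossxx mulr0 add0r => <-; rewrite /cross !mxE; ring.
move/eqP: h1; rewrite mulf_eq0 (negPf c) orbF => ->.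
by move/eqP: h2; rewrite mulf_eq0 crossC oppr_eq0 (negPf c) orbF.
Qed.

(** Where the discriminant vanishes the relation reduces to the vanishing of its
    right-hand side, in which all linear forms in w are then proportional. *)
Lemma discr_ratio Q : Q != 0 -> cross (moving al ga Q) (moving be de Q) = 0 ->
  exists ka : C, moving be de Q = ka *: moving al ga Q /\ Q 0 0 ^+ 2 = ka ^+ 4 * Q 1 0 ^+ 2.
Proof.
move=> nQ d0; have e0 := moving_neq0 indep_even nQ; have o0 := moving_neq0 indep_odd nQ.
have [ka oE] : exists ka, moving be de Q = ka *: moving al ga Q.
  by apply: not_indep e0 _; rewrite negbK; apply/eqP; exact: d0.
exists ka; split=> //; have [w [w1 w2]] := cross_neq0 e0 o0.
have := rel Q w; rewrite /= d0 mul0r => /eqP; rewrite eq_sym.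
rewrite mulf_eq0 (negPf k0) /= mulf_eq0 mulf_eq0 (negPf w1) (negPf w2) /= subr_eq0 oE crossZl.
rewrite exprMn [X in _ == X]mulrA => /eqP h; have -> := mulIf (expf_neq0 4 w1) h; ring.
Qed.

Lemma discr_x : cross al be != 0.
Proof.
apply/eqP => z; have n : pt 1 0 != 0 :> 'cV[C]_2 by rewrite pt_eq0 oner_eq0.
have mx a b : moving a b (pt 1 0) = a by rewrite /moving pt0 pt1 scale1r scale0r addr0.
have := discr_ratio n; rewrite !mx => /(_ z)[ka [_]]; rewrite pt0 pt1 expr1n expr0n mulr0.
by move/eqP; rewrite oner_eq0.
Qed.

Lemma discr_y : cross ga de != 0.
Proof.
apply/eqP => z; have n : pt 0 1 != 0 :> 'cV[C]_2 by rewrite pt_eq0 oner_eq0 andbF.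
have my a b : moving a b (pt 0 1) = b by rewrite /moving pt0 pt1 scale1r scale0r add0r.
have := discr_ratio n; rewrite !my => /(_ z)[ka [dE]]; rewrite pt0 pt1 expr1n expr0n mulr1 => /esym /eqP.
rewrite expf_eq0 /= => /eqP ka0; move: indep_odd.
by rewrite dE ka0 scale0r /cross !mxE !mulr0 subrr eqxx.
Qed.

End Relation.

Lemma cubic_of_face (g : 'cV[C]_2 -> 'M[C]_2) : (forall i j, isform 3 (fun q => g q i j)) ->
  (forall q, g q = g (flip q) *m face R) ->
  exists al ga be de, forall q, g q = cubic al ga be de q.
Proof.
move=> hg gE.
have g0 q i : g q i 0 = g (flip q) i 0 by rewrite [in LHS]gE mulmx2 !mat2E; ring.
have g1 q i : g q i 1 = - g (flip q) i 1 by rewrite [in LHS]gE mulmx2 !mat2E; ring.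
have half (c : C) : c = - c -> c = 0.
  move=> e; apply: (mulfI (two_neq0 R)); rewrite mulr0 mulr_natl mulr2n {1}e; exact: addNr.
have even i : exists a c : C, forall q, g q i 0 = q 0 0 * (q 0 0 ^+ 2 * a + q 1 0 ^+ 2 * c).
  have [a [b [c [d hE]]]] := isform3P (hg i 0); exists a, c => q.
  have d0 : d = 0.
    apply: half; have := g0 (pt 0 1) i; rewrite !hE /flip !pt0 !pt1 => h.
    transitivity (a * 0 ^+ 3 + b * (0 ^+ 2 * 1) + c * (0 * 1 ^+ 2) + d * 1 ^+ 3); first by ring.
    by rewrite h; ring.
  have b0 : b = 0.
    apply: half; have := g0 (pt 1 1) i; rewrite !hE /flip !pt0 !pt1 d0 => h.
    apply: (addrI (a + c)); transitivity (a * 1 ^+ 3 + b * (1 ^+ 2 * 1) + c * (1 * 1 ^+ 2) + 0 * 1 ^+ 3); first by ring.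
    by rewrite h; ring.
  by rewrite hE b0 d0; ring.
have odd i : exists b d : C, forall q, g q i 1 = q 1 0 * (q 0 0 ^+ 2 * b + q 1 0 ^+ 2 * d).
  have [a [b [c [d hE]]]] := isform3P (hg i 1); exists b, d => q.
  have a0 : a = 0.
    apply: half; have := g1 (pt 1 0) i; rewrite !hE /flip !pt0 !pt1 => h.
    transitivity (a * 1 ^+ 3 + b * (1 ^+ 2 * 0) + c * (1 * 0 ^+ 2) + d * 0 ^+ 3); first by ring.
    by rewrite h; ring.
  have c0 : c = 0.
    apply: half; have := g1 (pt 1 1) i; rewrite !hE /flip !pt0 !pt1 a0 => h.
    apply: (addrI (b + d)); transitivity (0 * 1 ^+ 3 + b * (1 ^+ 2 * 1) + c * (1 * 1 ^+ 2) + d * 1 ^+ 3); first by ring.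
    by rewrite h; ring.
  by rewrite hE a0 c0; ring.
have [a0 [c0 e0]] := even 0; have [a1 [c1 e1]] := even 1.
have [b0 [d0 f0]] := odd 0; have [b1 [d1 f1]] := odd 1.
exists (pt a0 a1), (pt c0 c1), (pt b0 b1), (pt d0 d1) => q.
by rewrite cubicE; apply: mx2P; rewrite !mat2E !movingE ?pt0 ?pt1 square0 square1.
Qed.

Lemma g_deg3_cubic (a3 a4 b3 b4 : C) q :
  g_deg3 (plane a3 a4 b3 b4) q = cubic (pt 1 0) (pt a3 b3) (pt 0 1) (pt a4 b4) q.
Proof.
by rewrite g_deg3E cubicE; apply: mx2P; rewrite !mat2E !movingE !(pt0, pt1) square0 square1; ring.
Qed.

(** In the coordinate u' = u + (1 + t) v the curve has no term in u'^3 v^3: with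
    p = X + t Y it is, up to a factor, the product of X v^2 - Y u'^2 and of two
    quadratic forms that are combinations of X v^2 + Y u'^2 and u' v. *)
Lemma antisymmetric_not_full (k t : C) F : linearly_full (ev F) ->
  (exists Q, cross (moving (pt 1 0) (pt (- (1 + t + t ^+ 2)) (1 + t)) Q)
                   (moving (pt 0 1) (pt (- (t + t ^+ 2)) t) Q) != 0) ->
  ~ cubic_relation k F (pt 1 0) (pt (- (1 + t + t ^+ 2)) (1 + t)) (pt 0 1) (pt (- (t + t ^+ 2)) t).
Proof.
move=> full nd rel; pose S := mat2 1 (- (1 + t)) 0 1 : 'M[C]_2.
have uS : S \in unitmx by rewrite unitmx_mat2 mulr0 subr0 mulr1 oner_eq0.
have [F' hF'] : exists F' : vform (binform R 6) 6,
    forall q w, bev (ev F' q) w = bev (ev F q) (S *m w).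
  apply: (@biform_exists _ 6 6 (fun q w => bev (ev F q) (S *m w))).
    by move=> q; exact: isform_comp (isform_bev _).
  by move=> w; exact: (isform_bev_ev F (S *m w)).
have full' : linearly_full (ev F').
  by apply: (@full_subst _ F F' 1%:M S full (unitmx1 _ _) uS) => q w; rewrite mul1mx.
pose l : 'cV[C]_7 := delta_mx (inord 3) 0.
suff l0 : l = 0.
  have := congr1 (fun v : 'cV[C]_7 => v (inord 3) 0) l0.
  by rewrite /= !mxE !eqxx /= => /eqP; rewrite oner_eq0.
apply: full' => Q _; apply/matrixP => i j; rewrite (ord1 i) (ord1 j) [RHS]mxE.
have hl := isform_mulmx l (isform_ev_row F').
case: (isform_dom (isform_discr (pt 1 0) (pt (- (1 + t + t ^+ 2)) (1 + t)) (pt 0 1)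
    (pt (- (t + t ^+ 2)) t)) hl) => [{}Q _|z|//]; last by have [Q' /eqP] := nd.
set D := cross _ _.
have -> : D * (ev F' Q *m l) 0 0 = ((D *: ev F' Q) *m l) 0 0 by rewrite -scalemxAl scE.
pose X := Q 0 0; pose Y := Q 1 0; pose m := (X + t * Y) * (1 + t).
pose n := (X + t * Y) ^+ 2 + (1 + t) ^+ 2 * (X * Y).
have lE i' : l i' 0 = (i' == inord 3)%:R by rewrite mxE eqxx andbT.
have ne a : (a < 7)%N -> a != 3%N -> (inord a == inord 3 :> 'I_7) = false.
  by move=> a7 a3; apply/negbTE; rewrite -val_eqE /= !inordK.
rewrite (@functional_of_bev _ _ _ (k * D * (- (m * n * Y ^+ 3)))
  (k * D * ((n ^+ 2 + 4 * m ^+ 2 * X * Y) * Y ^+ 2)) (k * D * (- (5 * m * n * X * Y ^+ 2))) 0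
  (k * D * (5 * m * n * X ^+ 2 * Y)) (k * D * (- ((n ^+ 2 + 4 * m ^+ 2 * X * Y) * X ^+ 2)))
  (k * D * (m * n * X ^+ 3))).
  by rewrite !lE eqxx !ne //= !mulr0n !mulr0 mul0r !addr0.
move=> u v; rewrite bevZ hF' rel; set w := S *m _.
have w0 : w 0 0 = u - (1 + t) * v by rewrite /w mulcol2 !mat2E pt0 pt1; ring.
have w1 : w 1 0 = v by rewrite /w mulcol2 !mat2E pt0 pt1; ring.
have eE : cross (moving (pt 1 0) (pt (- (1 + t + t ^+ 2)) (1 + t)) Q) w =
    (X + t * Y) * v - (1 + t) * Y * u.
  by rewrite /cross !movingE !(pt0, pt1) w0 w1 -/X -/Y; ring.
have oE : cross (moving (pt 0 1) (pt (- (t + t ^+ 2)) t) Q) w =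
    (1 + t) * X * v - (X + t * Y) * u.
  by rewrite /cross !movingE !(pt0, pt1) w0 w1 -/X -/Y; ring.
have dE : D = (X - Y) * (X - t ^+ 2 * Y).
  by rewrite /D /cross !movingE !(pt0, pt1) -/X -/Y; ring.
by rewrite eE oE dE /n /m -/X -/Y; ring.
Qed.

(** A root r of the discriminant gives o = ka e there, with ka^4 = r^2; the
    sign of ka^2 = r or - r decides between the excluded and the actual family.
    When r = 1 is a double root, the next order of the relation fixes b4. *)
Lemma cubic_parameter (k a3 a4 b3 b4 : C) F : k != 0 -> linearly_full (ev F) ->
  cubic_relation k F (pt 1 0) (pt a3 b3) (pt 0 1) (pt a4 b4) ->
  (exists Q, cross (moving (pt 1 0) (pt a3 b3) Q) (moving (pt 0 1) (pt a4 b4) Q) != 0) ->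
  a4 = 1 + a3 -> b3 = 1 + b4 -> exists s, s != 0 /\ plane_eqs s a3 a4 b3 b4.
Proof.
move=> k0 full rel nd a4E b3E; pose r := - (1 + a3 + b4).
have n1 : pt r 1 != 0 :> 'cV[C]_2 by rewrite pt_eq0 oner_eq0 andbF.
have r0 : r != 0.
  have := discr_y k0 full rel nd; apply: contraNneq => rz.
  rewrite /cross !pt0 !pt1 a4E b3E; apply/eqP; rewrite -[RHS]rz /r; ring.
have d0 : cross (moving (pt 1 0) (pt a3 b3) (pt r 1)) (moving (pt 0 1) (pt a4 b4) (pt r 1)) = 0.
  by rewrite !moving_pt cross_pt a4E b3E /r; ring.
have [ka [oE ka4]] := discr_ratio k0 full rel nd n1 d0.
have e1 : a4 = ka * (r + a3).
  have := congr1 (fun v : 'cV[C]_2 => v 0 0) oE; rewrite /= scE !movingE !(pt0, pt1) => h.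
  by transitivity (r * 0 + 1 * a4); [ring | rewrite h; ring].
have e2 : r + b4 = ka * b3.
  have := congr1 (fun v : 'cV[C]_2 => v 1 0) oE; rewrite /= scE !movingE !(pt0, pt1) => h.
  by transitivity (r * 1 + 1 * b4); [ring | rewrite h; ring].
have ka0 : ka != 0.
  move: ka4; rewrite pt0 pt1 expr1n mulr1 => h; apply: contraNneq r0 => z.
  by move: h; rewrite z expr0n => /eqP; rewrite expf_eq0.
have : (r - ka ^+ 2) * (r + ka ^+ 2) = 0.
  by move: ka4; rewrite pt0 pt1 expr1n mulr1 -subr_sqr => ->; rewrite -exprM subrr.
move/eqP; rewrite mulf_eq0 => /orP[]; last first.
  rewrite addr_eq0 => /eqP rE; exists ka; split=> //; split=> //.
  - by rewrite b3E addrC addKr.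
  - rewrite rE a4E in e1; apply/eqP; rewrite -subr_eq0; apply/eqP.
    transitivity (ka * (- ka ^+ 2 + a3) - (1 + a3)); first by ring.
    by rewrite e1 subrr.
  - rewrite rE b3E in e2; rewrite b3E; apply/eqP; rewrite -subr_eq0; apply/eqP.
    transitivity (ka * (1 + b4) - (- ka ^+ 2 + b4)); first by ring.
    by rewrite e2 subrr.
rewrite subr_eq0 => /eqP rE; exfalso.
have a3E : a3 = - (1 + ka ^+ 2 + b4) by rewrite -rE /r; ring.
suff b4E : b4 = ka.
  have a3t : a3 = - (1 + ka + ka ^+ 2) by rewrite a3E b4E; ring.
  have a4t : a4 = - (ka + ka ^+ 2) by rewrite a4E a3t; ring.
  by move: nd rel; rewrite a3t a4t b3E b4E => nd rel; exact: antisymmetric_not_full full nd rel.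
case: (eqVneq ka 1) => [ka1|ka1]; last first.
  have h0 : 1 - ka != 0 by rewrite subr_eq0 eq_sym.
  apply: (mulfI h0); apply/eqP; rewrite -subr_eq0; apply/eqP.
  transitivity (r + b4 - ka * b3); first by rewrite rE b3E; ring.
  by rewrite e2 subrr.
rewrite ka1; set c := b3; have b4c : b4 = c - 1 by rewrite /c b3E addrC addKr.
have a3c : a3 = - (1 + c) by rewrite a3E ka1 b4c; ring.
have a4c : a4 = - c by rewrite a4E a3c; ring.
have c0 : c != 0.
  have := moving_neq0 (indep_even full rel nd) n1; apply: contraNneq => cz.
  apply/eqP/colP => i; rewrite [RHS]mxE movingE; case: (ord2 i) => ->; rewrite !(pt0, pt1) rE ka1.
    by rewrite a3c cz; ring.
  by rewrite -/c cz; ring.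
have [P [_ hP _]] := isform_line (pt 1 1) (pt 1 0) (isform_bev_ev F (pt 1 0)).
have Pz z : P.[z] * z ^+ 2 = - k * c * (z + c) * z *
    (z ^+ 3 + 4 * c * z ^+ 2 + (6 * c ^+ 2 - c ^+ 4) * z + (4 * c ^+ 3 - 2 * c ^+ 4)).
  have := rel (pt (1 + z) 1) (pt 1 0).
  rewrite /= !moving_pt !cross_pt pt0 pt1 -/c a3c a4c b4c hP => h.
  have -> : pt 1 1 + z *: pt 1 0 = pt (1 + z) 1 :> 'cV[C]_2.
    by apply/colP => i; rewrite !mxE; case: eqP => _; ring.
  transitivity ((((1 + z) * 1 + 1 * - (1 + c)) * ((1 + z) * 1 + 1 * (c - 1))
     - ((1 + z) * 0 + 1 * c) * ((1 + z) * 0 + 1 * - c))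
     * bev (ev F (pt (1 + z) 1)) (pt 1 0)); last by rewrite h; ring.
  by ring.
pose M : {poly C} := Poly [:: 4 * c ^+ 3 - 2 * c ^+ 4; 6 * c ^+ 2 - c ^+ 4; 4 * c; 1].
have z0 : P * 'X + (k * c) *: (('X + c%:P) * M) = 0.
  apply: (@poly_generic0 _ 'X); first by rewrite polyX_eq0.
  move=> z; rewrite hornerX => zn; apply: (mulIf zn).
  rewrite mul0r hornerD hornerM hornerX hornerZ hornerM hornerD hornerX hornerC horner_Poly /=.
  transitivity (P.[z] * z ^+ 2 + k * c * (z + c) * z * (z ^+ 3 + 4 * c * z ^+ 2
    + (6 * c ^+ 2 - c ^+ 4) * z + (4 * c ^+ 3 - 2 * c ^+ 4))); first by ring.
  by rewrite Pz; ring.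
have := congr1 (fun p : {poly C} => p.[0]) z0.
rewrite /= hornerD hornerM hornerX hornerZ hornerM hornerD hornerX hornerC horner_Poly /= horner0.
rewrite !mulr0 !add0r => h.
have nz : k * c * c * (2 * c ^+ 3) != 0.
  by rewrite (mulf_neq0 (mulf_neq0 (mulf_neq0 k0 c0) c0)) // (mulf_neq0 (two_neq0 R)) // expf_neq0.
have c2 : 2 - c = 0 by apply: (mulfI nz); rewrite mulr0 -[RHS]h; ring.
rewrite b4c; apply/eqP; rewrite -subr_eq0 -oppr_eq0; apply/eqP; rewrite -[RHS]c2; ring.
Qed.

(** Rescaling the coordinates of the source moves one zero of the discriminant
    to X = Y, and a diagonal element of the binary octahedral group then makes
    the two columns equal there. *)
Lemma deg3_normal_form m g h F (k : C) : lift_of 3 m g h F -> linearly_full (ev F) ->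
  k != 0 -> (forall q, \det (g q) = k * h q) ->
  (forall q, g q = g (flip q) *m face R) ->
  exists t a3 a4 b3 b4 : C, [/\ t <> 0, unique_perpendicular_plane t (plane a3 a4 b3 b4)
    & equivalent (@square R) g (@square R) (g_deg3 (plane a3 a4 b3 b4))].
Proof.
move=> lift full k0 Dh gE; have [hg _ _ _ _] := lift.
have [al [ga [be [de /funext gc]]]] := cubic_of_face hg gE.
rewrite {}gc in lift Dh *; have [rel nd] := cubic_relation_of_lift lift Dh.
have ax := discr_x k0 full rel nd; have ay := discr_y k0 full rel nd.
have [r rE] := quadratic_root (cross al de + cross ga be) (cross ga de) ax.
have n1 : pt r 1 != 0 :> 'cV[C]_2 by rewrite pt_eq0 oner_eq0 andbF.
have d0 : cross (moving al ga (pt r 1)) (moving be de (pt r 1)) = 0.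
  by rewrite -[RHS]rE /cross !movingE pt0 pt1; ring.
have r0 : r != 0.
  apply: contraNneq ay => z; rewrite -[X in _ == X]rE z; apply/eqP; ring.
have [ka [oE ka4]] := discr_ratio k0 full rel nd n1 d0.
rewrite pt0 pt1 expr1n mulr1 in ka4.
have [rho rho2] : exists rho : C, rho ^+ 2 = r by exists (sqrtC r); rewrite sqrtCK.
have rho0 : rho != 0 by apply: contraNneq r0 => z; rewrite -rho2 z expr0n.
have [z [z2 z8]] : exists z : C, z ^+ 2 = ka / rho /\ z ^+ 8 = 1.
  by apply: sqrt_eighth; rewrite expr_div_n -ka4 -rho2 -exprM divff // expf_neq0.
have z0 : z != 0.
  by apply/eqP => zz; move/eqP: z8; rewrite zz expr0n eq_sym oner_eq0.
pose s := mat2 rho 0 0 1 : 'M[C]_2; pose S := mat2 r 0 0 1 : 'M[C]_2.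
have us : s \in unitmx by rewrite unitmx_mat2 mulr1 mulr0 subr0.
have uS : S \in unitmx by rewrite unitmx_mat2 mulr1 mulr0 subr0.
have sE q : s *m q = pt (rho * q 0 0) (q 1 0).
  by rewrite [LHS]pt_eta !mulcol2 !mat2E; congr pt; ring.
have sS q : square (s *m q) = S *m square q.
  rewrite [LHS]pt_eta [RHS]pt_eta !mulcol2 !mat2E sE !square0 !square1 pt0 pt1 -rho2.
  by congr pt; ring.
have SB := S4star_diag8 z8.
pose P := mat2 (z * rho * r * al 0 0) (z^-1 * r * be 0 0)
               (z * rho * r * al 1 0) (z^-1 * r * be 1 0).
have uP : P \in unitmx.
  rewrite unitmx_mat2 (_ : _ - _ = z / z * rho * r ^+ 2 * cross al be); last by rewrite /cross; ring.
  by rewrite divff // mul1r (mulf_neq0 (mulf_neq0 rho0 (expf_neq0 2 r0))).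
pose c := invmx P *m ((z * rho) *: ga); pose d := invmx P *m (z^-1 *: de).
have Pc i : P i 0 * c 0 0 + P i 1 * c 1 0 = z * rho * ga i 0.
  by rewrite -mulcol2 /c mulKVmx // scE.
have Pd i : P i 0 * d 0 0 + P i 1 * d 1 0 = z^-1 * de i 0.
  by rewrite -mulcol2 /d mulKVmx // scE.
have cd : pt 1 0 + c = pt 0 1 + d.
  have Pc' : P *m c = (z * rho) *: ga := mulKVmx uP _.
  have Pd' : P *m d = z^-1 *: de := mulKVmx uP _.
  suff hcd : P *m (pt 1 0 + c) = P *m (pt 0 1 + d) by rewrite -[LHS](mulKmx uP) hcd (mulKmx uP).
  clearbody c d; rewrite 2!mulmxDr Pc' Pd'.
  have zr : z * rho = z^-1 * ka by apply: (mulfI z0); rewrite mulVKf // mulrA -expr2 z2 divfK.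
  have hP (x y : C) i : (P *m pt x y) i 0 = P i 0 * x + P i 1 * y.
    by rewrite mulcol2 pt0 pt1.
  have oi i : r * be i 0 + de i 0 = ka * (r * al i 0 + ga i 0).
    have := congr1 (fun v : 'cV[C]_2 => v i 0) oE.
    by rewrite /= scE !movingE pt0 pt1 !mul1r.
  apply/colP => i; rewrite [LHS]mxE [RHS]mxE !hP !scE !mulr1 !mulr0 addr0 add0r.
  transitivity (z * rho * (r * al i 0 + ga i 0)).
    by case: (ord2 i) => ->; rewrite /P mat2E; ring.
  rewrite zr -mulrA -oi.
  by case: (ord2 i) => ->; rewrite /P mat2E; ring.
have GE : (fun q => invmx P *m cubic al ga be de (s *m q) *m (diag2 z)^T) =
    cubic (pt 1 0) (pt (c 0 0) (c 1 0)) (pt 0 1) (pt (d 0 0) (d 1 0)).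
  have P0 i : P i 0 = z * rho * r * al i 0 by case: (ord2 i) => ->; rewrite /P mat2E.
  have P1 i : P i 1 = z^-1 * r * be i 0 by case: (ord2 i) => ->; rewrite /P mat2E.
  have tE i j : (diag2 z)^T i j = diag2 z j i by rewrite mxE.
  clear oE; clearbody c d; clearbody P; apply: funext => q; rewrite -mulmxA.
  apply: (can_inj (mulKmx uP)); rewrite (mulKVmx uP).
  have col0 i : (cubic al ga be de (s *m q) *m (diag2 z)^T) i 0 =
      (P *m cubic (pt 1 0) (pt (c 0 0) (c 1 0)) (pt 0 1) (pt (d 0 0) (d 1 0)) q) i 0.
    rewrite !mulmx2 !tE !mat2E !cubic_col0 sE !pt0 !pt1.
    transitivity (q 0 0 * (q 0 0 ^+ 2 * (P i 0) + q 1 0 ^+ 2 * (P i 0 * c 0 0 + P i 1 * c 1 0))).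
      by rewrite Pc P0 -rho2; ring.
    by ring.
  have col1 i : (cubic al ga be de (s *m q) *m (diag2 z)^T) i 1 =
      (P *m cubic (pt 1 0) (pt (c 0 0) (c 1 0)) (pt 0 1) (pt (d 0 0) (d 1 0)) q) i 1.
    rewrite !mulmx2 !tE !mat2E !cubic_col1 sE !pt0 !pt1.
    transitivity (q 1 0 * (q 0 0 ^+ 2 * (P i 1) + q 1 0 ^+ 2 * (P i 0 * d 0 0 + P i 1 * d 1 0))).
      by rewrite Pd P1 -rho2; ring.
    by ring.
  by apply: mx2P.
have uA : invmx P \in unitmx by rewrite unitmx_inv.
clearbody c d; clearbody P.
have [h' [F' [k' [lift' full' k0' Dh']]]] := lift_transport lift full us sS uS uA SB k0 Dh.
have GEq q := congr1 (fun G => G q) GE.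
move: lift' Dh'; rewrite GE => lift' Dh'.
have Dh2 q : \det (cubic (pt 1 0) (pt (c 0 0) (c 1 0)) (pt 0 1) (pt (d 0 0) (d 1 0)) q) = k' * h' q.
  by rewrite -Dh' -GEq.
have [rel' nd'] := cubic_relation_of_lift lift' Dh2.
have [s1 [s10 eqs]] : exists s1, s1 != 0 /\ plane_eqs s1 (c 0 0) (d 0 0) (c 1 0) (d 1 0).
  apply: (cubic_parameter k0' full' rel' nd').
    have := congr1 (fun v : 'cV[C]_2 => v 0 0) cd.
    by rewrite /= !mxE /= add0r => ->.
  have := congr1 (fun v : 'cV[C]_2 => v 1 0) cd.
  by rewrite /= !mxE /= add0r => ->.
pose J := xi1 R ^+ 2; have J0 : J != 0 by rewrite expf_neq0 // xi_neq0.
exists (s1 / J), (c 0 0), (d 0 0), (c 1 0), (d 1 0); split.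
- by apply/eqP; rewrite mulf_neq0 ?invr_eq0.
- apply: plane_unique; apply: (proj2 (perpendicular_eqs _ _ _ _ _)).
  have -> : xi1 R ^+ 2 * (s1 / J) = s1 by rewrite [LHS]mulrC; exact: (divfK J0).
  exact: eqs.
- have uS' : invmx S \in unitmx by rewrite unitmx_inv.
  have dA : \det (invmx P) != 0 by rewrite -unitfE -unitmxE.
  apply: (equivalentI us uS' dA SB) => q _.
    by rewrite sS (mulKmx uS); exact: peqxx.
  by rewrite g_deg3_cubic -GEq; exact: peqxx.
Qed.

End Degree3Classification.

(** * Reduction to the standard covering *)

Section Reduction.
Variable R : realType.
Local Notation C := R[i].
Implicit Types (q w : 'cV[C]_2) (M A B T S : 'M[C]_2) (F : vform (binform R 6) 6).

Lemma ev_d_comp F F1 S q (a b : C) : (forall q, ev F1 q = ev F (S *m q)) ->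
  a *: ev_dx F1 q + b *: ev_dy F1 q =
  (S *m pt a b) 0 0 *: ev_dx F (S *m q) + (S *m pt a b) 1 0 *: ev_dy F (S *m q).
Proof.
move=> hF; apply: bev_inj => w _.
have [P1 [h1 d1]] := ev_path F1 q (pt a b) w.
have [P [hP d]] := ev_path F (S *m q) (S *m pt a b) w.
have PE : P1 = P; last by rewrite pt0 pt1 PE in d1; exact: etrans (esym d1) d.
by apply: poly_ext => z; rewrite h1 hP hF mulmxDr scalemxAr.
Qed.

Lemma tangent_line_comp F F1 S q : (forall q, ev F1 q = ev F (S *m q)) ->
  (col_mx (ev_dx F1 q) (ev_dy F1 q) <= col_mx (ev_dx F (S *m q)) (ev_dy F (S *m q)))%MS.
Proof.
move=> hF; have e1 := @ev_d_comp F F1 S q 1 0 hF; have e2 := @ev_d_comp F F1 S q 0 1 hF.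
rewrite scale1r scale0r addr0 in e1; rewrite scale1r scale0r add0r in e2.
exact: span2_sub e1 e2.
Qed.

Lemma tangent_comp F F1 S : S \in unitmx -> (forall q, ev F1 q = ev F (S *m q)) ->
  tangent_to_1dim_orbit F1 -> tangent_to_1dim_orbit F.
Proof.
move=> uS hF [q [A [nq dA hp ht]]]; exists (S *m q), A; split=> //.
- exact: unit_mul_neq0.
- by rewrite -hF.
apply: eqmx_trans ht; apply/eqmxP; rewrite tangent_line_comp // andbT.
have hF' q' : ev F q' = ev F1 (invmx S *m q') by rewrite hF mulKVmx.
by have := tangent_line_comp (S *m q) hF'; rewrite mulKmx.
Qed.

(** At the fixed point (1, 0) of the flip the second column of g vanishes,
    while f1 (g (1, 0)) is not 0 in degree 2. *)
Lemma face_not_deg2 (g : 'cV[C]_2 -> 'M[C]_2) h F : lift_of 2 0 g h F ->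
  linearly_full (ev F) -> ~ forall q, g q = g (flip q) *m face R.
Proof.
move=> [_ _ hh lift [q1 [_ d1]]] full gE.
have n1 : pt 1 0 != 0 :> 'cV[C]_2 by rewrite pt_eq0 oner_eq0.
have [h0 hE] := isform0P hh.
have h00 : h0 != 0.
  by move/f1_neq0: d1; apply: contraNneq => z; rewrite lift hE z scale0r.
have fl : flip (pt 1 0) = pt 1 0 :> 'cV[C]_2 by rewrite /flip pt0 pt1 oppr0.
have c1 i : g (pt 1 0) i 1 = 0.
  have e : g (pt 1 0) i 1 = - g (pt 1 0) i 1.
    by rewrite [in LHS]gE fl mulmx2 !mat2E; ring.
  by apply: (mulfI (two_neq0 R)); rewrite mulr0 mulr_natl mulr2n {1}e addNr.
have f0 : f1 (g (pt 1 0)) = 0.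
  by apply: bev_inj => w _; rewrite bev_f1 !c1 bev0 !mul0r subrr /oct !mul0r.
have := full_neq0 full (square_neq0 n1); move/eqP; apply.
by apply: (scalerI h00); rewrite scaler0 -f0 lift hE.
Qed.

(** At (1, 0) the relation g = g edge makes the two linear factors l, m of
    f1 (g) proportional by a primitive eighth root of unity; as det g and with
    it f1 (g) vanish there, l = m = 0. *)
Lemma edge_not_deg3 m (g : 'cV[C]_2 -> 'M[C]_2) h F (k : C) : lift_of 3 m g h F ->
  k != 0 -> (forall q, \det (g q) = k * h q) -> ~ forall q, g q = g (flip q) *m edge R.
Proof.
move=> [_ ng hh lift _] k0 Dh gE; have x0 := xi_neq0 R.
have n1 : pt 1 0 != 0 :> 'cV[C]_2 by rewrite pt_eq0 oner_eq0.
have fl : flip (pt 1 0) = pt 1 0 :> 'cV[C]_2 by rewrite /flip pt0 pt1 oppr0.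
have c1 i : g (pt 1 0) i 1 = - xi1 R * g (pt 1 0) i 0.
  by rewrite [in LHS]gE fl mulmx2 !mat2E; ring.
have h0 : h (pt 1 0) = 0.
  by apply: (mulfI k0); rewrite mulr0 -Dh det2 !c1; ring.
have /eqP := ng _ n1; apply.
have z i : g (pt 1 0) i 0 = 0.
  pose w : 'cV[C]_2 := if i == 0 then pt 0 1 else pt 1 0.
  have := bev_f1 (g (pt 1 0)) w; rewrite lift h0 scale0r bev0 !c1 => e.
  have e6 : (2 * xi1 R) * (g (pt 1 0) 0 0 * w 1 0 - g (pt 1 0) 1 0 * w 0 0) ^+ 6 = 0.
    rewrite -[RHS]oppr0 -[in RHS](mul0r 1) [in RHS]e /oct; move: (xi_4 R).
    set x := xi1 R => x4.
    transitivity (- (x * (1 - x ^+ 4) * - (g (pt 1 0) 0 0 * w 1 0 - g (pt 1 0) 1 0 * w 0 0) ^+ 6)).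
      by rewrite x4; ring.
    by ring.
  move/eqP: e6; rewrite mulf_eq0 (negPf (mulf_neq0 (two_neq0 R) x0)) expf_eq0 /=.
  rewrite /w; case: (ord2 i) => -> /=; rewrite pt0 pt1 !mulr0 ?subr0 ?sub0r ?oppr_eq0 mulr1;
    by move/eqP.
by apply: mx2P; rewrite ?c1 !z ?mulr0 mxE.
Qed.

(** A Galois lift over the standard covering is not projectively invariant
    under the flip: otherwise the half turn would have trivial holonomy. *)
Lemma flip_nontrivial (phi : 'cV[C]_2 -> 'cV[C]_2) G (g : 'cV[C]_2 -> 'M[C]_2) s t :
  galois_lift phi G g -> s \in unitmx -> t \in unitmx ->
  (forall q, t *m phi (s *m q) = square q) ->
  forall c : C, ~ forall q, g (s *m q) = c *: g (s *m flip q).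
Proof.
move=> [_ _ inj] us ut hphi c hc.
pose r := s *m face R *m invmx s.
have phiE q : phi q = invmx t *m square (invmx s *m q).
  by rewrite -hphi (mulKVmx us) (mulKmx ut).
have rE q : r *m q = s *m flip (invmx s *m q) by rewrite flipE /r !mulmxA.
have ur : r \in unitmx.
  rewrite !unitmx_mul us unitmx_inv us andbT /= unitmx_mat2 mul1r mulr0 subr0.
  by rewrite oppr_eq0 oner_eq0.
have dr : deck phi r.
  split=> // q _; rewrite !phiE rE (mulKmx us) square_flip; exact: peqxx.
have d1 : deck phi 1%:M.
  by split; [exact: unitmx1 | move=> q _; rewrite mul1mx; exact: peqxx].
have [|k [k0 rk]] := inj r 1%:M dr d1.
  move=> q nq u1 u2 _; rewrite /holonomy mul1mx mulVmx //.
  have gq : g q = c *: g (r *m q) by rewrite rE -hc (mulKVmx us).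
  exists c; split; last by rewrite gq -scalemxAr mulVmx.
  apply: contraTneq u1 => c0; rewrite gq c0 scale0r.
  by rewrite unitmxE det0 unitr0.
have := @face_nonscalar R k; move/eqP; apply.
have : r *m s = k *: s by rewrite rk -scalemxAl mul1mx.
rewrite /r (mulmxKV us) => e.
by rewrite -[LHS](mulKmx us) e -scalemxAr (mulVmx us) scalemx1.
Qed.

(** Coordinates in which the covering is the squaring map reduce the
    classification to the two normal forms. *)
Lemma classification (phi : 'cV[C]_2 -> 'cV[C]_2) F n (g : 'cV[C]_2 -> 'M[C]_2) :
  galois_covering 2 phi -> sextic_curve F -> curve n g -> galois_lift phi (ev F) g ->
  [/\ n = 2%N \/ n = 3%N,
      n = 2%N ->
        (exists a3 b3 : C, (a3, b3) <> (0, 0) /\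
           equivalent phi g (@square R) (g_deg2 a3 b3)) /\ generally_ramified F
    & n = 3%N ->
        (exists t a3 a4 b3 b4 : C,
           [/\ t <> 0, unique_perpendicular_plane t (plane a3 a4 b3 b4)
             & equivalent phi g (@square R) (g_deg3 (plane a3 a4 b3 b4))]) /\
        exceptional_transversal F].
Proof.
move=> [cphi _] sF cg lg; have [s [t [us ut hphi]]] := degree2_normal_form cphi.
have us' : invmx s \in unitmx by rewrite unitmx_inv.
have ut' : invmx t \in unitmx by rewrite unitmx_inv.
have [F1 hF1] := vform_comp F (invmx t).
have sF1 : sextic_curve F1 := sextic_comp ut' hF1 sF.
have hF q : ev F q = ev F1 (t *m q) by rewrite hF1 (mulKmx ut).
pose g1 q := g (s *m q).
have F1E q : ev F1 (square q) = ev F (phi (s *m q)) by rewrite -hphi -hF.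
have cg1 : curve n g1.
  apply: mx_curve => [i j|q nq]; first exact: (isform_comp s (isform_curve i j cg)).
  exact: (proj2 cg) (unit_mul_neq0 us nq).
have nflip := flip_nontrivial lg us ut hphi; case: lg => [[q1 [nq1 f1q1]] rel _].
have [] := lift_standard cg1 sF1 _ _ nflip.
- exists (invmx s *m q1); rewrite /g1 (mulKVmx us); split=> //.
  exact: unit_mul_neq0 us' nq1.
- by move=> q nq hq; rewrite F1E; exact: rel (unit_mul_neq0 us nq) hq.
move=> B [m [h [SB [lift mn n23 kD hol]]]].
have full1 : linearly_full (ev F1) by case: sF1.
have eq1 : equivalent phi g (@square R) (fun q => g1 q *m B^T).
  have d1 : \det (1%:M : 'M[C]_2) != 0 by rewrite det1 oner_eq0.
  apply: (equivalentI us ut d1 SB) => q _; first by rewrite hphi; exact: peqxx.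
  by rewrite mul1mx; exact: peqxx.
split=> // n_eq.
- have m0 : m = 0 by move: mn; rewrite n_eq; lia.
  rewrite n_eq m0 in lift; case: hol => hol; first by case: (face_not_deg2 lift full1 hol).
  have [a [b [nab eq2 tan]]] := deg2_normal_form lift full1 hol; split.
    by exists a, b; split=> //; exact: equivalent_trans eq1 eq2.
  by split=> //; exact: tangent_comp ut' hF1 tan.
- have [k [k0 Dh]] := kD n_eq; have m6 : m = (2 * 3)%N by move: mn; rewrite n_eq; lia.
  rewrite n_eq m6 in lift; case: hol => hol; last by case: (edge_not_deg3 lift k0 Dh hol).
  have [t' [a3 [a4 [b3 [b4 [t0 up eq2]]]]]] := deg3_normal_form lift full1 k0 Dh hol; split.
    by exists t', a3, a4, b3, b4; split=> //; exact: equivalent_trans eq1 eq2.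
  split=> // tan; exact: (lift_exceptional lift full1 k0 Dh) (tangent_comp ut hF tan).
Qed.

End Reduction.

Theorem theorem4p1 (R : realType) :
  (* classification *)
  (forall (phi : 'cV[R[i]]_2 -> 'cV[R[i]]_2) (F : vform (binform R 6) 6)
          (n : nat) (g : 'cV[R[i]]_2 -> 'M[R[i]]_2),
     galois_covering 2 phi -> sextic_curve F -> curve n g ->
     galois_lift phi (ev F) g ->
     [/\ n = 2%N \/ n = 3%N,
         n = 2%N ->
           (exists a3 b3 : R[i], (a3, b3) <> (0, 0) /\
              equivalent phi g (@square R) (g_deg2 a3 b3)) /\
           generally_ramified F
       & n = 3%N ->
           (exists t a3 a4 b3 b4 : R[i],
              [/\ t <> 0, unique_perpendicular_plane t (plane a3 a4 b3 b4)
                & equivalent phi g (@square R) (g_deg3 (plane a3 a4 b3 b4))]) /\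
           exceptional_transversal F]) /\
  (* the family of degree 2, with parameter in P^1 *)
  [/\ forall a3 b3 : R[i], (a3, b3) <> (0, 0) ->
        curve 2 (g_deg2 a3 b3) /\
        (linearly_full (fun q => f1 (g_deg2 a3 b3 q)) ->
         exists F : vform (binform R 6) 6,
           galois_lift (@square R) (ev F) (g_deg2 a3 b3) /\
           generally_ramified F),
      forall a3 b3 a3' b3' : R[i], (a3, b3) <> (0, 0) -> (a3', b3') <> (0, 0) ->
        (equivalent (@square R) (g_deg2 a3 b3) (@square R) (g_deg2 a3' b3') <->
         same_parameter (a3, b3) (a3', b3'))
    & exists e : seq (R[i] * R[i]),
        (forall p, p \in e -> p <> (0, 0)) /\
        forall a3 b3 : R[i], (a3, b3) <> (0, 0) ->
          (forall p, p \in e -> ~ same_parameter (a3, b3) p) ->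
          linearly_full (fun q => f1 (g_deg2 a3 b3 q))] /\
  (* the family of degree 3, with parameter in C \ {0} *)
  [/\ forall t a3 a4 b3 b4 : R[i], t <> 0 ->
        unique_perpendicular_plane t (plane a3 a4 b3 b4) ->
        linearly_full (fun q => f1 (g_deg3 (plane a3 a4 b3 b4) q)) ->
        curve 3 (g_deg3 (plane a3 a4 b3 b4)) /\
        exists F : vform (binform R 6) 6,
          galois_lift (@square R) (ev F) (g_deg3 (plane a3 a4 b3 b4)) /\
          exceptional_transversal F
    & exists e : seq R[i],
        forall t : R[i], t <> 0 -> t \notin e ->
          exists a3 a4 b3 b4 : R[i],
            unique_perpendicular_plane t (plane a3 a4 b3 b4) /\
            linearly_full (fun q => f1 (g_deg3 (plane a3 a4 b3 b4) q))].
Proof.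
split; first by move=> phi F n g; exact: classification.
split; split.
- by move=> a b; exact: deg2_family.
- by move=> a b a' b'; exact: g_deg2_parameter.
- exact: deg2_generic.
- by move=> t a3 a4 b3 b4; exact: deg3_family.
- exact: deg3_generic.
Qed.
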